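(* Let $\Gamma$ be a simplicial graph with countable (finite or infinite) vertex set $S$ such that the opposite graph $\Gamma^{\rm opp}$ has no isolated vertices. Then the universal C*-algebra with generators $\{V_s : s\in S\}$ subject to the relations (1) $V_s^*V_s=1$ for each $s\in S$; (2) $V_sV_t=V_tV_s$ and $V_s^*V_t=V_tV_s^*$ if $s$ and $t$ are adjacent in $\Gamma$; (3) $V_s^*V_t=0$ if $s$ and $t$ are distinct and not adjacent in $\Gamma$; (4) $\prod_{s\in S_\lambda}(1-V_sV_s^* )=0$ for each $S_\lambda\subset S$ spanning a finite connected component of $\Gamma^{\rm opp}$, is canonically isomorphic (via $V_s\mapsto 1_s\delta_s$) to the boundary quotient $C(\partial\Omega)\rtimes A_\Gamma$ for $(A_\Gamma,A_\Gamma^+)$, and it is purely infinite and simple.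
   Context: Right-angled Artin groups: $A_\Gamma=\langle S \mid ab=ba \text{ if } \{a,b\}\text{ is an edge of }\Gamma\rangle$, and $A_\Gamma^+$ is the submonoid generated by $S$. The opposite graph $\Gamma^{\rm opp}$ has vertex set $S$, and two distinct vertices are joined in $\Gamma^{\rm opp}$ iff they are not joined in $\Gamma$. The pair $(G,P)=(A_\Gamma,A_\Gamma^+)$ is quasi-lattice ordered: $P\cap P^{-1}=\{e\}$, and with the left-invariant partial order $x\le y\iff x^{-1}y\in P$ every two elements of $G$ with a common upper bound have a least upper bound $x\vee y$ (write $x\vee y=\infty$ if there is no common upper bound). Nica spectrum: $\Omega$ is the set of subsets $\omega\subset G$ with $e\in\omega$ that are hereditary ($\omega P^{-1}\subset\omega$) and directed ($x\vee y$ exists and lies in $\omega$ for all $x,y\in\omega$), with the topology inherited from $\{0,1\}^G$ (compact Hausdorff). $G$ acts partially on $\Omega$: for $t\in G$, $U_t=\{\omega: t\in\omega\}$ and $\theta_t:U_{t^{-1}}\to U_t$, $\omega\mapsto t\omega$. The boundary spectrum $\partial\Omega$ is the closure in $\Omega$ of the set of maximal directed subsets of $G$ containing $e$ (these are automatically hereditary); it is closed and invariant. Crossed products: for a closed invariant $X\subset\Omega$, let $D_t=C_0(U_t\cap X)$ and $\alpha_t:D_{t^{-1}}\to D_t$, $f\mapsto f\circ\theta_{t^{-1}}$. Then $C(X)\rtimes G$ is the (full) partial crossed product: the universal C*-completion of the $*$-algebra of finite sums $\sum f_t\delta_t$, $f_t\in D_t$, with $(f\delta_s)(g\delta_t)=\alpha_s(\alpha_{s^{-1}}(f)g)\delta_{st}$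 and $(f\delta_t)^*=\alpha_{t^{-1}}(\bar f)\delta_{t^{-1}}$. $1_t$ denotes the characteristic function of $U_t\cap X$. The boundary quotient is $C(\partial\Omega)\rtimes G$. Convention: a unital C*-algebra $B$ is called purely infinite and simple if $B\neq0$ and for every nonzero $x\in B$ there are $a,b\in B$ with $axb=1$ (for $B\ne\mathbb C$ this is Cuntz's standard characterisation of unital simple purely infinite C*-algebras). *)

(* Defs.v *)
From HB Require Import structures.
From mathcomp Require Import all_boot all_order all_algebra finmap.
From mathcomp Require Import complex.
From mathcomp Require Import all_classical all_reals all_analysis.

Set Implicit Arguments.
Unset Strict Implicit.
Unset Printing Implicit Defensive.
Import Order.TTheory GRing.Theory Num.Theory.
Import numFieldNormedType.Exports.

Local Open Scope classical_set_scope.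
Local Open Scope ring_scope.

(* The product is part of the mixin because the library has no structure that
   joins a normed module with a ring; the ring structure of a C*-algebra is
   derived right below.  It is a [pzRingType], in which 1 = 0 is allowed, since
   the zero algebra is a unital C*-algebra. *)
HB.mixin Record isCStarAlgebra (R : realType) A
    of CompleteNormedModule R[i] A := {
  cstar_one : A;
  cstar_mul : A -> A -> A;
  star : A -> A;
  cstar_mulA : associative cstar_mul;
  cstar_mul1 : left_id cstar_one cstar_mul;
  cstar_mulr1 : right_id cstar_one cstar_mul;
  cstar_mulDl : left_distributive cstar_mul +%R;
  cstar_mulDr : right_distributive cstar_mul +%R;
  cstar_scalerAl : forall (c : R[i]) x y,
    c *: cstar_mul x y = cstar_mul (c *: x) y;
  cstar_scalerAr : forall (c : R[i]) x y,
    c *: cstar_mul x y = cstar_mul x (c *: y);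
  starD : {morph star : x y / x + y};
  starZ : forall (c : R[i]) x, star (c *: x) = c^* *: star x;
  starM : forall x y, star (cstar_mul x y) = cstar_mul (star y) (star x);
  starK : involutive star;
  cstar_normM : forall x y, `|cstar_mul x y| <= `|x| * `|y|;
  cstar_norm : forall x, `|cstar_mul (star x) x| = `|x| ^+ 2
}.

#[short(type="cstarType")]
HB.structure Definition CStarAlgebra (R : realType) :=
  {A of CompleteNormedModule R[i] A & isCStarAlgebra R A}.

HB.instance Definition _ (R : realType) (A : cstarType R) :=
  GRing.Zmodule_isPzRing.Build A
    (@cstar_mulA R A) (@cstar_mul1 R A) (@cstar_mulr1 R A)
    (@cstar_mulDl R A) (@cstar_mulDr R A).

Definition star_hom (R : realType) (A B : cstarType R) (f : A -> B) : Prop :=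
  [/\ linear f, monoid_morphism f & forall x, f (star x) = star (f x)].

Definition purely_infinite_simple (R : realType) (B : cstarType R) : Prop :=
  (exists x : B, x <> 0) /\
  (forall x : B, x <> 0 -> exists a b : B, a * x * b = 1).

Section RightAngledArtinGroup.
Variables (S : countType) (e : rel S).

(* The letter (s, true) stands for s and (s, false) for s^-1. *)
Inductive raag_cong : seq (S * bool) -> seq (S * bool) -> Prop :=
| RaagRefl u : raag_cong u u
| RaagSym u v : raag_cong u v -> raag_cong v u
| RaagTrans u v w : raag_cong u v -> raag_cong v w -> raag_cong u w
| RaagCancel u s b v :
    raag_cong (u ++ [:: (s, b); (s, ~~ b)] ++ v) (u ++ v)
| RaagComm u s t v : e s t ->
    raag_cong (u ++ [:: (s, true); (t, true)] ++ v)
              (u ++ [:: (t, true); (s, true)] ++ v).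

Definition raag_rel (u v : seq (S * bool)) : bool := `[< raag_cong u v >].

Lemma raag_rel_refl : reflexive raag_rel.
Proof. by move=> u; apply/asboolP/RaagRefl. Qed.

Lemma raag_rel_sym : symmetric raag_rel.
Proof. by move=> u v; apply/asboolP/asboolP; apply: RaagSym. Qed.

Lemma raag_rel_trans : transitive raag_rel.
Proof.
move=> v u w /asboolP uv /asboolP vw; apply/asboolP; exact: RaagTrans uv vw.
Qed.

Canonical raag_equiv :=
  EquivRel raag_rel raag_rel_refl raag_rel_sym raag_rel_trans.

Definition raag := {eq_quot raag_equiv}%qT.
HB.instance Definition _ := Choice.on raag.

Definition raag_class (u : seq (S * bool)) : raag := (\pi_({eq_quot raag_equiv}) u)%qT.
Definition raag_repr (x : raag) : seq (S * bool) := repr x.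

Lemma raag_reprK x : raag_class (raag_repr x) = x.
Proof. exact: reprK. Qed.

Lemma raag_classP u v : raag_class u = raag_class v <-> raag_cong u v.
Proof.
split=> [/eqP|uv]; last by apply/eqP; rewrite /raag_class eqmodE; apply/asboolP.
by rewrite /raag_class eqmodE => /asboolP.
Qed.

Lemma raag_repr_class u : raag_cong (raag_repr (raag_class u)) u.
Proof. by apply/raag_classP; rewrite raag_reprK. Qed.

Lemma raag_cong_cat u u' v v' :
  raag_cong u u' -> raag_cong v v' -> raag_cong (u ++ v) (u' ++ v').
Proof.
move=> uu' vv'; apply: (@RaagTrans _ (u' ++ v)).
  elim: uu' v {vv'} => {u u'} [u|u u' _ IH|u u' u'' _ IH1 _ IH2|u s b w|u s t w est] v.
  - exact: RaagRefl.
  - exact: RaagSym.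
  - exact: RaagTrans (IH1 v) (IH2 v).
  - rewrite -!catA; exact: RaagCancel.
  - rewrite -!catA; exact: RaagComm.
elim: vv' => {v v'} [v|v v' _ IH|v v' v'' _ IH1 _ IH2|v s b w|v s t w est].
- exact: RaagRefl.
- exact: RaagSym.
- exact: RaagTrans IH1 IH2.
- rewrite catA [u' ++ v ++ w]catA; exact: RaagCancel.
- rewrite catA [u' ++ v ++ _ ++ w]catA; exact: RaagComm.
Qed.

Definition raag_winv (u : seq (S * bool)) := rev [seq (l.1, ~~ l.2) | l <- u].

Lemma raag_winvK : involutive raag_winv.
Proof.
move=> u; rewrite /raag_winv map_rev revK -map_comp.
by rewrite (eq_map (_ : _ =1 id)) ?map_id // => -[s b] /=; rewrite negbK.
Qed.

Lemma raag_cong_winvr u : raag_cong (u ++ raag_winv u) [::].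
Proof.
elim: u => [|[s b] u IH]; first exact: RaagRefl.
apply: (@RaagTrans _ ([:: (s, b)] ++ [::] ++ [:: (s, ~~ b)])); last first.
  exact: (RaagCancel [::] s b [::]).
rewrite /raag_winv /= rev_cons -cats1 -cat_cons catA -cat1s -!catA [u ++ _]catA.
exact: raag_cong_cat (RaagRefl [:: _]) (raag_cong_cat IH (RaagRefl [:: _])).
Qed.

Lemma raag_cong_winvl u : raag_cong (raag_winv u ++ u) [::].
Proof. by rewrite -{2}[u]raag_winvK; exact: raag_cong_winvr. Qed.

Definition raag_one : raag := raag_class [::].
Definition raag_mul (x y : raag) : raag := raag_class (raag_repr x ++ raag_repr y).
Definition raag_inv (x : raag) : raag := raag_class (raag_winv (raag_repr x)).

Lemma raag_mulE u v : raag_mul (raag_class u) (raag_class v) = raag_class (u ++ v).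
Proof. by apply/raag_classP/raag_cong_cat; exact: raag_repr_class. Qed.

Lemma raag_mulA : associative raag_mul.
Proof.
move=> x y z.
by rewrite -[x]raag_reprK -[y]raag_reprK -[z]raag_reprK !raag_mulE catA.
Qed.

Lemma raag_mul1 : left_id raag_one raag_mul.
Proof. by move=> x; rewrite -[x]raag_reprK raag_mulE. Qed.

Lemma raag_mulr1 : right_id raag_one raag_mul.
Proof. by move=> x; rewrite -[x]raag_reprK raag_mulE cats0. Qed.

Lemma raag_mulV : left_inverse raag_one raag_inv raag_mul.
Proof.
move=> x; rewrite -{2}[x]raag_reprK raag_mulE.
by apply/raag_classP; exact: raag_cong_winvl.
Qed.

Lemma raag_mulrV : right_inverse raag_one raag_inv raag_mul.
Proof.
move=> x; rewrite -{1}[x]raag_reprK raag_mulE.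
by apply/raag_classP; exact: raag_cong_winvr.
Qed.

HB.instance Definition _ :=
  isGroup.Build raag raag_mulA raag_mul1 raag_mulr1 raag_mulV raag_mulrV.

Definition raag_gen (s : S) : raag := raag_class [:: (s, true)].

Definition raag_pos : set raag :=
  [set g | exists w : seq S, g = (\prod_(s <- w) raag_gen s)%g].

Definition opp_adj : rel S := [rel s t | (s != t) && ~~ e s t].

Definition opp_component (C : set S) : Prop :=
  exists s, C = [set t | exists2 p, path opp_adj s p & t = last s p].

End RightAngledArtinGroup.

(* Subsets of G, as points of {0,1}^G with the product topology. *)
Notation subsets G := {ptws G -> bool}.

Section NicaSpectrum.
Variables (G : groupType) (P : set G).

Definition qle (x y : G) : Prop := P (x^-1 * y)%g.

Definition is_join (x y z : G) : Prop :=
  [/\ qle x z, qle y z & forall w, qle x w -> qle y w -> qle z w].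

Definition hereditary (w : subsets G) : Prop :=
  forall x p, w x -> P p -> w (x * p^-1)%g.

Definition directed (w : subsets G) : Prop :=
  forall x y, w x -> w y -> exists2 z, is_join x y z & w z.

Definition nica_spectrum : set (subsets G) :=
  [set w : subsets G | [/\ w 1%g, hereditary w & directed w]].

Definition maximal_directed (w : subsets G) : Prop :=
  directed w /\
  forall w' : subsets G, directed w' -> (forall x, w x -> w' x) -> w' = w.

Definition boundary_spectrum : set (subsets G) :=
  nica_spectrum `&` closure [set w : subsets G | w 1%g /\ maximal_directed w].

Definition translate (t : G) (w : subsets G) : subsets G :=
  fun x => w (t^-1 * x)%g.

End NicaSpectrum.

Section PartialCrossedProduct.
Variables (R : realType) (G : groupType) (X : set (subsets G)).

(* D_t = C_0(U_t `&` X), for X compact and U_t open: the elements of C(X) that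
   vanish outside U_t.  A function on X is represented by its extension by zero
   to all subsets of G. *)
Definition pcp_ideal (t : G) : set (subsets G -> R[i]) :=
  [set f : subsets G -> R[i] | {within X, continuous (f : subsets G -> R[i]^o)} /\ forall w, f w <> 0 -> X w /\ w t].

(* If f is in D_{t^-1} and X is invariant then this function vanishes outside
   of U_t `&` X (as every member of X contains 1), so it is the extension by
   zero of f \o theta_{t^-1} : U_t `&` X -> R[i]. *)
Definition pcp_alpha (t : G) (f : subsets G -> R[i]) : subsets G -> R[i] :=
  fun w => f (translate t^-1%g w).

(* a : pcp stands for the sum over t of (a t) delta_t. *)
Definition pcp : Type := G -> subsets G -> R[i].

Definition pcp_elt : set pcp :=
  [set a | finite_set [set t | a t <> 0] /\ forall t, pcp_ideal t (a t)].

Definition pcp_mono (f : subsets G -> R[i]) (t : G) : pcp :=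
  fun r => if r == t then f else 0.

Definition pcp_char (t : G) : subsets G -> R[i] :=
  fun w => (`[< X w /\ w t >])%:R.

Definition pcp_add (a b : pcp) : pcp := fun r w => a r w + b r w.

Definition pcp_scale (c : R[i]) (a : pcp) : pcp := fun r w => c * a r w.

(* (f delta_s)(g delta_t) = alpha_s (alpha_{s^-1} f * g) delta_{st}, extended
   bilinearly: the coefficient at r collects the pairs (s, t) with s t = r. *)
Definition pcp_mul (a b : pcp) : pcp := fun r w =>
  \sum_(s \in [set: G])
    pcp_alpha s (fun v => pcp_alpha s^-1%g (a s) v * b (s^-1 * r)%g v) w.

(* (f delta_t)^* = alpha_{t^-1} (conj f) delta_{t^-1}; at r we have t = r^-1. *)
Definition pcp_star (a : pcp) : pcp := fun r =>
  pcp_alpha r (fun v => (a r^-1%g v)^*).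

Definition pcp_one : pcp := pcp_mono (pcp_char 1%g) 1%g.

(* Only the values of j on [pcp_elt] matter. *)
Definition pcp_hom (B : cstarType R) (j : pcp -> B) : Prop :=
  [/\ forall a b, pcp_elt a -> pcp_elt b -> j (pcp_add a b) = j a + j b,
      forall c a, pcp_elt a -> j (pcp_scale c a) = c *: j a,
      forall a b, pcp_elt a -> pcp_elt b -> j (pcp_mul a b) = j a * j b,
      forall a, pcp_elt a -> j (pcp_star a) = star (j a) &
      j pcp_one = 1].

(* (B, j) is the universal C*-completion of the *-algebra of finite sums. *)
Definition is_crossed_product (B : cstarType R) (j : pcp -> B) : Prop :=
  pcp_hom j /\
  forall (D : cstarType R) (k : pcp -> D), pcp_hom k ->
    exists! f : B -> D, star_hom f /\ forall a, pcp_elt a -> f (j a) = k a.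

End PartialCrossedProduct.

Definition boundary (S : countType) (e : rel S) : set (subsets (raag e)) :=
  boundary_spectrum (@raag_pos S e).
Arguments boundary {S} e.

Definition is_boundary_quotient (R : realType) (S : countType) (e : rel S)
    (B : cstarType R) (j : pcp R (raag e) -> B) : Prop :=
  is_crossed_product (boundary e) j.

Section Presentation.
Variables (R : realType) (S : countType) (e : rel S).

(* The factors of the last product commute, by the second and third relations,
   so the enumeration of F that \prod uses is immaterial. *)
Definition boundary_relations (A : cstarType R) (V : S -> A) : Prop :=
  [/\ forall s, star (V s) * V s = 1,
      forall s t, e s t ->
        V s * V t = V t * V s /\ star (V s) * V t = V t * star (V s),
      forall s t, s != t -> ~~ e s t -> star (V s) * V t = 0 &
      forall F : {fset S}, opp_component e [set` F] ->
        \prod_(s <- F) (1 - V s * star (V s)) = 0].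

Definition is_universal_cstar (A : cstarType R) (V : S -> A) : Prop :=
  boundary_relations V /\
  forall (D : cstarType R) (W : S -> D), boundary_relations W ->
    exists! f : A -> D, star_hom f /\ forall s, f (V s) = W s.

End Presentation.

(* Main.v *)
(* Every element of the dense *-subalgebra of the universal algebra A is a finite
   sum of terms c V_u V_v^*, with u and v words in S, because V_u^* V_v is
   V_a V_b^* when u a = v b is the least common multiple of u and v, and 0 when
   there is none. Let N be the seminorm given by the regular representation of
   C(boundary) x| G on l^2 of pairs (w, g), w maximal directed.

   Amenability: |x| <= N(x) for finite sums x. If u = v in all terms of x, then x
   is cut by the commuting projections V_u V_u^* into scalars, and the relations
   say that the nonzero pieces are exactly those realized by a maximal directed
   w. If all terms have the same degree u v^-1, pass to x^* x. In general
   |x|^(2^(r+1)) = |(x^* x)^(2^r)|. When each letter occurs as often in u as in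
   v, in every term, the degrees of all powers lie in one finite set. The letters
   are then released one at a time; each admits only linearly many degrees on the
   n-th power. In all cases |x|^(2^r) <= K 2^r N(x)^(2^r), whence |x| <= N(x).

   Hence A -> C(boundary) x| G is isometric, and its range contains the
   characters and so, by uniform approximation, everything. For pure
   infiniteness, given b <> 0 choose a finite sum x close to b and a basis vector
   on which x is large. Conjugating x^* x by some V_z replaces the terms with
   u = v by the squared norm of the image of that vector, and then, because no
   vertex of the opposite graph is isolated, z can be prolonged until all terms
   with u <> v vanish. *)
Require Import Defs.
From HB Require Import structures.
From mathcomp Require Import all_boot all_order all_algebra finmap.
From mathcomp Require Import complex.
From mathcomp Require Import all_classical all_reals all_analysis.
From mathcomp Require Import zify ring lra.

Set Implicit Arguments.
Unset Strict Implicit.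
Unset Printing Implicit Defensive.

(** * Traces and least common multiples *)

(** The group is not amenable in general, and (x^* x)^n may have exponentially many degrees. What
    tames them is that the letter counts of a least common multiple are maxima, not sums: balanced
    sums keep their counts under products, and the count of one letter at most doubles in a
    squaring. Each graded part of x is bounded by N(x) because the coordinate g of the basis vectors
    (w, g) carries the left regular representation. Relation (4) is confined to finite components
    because a pattern imposes finitely many conditions: a path in an infinite component leaves every
    finite set of letters, which gives room for a w that avoids them. Neither universal algebra is
    given in advance: each is a completion of formal expressions under the supremum of the norms in
    all representations. The theorem concerns arbitrary algebras with the universal properties, so
    the density of finite sums is carried over from these models. Contractivity of homomorphisms
    comes from a square root obtained as a Banach fixed point. *)

Section Traces.
Variables (L : eqType) (D : rel L).
Hypothesis D_refl : reflexive D.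
Hypothesis D_sym : symmetric D.
Implicit Types (l m x : L) (u v w p : seq L).

(* [D x y] holds when the letters x and y do not commute. *)
Inductive scong : seq L -> seq L -> Prop :=
| ScongRefl u : scong u u
| ScongTrans u v w : scong u v -> scong v w -> scong u w
| ScongSwap u l m v : ~~ D l m -> scong (u ++ [:: l, m & v]) (u ++ [:: m, l & v]).

Lemma scong_sym u v : scong u v -> scong v u.
Proof.
elim=> {u v} [u|u v w _ uv _ vw|u l m v lm]; first exact: ScongRefl.
  exact: ScongTrans vw uv.
by apply: ScongSwap; rewrite D_sym.
Qed.

Lemma scong_catl p u v : scong u v -> scong (p ++ u) (p ++ v).
Proof.
elim=> {u v} [u|u v w _ uv _ vw|u l m v lm]; first exact: ScongRefl.
  exact: ScongTrans uv vw.
by rewrite !catA; exact: ScongSwap.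
Qed.

Lemma scong_catr p u v : scong u v -> scong (u ++ p) (v ++ p).
Proof.
elim=> {u v} [u|u v w _ uv _ vw|u l m v lm]; first exact: ScongRefl.
  exact: ScongTrans uv vw.
by rewrite -!catA; exact: ScongSwap.
Qed.

Lemma scong_cons l u v : scong u v -> scong (l :: u) (l :: v).
Proof. exact: (@scong_catl [:: l]). Qed.

Lemma scong_perm u v : scong u v -> perm_eq u v.
Proof.
elim=> {u v} [//|u v w _ uv _ vw|u l m v lm]; first exact: perm_trans uv vw.
by rewrite perm_cat2l (perm_catCA [:: l] [:: m] v).
Qed.

(** The projections onto pairs of dependent letters, the pairs (l, l) included, determine a trace:
    congruence and divisibility become equality and the prefix order of plain words. *)
Definition tproj l m u := [seq x <- u | (x == l) || (x == m)].

Lemma proj_cat l m u v : tproj l m (u ++ v) = tproj l m u ++ tproj l m v.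
Proof. exact: filter_cat. Qed.

Lemma projC l m u : tproj l m u = tproj m l u.
Proof. by apply: eq_filter => x; rewrite orbC. Qed.

Definition tr_eq u v := forall l m, D l m -> tproj l m u = tproj l m v.
Definition tr_le u v := forall l m, D l m -> prefix (tproj l m u) (tproj l m v).

Lemma scong_tr u v : scong u v -> tr_eq u v.
Proof.
elim=> {u v} [//|u v w _ uv _ vw l m lm|u x y v xy l m lm].
  by rewrite uv // vw.
rewrite !proj_cat; congr (_ ++ _); rewrite /tproj /=.
have: ~~ (((x == l) || (x == m)) && ((y == l) || (y == m))).
  apply: contra xy => /andP[/orP[]/eqP-> /orP[]/eqP->] //.
  by rewrite D_sym.
by case: (_ || _) => //=; case: (_ || _).
Qed.

Lemma tr_eq_le u v : tr_eq u v -> tr_le u v.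
Proof. by move=> uv l m lm; rewrite uv // prefix_refl. Qed.

Lemma tr_le_trans v u w : tr_le u v -> tr_le v w -> tr_le u w.
Proof. by move=> uv vw l m lm; exact: prefix_trans (uv l m lm) (vw l m lm). Qed.

Lemma tr_le_cat u p : tr_le u (u ++ p).
Proof. by move=> l m _; rewrite proj_cat prefix_prefix. Qed.

Lemma prefix_cat2l p u v : prefix (p ++ u) (p ++ v) = prefix u v.
Proof. by elim: p => //= x p IH; rewrite eqxx. Qed.

Lemma tr_le_catl p u v : tr_le u v -> tr_le (p ++ u) (p ++ v).
Proof.
by move=> uv l m lm; rewrite !proj_cat prefix_cat2l uv.
Qed.

Lemma tr_le_catl_cancel p u v : tr_le (p ++ u) (p ++ v) -> tr_le u v.
Proof.
by move=> uv l m lm; have := uv l m lm; rewrite !proj_cat prefix_cat2l.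
Qed.

(** Decides whether the letter x is a left divisor of the trace u: every letter before the first x
    in u must commute with x. *)
Fixpoint ldiv x u :=
  if u is l :: u' then (x == l) || (~~ D x l && ldiv x u') else false.

Lemma ldiv_scong x u : ldiv x u -> scong u (x :: rem x u).
Proof.
elim: u => //= l u IH; rewrite eq_sym; case: eqP => [->|_] /=.
  by move=> _; exact: ScongRefl.
case/andP=> xl /IH ux; apply: ScongTrans (scong_cons l ux) _.
by apply: (@ScongSwap [::]); rewrite D_sym.
Qed.

Lemma ldiv_le x u : tr_le [:: x] u -> ldiv x u.
Proof.
elim: u => [|l u IH] H.
  by have := H x x (D_refl x); rewrite /tproj /= eqxx.
rewrite /=; case: eqP => //= xl; apply/andP; split.
  (* Otherwise the projection of l :: u onto x and l would begin with l, not with x. *)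
  apply/negP => Dxl; have := H x l Dxl.
  by rewrite /tproj /= !eqxx orbT /=; case: eqP xl.
apply: IH => y z yz; have := H y z yz; rewrite /tproj /=.
case: ifP => [xyz|_ _]; last by rewrite prefix0s.
case: ifP => // _; rewrite prefix_cons.
by case/andP => /eqP.
Qed.

Lemma ldivP x u : ldiv x u <-> tr_le [:: x] u.
Proof.
split=> [/ldiv_scong /scong_sym /scong_tr /tr_eq_le|]; last exact: ldiv_le.
exact/tr_le_trans/(tr_le_cat [:: x]).
Qed.

Lemma ldiv_cons_scong x u p : scong u (x :: p) -> ldiv x u.
Proof.
move=> /scong_sym /scong_tr /tr_eq_le ux; apply/ldivP.
exact: tr_le_trans (tr_le_cat [:: x] p) ux.
Qed.

(** The letters of u are taken off w one at a time: each is a left divisor by [ldivP], so it moves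
    to the front and cancels. *)
Lemma tr_leP u w : tr_le u w <-> exists p, scong w (u ++ p).
Proof.
split; last first.
  by case=> p /scong_sym /scong_tr /tr_eq_le; apply/tr_le_trans/tr_le_cat.
elim: u w => [|l u IH] w H; first by exists w; exact: ScongRefl.
have lw : ldiv l w by apply/ldivP; exact: tr_le_trans (tr_le_cat [:: l] u) H.
have wl := ldiv_scong lw.
have [|p Hp] := IH (rem l w).
  apply: (@tr_le_catl_cancel [:: l]); apply: tr_le_trans H _.
  exact/tr_eq_le/scong_tr.
by exists p; apply: ScongTrans wl (scong_cons l Hp).
Qed.

(** By [tr_leP] v is u followed by some p; the projection onto the pair (x, x) counts x, so no
    letter x can be left in p. *)
Lemma tr_eqP u v : tr_eq u v <-> scong u v.
Proof.
split=> [uv|]; last exact: scong_tr.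
have /tr_leP [p vp] : tr_le u v by exact: tr_eq_le.
case: p vp => [|x p] vp; first by rewrite cats0 in vp; exact: scong_sym.
have := uv x x (D_refl x); rewrite (scong_tr vp) // proj_cat => /(congr1 size).
by rewrite size_cat /tproj /= eqxx /=; lia.
Qed.

Lemma scong_cancell p u v : scong (p ++ u) (p ++ v) -> scong u v.
Proof.
move=> /tr_eqP H; apply/tr_eqP => l m lm; have := H l m lm.
rewrite !proj_cat => /eqP; rewrite eqseq_cat // => /andP[_ /eqP //].
Qed.

Lemma scong_rem x u v : scong u (x :: v) -> scong (rem x u) v.
Proof.
move=> uv; apply: (@scong_cancell [:: x]).
exact: ScongTrans (scong_sym (ldiv_scong (ldiv_cons_scong uv))) uv.
Qed.

Lemma ldiv_eq x u v : scong u v -> ldiv x u = ldiv x v.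
Proof.
move=> uv; apply/idP/idP => /ldiv_scong H.
  exact: ldiv_cons_scong (ScongTrans (scong_sym uv) H).
exact: ldiv_cons_scong (ScongTrans uv H).
Qed.

Lemma ldiv_cat x u v : x \notin u ->
  ldiv x (u ++ v) = all (fun l => ~~ D x l) u && ldiv x v.
Proof.
elim: u => //= l u IH; rewrite inE negb_or => /andP[/negbTE -> xu].
by rewrite IH // andbA.
Qed.

Lemma scong_front x u : all (fun l => ~~ D x l) u -> scong (x :: u) (u ++ [:: x]).
Proof.
elim: u => [_|l u IH /= /andP[xl xu]]; first exact: ScongRefl.
apply: ScongTrans (scong_cons l (IH xu)).
exact: (@ScongSwap [::]).
Qed.

End Traces.

Lemma scong_map (L M : eqType) (D : rel L) (D' : rel M) (f : L -> M) u v :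
  (forall l m, ~~ D l m -> ~~ D' (f l) (f m)) ->
  scong D u v -> scong D' (map f u) (map f v).
Proof.
move=> fD; elim=> {u v} [u|u v w _ uv _ vw|u l m v lm]; first exact: ScongRefl.
  exact: ScongTrans uv vw.
by rewrite !map_cat /=; apply: ScongSwap; exact: fD.
Qed.

Lemma scong_filter (L : eqType) (D : rel L) (a : pred L) u v :
  scong D u v -> scong D (seq.filter a u) (seq.filter a v).
Proof.
elim=> {u v} [u|u v w _ uv _ vw|u l m v lm]; first exact: ScongRefl.
  exact: ScongTrans uv vw.
rewrite !filter_cat /=; case: (a l); case: (a m); try exact: ScongRefl.
exact: ScongSwap.
Qed.

Lemma scong_rev (L : eqType) (D : rel L) u v : symmetric D ->
  scong D u v -> scong D (rev u) (rev v).
Proof.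
move=> Ds; elim=> {u v} [u|u v w _ uv _ vw|u l m v lm]; first exact: ScongRefl.
  exact: ScongTrans uv vw.
rewrite !rev_cat !rev_cons -!cats1 -!catA /=.
by apply: ScongSwap; rewrite Ds.
Qed.

Section Joins.
Variables (S : eqType) (e : rel S).
Hypothesis e_sym : symmetric e.
Hypothesis e_irr : irreflexive e.

Definition dep : rel S := fun s t => ~~ e s t.

Lemma dep_refl : reflexive dep. Proof. by move=> s; rewrite /dep e_irr. Qed.
Lemma dep_sym : symmetric dep. Proof. by move=> s t; rewrite /dep e_sym. Qed.

(* [res u v = Some (a, b)] when u a = v b is the least common multiple of the
   traces u and v, [None] when they have no common multiple. *)
Fixpoint res (u v : seq S) : option (seq S * seq S) :=
  if u is s :: u' then
    if ldiv dep s v then res u' (rem s v)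
    else if all (e s) v then
      if res u' v is Some (a, b) then Some (a, s :: b) else None
    else None
  else Some (v, [::]).

Lemma all_e_scong s v : all (e s) v -> scong dep (s :: v) (v ++ [:: s]).
Proof.
by move=> sv; apply: scong_front; apply: sub_all sv => t st; rewrite /dep negbK.
Qed.

Lemma res_scong u v a b : res u v = Some (a, b) -> scong dep (u ++ a) (v ++ b).
Proof.
elim: u v a b => [|s u IH] v a b /=.
  by case=> <- <-; rewrite cats0; exact: ScongRefl.
case: ifP => [sv /IH H|_].
  apply: ScongTrans (scong_cons s H) _.
  apply: (@scong_catr _ _ b (s :: rem s v)).
  exact: (scong_sym dep_sym (ldiv_scong dep_sym sv)).
case: ifP => // sv; case E: (res u v) => [[a' b']|] // [<- <-].
apply: ScongTrans (scong_cons s (IH _ _ _ E)) _.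
rewrite (_ : v ++ s :: b' = (v ++ [:: s]) ++ b'); last by rewrite -catA.
exact: (scong_catr b' (all_e_scong sv)).
Qed.

(** This controls the letter counts of products in the proof of amenability. *)
Lemma res_count u v a b s : res u v = Some (a, b) ->
  count_mem s (u ++ a) = maxn (count_mem s u) (count_mem s v).
Proof.
elim: u v a b => [|t u IH] v a b /=; first by case=> <- _; rewrite max0n.
case: ifP => [tv /IH ->|tv].
  have /permP -> := scong_perm (ldiv_scong dep_sym tv).
  by rewrite /= addn_maxr.
case: ifP => // etv; case E: (res u v) => [[a' b']|] // [<- _].
rewrite (IH _ _ _ E); case: eqP => [<-|_]; last by [].
have -> : count_mem t v = 0.
  apply/count_memPn/negP => /(allP etv); by rewrite e_irr.
by rewrite !maxn0.
Qed.

(** Conversely to [res_scong], no common multiple is missed, and the computed one is least. The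
    first letter s of u divides w, so either s divides v or it commutes with all letters of v; in
    both cases s cancels from w. *)
Lemma res_join u v w : tr_le dep u w -> tr_le dep v w ->
  exists a b, res u v = Some (a, b) /\ tr_le dep (u ++ a) w.
Proof.
elim: u v w => [|s u IH] v w; first by move=> _ vw; exists v, [::].
move=> /(tr_leP dep_refl dep_sym) [p Hw] vw.
have uw' : tr_le dep u (u ++ p) by exact: tr_le_cat.
have wle : tr_le dep w (s :: u ++ p) by exact: (tr_eq_le (scong_tr dep_refl dep_sym Hw)).
have lew : tr_le dep (s :: u ++ p) w.
  by apply: tr_eq_le; exact: (scong_tr dep_refl dep_sym (scong_sym dep_sym Hw)).
rewrite /=; case: ifP => [sv|sv].
  have [|a [b [E H]]] := IH (rem s v) _ uw'.
    apply: (@tr_le_catl_cancel _ _ [:: s]).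
    apply: tr_le_trans (tr_le_trans vw wle); apply: tr_eq_le; apply: (scong_tr dep_refl dep_sym).
    exact: (scong_sym dep_sym (ldiv_scong dep_sym sv)).
  exists a, b; split=> //; apply: tr_le_trans lew.
  exact: (@tr_le_catl _ _ [:: s]).
case: ifP => esv.
  have [|a [b [E H]]] := IH v _ uw'.
    have vs t : t \in v -> dep s t = false by move=> /(allP esv); rewrite /dep => ->.
    have nil t : dep s t -> tproj s t v = [::].
      move=> st; apply/eqP; rewrite -[_ == _]negbK -has_filter; apply/hasPn => x xv.
      rewrite negb_or; apply/andP; split; apply/eqP => E; move: (vs x xv).
        by rewrite E dep_refl.
      by rewrite E st.
    move=> l m lm; have := tr_le_trans vw wle lm.
    rewrite {2}/tproj /=; case: ifP => // /orP[/eqP E|/eqP E] _; subst s.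
      by rewrite nil ?prefix0s.
    by rewrite projC nil ?prefix0s // dep_sym.
  rewrite E; exists a, (s :: b); split=> //; apply: tr_le_trans lew.
  exact: (@tr_le_catl _ _ [:: s]).
suff : ldiv dep s v || all (e s) v by rewrite sv esv.
(* As w begins with s, so does every nonempty projection of v onto s and a dependent x; the default
   value of [head] covers the empty ones. *)
have {vw lew Hw IH uw'} Q x : dep s x -> head s (tproj s x v) = s.
  move=> sx; have := tr_le_trans vw wle sx; rewrite {2}/tproj /= eqxx /=.
  by case: (tproj s x v) => //= y z /andP[/eqP].
clear -Q; elim: v Q => //= t v IHv Q.
case: (eqVneq s t) => //= st; rewrite {1}/dep negbK.
case est : (e s t) => /=.
  apply: IHv => x sx; have := Q x sx; rewrite /tproj /= eq_sym (negbTE st) /=.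
  by case: eqP => // E; move: sx; rewrite -E /dep est.
by have := Q t; rewrite /dep est /tproj /= !eqxx orbT => /(_ isT) /= /esym/eqP; rewrite (negbTE st).
Qed.

End Joins.

(** * Normal forms in right-angled Artin groups *)

Section RaagWords.
Variables (S : countType) (e : rel S).
Hypothesis e_sym : symmetric e.
Hypothesis e_irr : irreflexive e.
Local Notation L := (S * bool)%type.
Implicit Types (x y : L) (u v w : seq L).

(** Signs are ignored: a letter depends on its own inverse, and swaps alone never move one past the
    other. *)
Definition sdep : rel L := fun x y => dep e x.1 y.1.

Lemma sdep_refl : reflexive sdep. Proof. by move=> x; exact: dep_refl. Qed.
Lemma sdep_sym : symmetric sdep. Proof. by move=> x y; exact: dep_sym. Qed.

Definition linv x : L := (x.1, ~~ x.2).

Lemma linvK : involutive linv.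
Proof. by case=> s b; rewrite /linv /= negbK. Qed.

Lemma sdep_linvl x y : sdep (linv x) y = sdep x y. Proof. by []. Qed.

(** No letter can be moved next to its inverse by swaps; each letter is tested against the suffix
    behind it. *)
Fixpoint reduced u :=
  if u is x :: u' then reduced u' && ~~ ldiv sdep (linv x) u' else true.

(** Left multiplication by a letter on reduced traces, in the manner of van der Waerden: once the
    defining relations hold for this action ([lact_inv], [lact_comm]), congruent words have the same
    normal form up to swaps. *)
Definition lact x u := if ldiv sdep (linv x) u then rem (linv x) u else x :: u.

Definition nform u := foldr lact [::] u.

Local Notation ldiv_eq := (ldiv_eq sdep_refl sdep_sym).
Local Notation ldiv_scong := (ldiv_scong sdep_sym).

Lemma reduced_eq u v : scong sdep u v -> reduced u = reduced v.
Proof.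
elim=> {u v} [//|u v w _ -> //|u x y v xy].
elim: u => [|z u IH] /=; last first.
  rewrite IH; congr (_ && ~~ _); apply: ldiv_eq; exact: ScongSwap.
have nxy : x.1 != y.1 by apply: contra xy => /eqP E; rewrite /sdep E dep_refl.
have ne z t : z.1 != t.1 -> (linv z == t) = false.
  by move=> zt; apply/negbTE; apply: contra zt => /eqP <-.
rewrite (ne x y) // (ne y x) 1?eq_sym // !sdep_linvl xy (sdep_sym y x) xy /=.
by rewrite -!andbA; do 2 ! case: (reduced v) => //=; rewrite andbC.
Qed.

Lemma lact_ldiv x u v : scong sdep u (linv x :: v) -> scong sdep (lact x u) v.
Proof.
move=> uv; rewrite /lact (ldiv_cons_scong sdep_refl sdep_sym uv).
exact: (scong_rem sdep_refl sdep_sym uv).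
Qed.

Lemma lact_scong x u v : scong sdep u v -> scong sdep (lact x u) (lact x v).
Proof.
move=> uv; case E : (ldiv sdep (linv x) v).
  apply: lact_ldiv; rewrite /lact E.
  exact: ScongTrans uv (ldiv_scong E).
by rewrite /lact (ldiv_eq _ uv) E; exact: scong_cons.
Qed.

Lemma lact_reduced x u : reduced u -> reduced (lact x u).
Proof.
rewrite /lact; case: ifP => [ux|ux] ru /=; last by rewrite ru ux.
by move: ru; rewrite (reduced_eq (ldiv_scong ux)) /= => /andP[].
Qed.

Lemma nform_reduced u : reduced (nform u).
Proof. by elim: u => //= x u; exact: lact_reduced. Qed.

Lemma reduced_nform u : reduced u -> nform u = u.
Proof.
by elim: u => //= x u IH /andP[/IH -> ux]; rewrite /lact (negbTE ux).
Qed.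

Lemma lact_inv x u : reduced u -> scong sdep (lact x (lact (linv x) u)) u.
Proof.
move=> ru; rewrite {2}/lact linvK; case: ifP => [ux|ux].
  have E := ldiv_scong ux.
  move: ru; rewrite (reduced_eq E) /= => /andP[_ nx].
  by rewrite /lact (negbTE nx); exact: scong_sym sdep_sym _ _ E.
by apply: lact_ldiv; exact: ScongRefl.
Qed.

Lemma lact_comm x y u : ~~ sdep x y ->
  scong sdep (lact x (lact y u)) (lact y (lact x u)).
Proof.
have swap z t v : ~~ sdep z t -> scong sdep (z :: t :: v) (t :: z :: v).
  exact: (@ScongSwap _ _ [::]).
(* The case in which t finds its inverse in v; whether z cancels as well is read off from the rest
   v'. *)
have half z t v : ~~ sdep z t -> ldiv sdep (linv t) v ->
    scong sdep (lact z (lact t v)) (lact t (lact z v)).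
  move=> zt tv; have E := ldiv_scong tv; set v' := rem _ _ in E.
  apply: ScongTrans (lact_scong z (lact_ldiv E)) _.
  apply: scong_sym; first exact: sdep_sym.
  apply: lact_ldiv; apply: ScongTrans (lact_scong z E) _.
  have nzt : z.1 != t.1 by apply: contra zt => /eqP E'; rewrite /sdep E' dep_refl.
  have ne : (linv z == linv t) = false.
    by apply/negbTE; apply: contra nzt => /eqP [->].
  case E2 : (ldiv sdep (linv z) v').
    have H := ldiv_scong E2.
    apply: ScongTrans (_ : scong sdep (lact z [:: linv t, linv z & rem (linv z) v']) _).
      apply: lact_scong; exact: scong_cons.
    apply: ScongTrans (_ : scong sdep (linv t :: rem (linv z) v') _).
      by apply: lact_ldiv; apply: swap; rewrite sdep_sym.
    apply: scong_cons; apply: scong_sym; first exact: sdep_sym.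
    exact: lact_ldiv.
  rewrite /lact /= ne E2 /= andbF; exact: swap.
move=> xy; case Ex : (ldiv sdep (linv x) u).
  apply: scong_sym; first exact: sdep_sym.
  by apply: half => //; rewrite sdep_sym.
case Ey : (ldiv sdep (linv y) u); first exact: half.
have nxy : x.1 != y.1 by apply: contra xy => /eqP E'; rewrite /sdep E' dep_refl.
have ne z t : z.1 != t.1 -> (linv z == t) = false.
  by move=> zt; apply/negbTE; apply: contra zt => /eqP <-.
rewrite {2}/lact Ey {3}/lact Ex /lact /= !ne // 1?eq_sym // Ex Ey !andbF.
exact: swap.
Qed.

Lemma nform_cat u v : nform (u ++ v) = foldr lact (nform v) u.
Proof. exact: foldr_cat. Qed.

Lemma foldr_lact_scong w u v :
  scong sdep u v -> scong sdep (foldr lact u w) (foldr lact v w).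
Proof. by move=> uv; elim: w => //= x w; exact: lact_scong. Qed.

Lemma raag_cong_nform u v : raag_cong e u v -> scong sdep (nform u) (nform v).
Proof.
elim=> {u v} [u|u v _ IH|u v w _ IH1 _ IH2|u s b v|u s t v st].
- exact: ScongRefl.
- exact: scong_sym sdep_sym _ _ IH.
- exact: ScongTrans IH1 IH2.
- rewrite !nform_cat; apply: foldr_lact_scong => /=.
  exact: (@lact_inv (s, b)) (nform_reduced v).
- rewrite !nform_cat; apply: foldr_lact_scong => /=.
  by apply: lact_comm; rewrite /sdep /dep /= negbK.
Qed.

Lemma reduced_raag_cong u v : reduced u -> reduced v -> raag_cong e u v ->
  scong sdep u v.
Proof. by move=> ru rv /raag_cong_nform; rewrite !reduced_nform. Qed.

Local Notation G := (raag e).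
Local Notation cls := (@raag_class S e).
Local Open Scope group_scope.

Lemma cls_cat u v : cls (u ++ v) = cls u * cls v.
Proof. exact: esym (raag_mulE e u v). Qed.

Lemma cls_cons x u : cls (x :: u) = cls [:: x] * cls u.
Proof. exact: cls_cat [:: x] u. Qed.

Lemma cls_linv x : cls [:: linv x] = (cls [:: x])^-1.
Proof.
apply: (@mulgI _ (cls [:: x])); rewrite mulgV -cls_cat.
by apply/raag_classP; case: x => s b; exact: (RaagCancel e [::] s b [::]).
Qed.

(** The defining relation concerns positive letters only; the other signs follow because inverses of
    commuting elements commute. *)
Lemma cls_swap x y : ~~ sdep x y -> cls [:: x; y] = cls [:: y; x].
Proof.
rewrite /sdep /dep negbK; case: x y => [s b] [t c] /= st.
have comm : commute (cls [:: (s, true)]) (cls [:: (t, true)]).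
  rewrite /commute -!cls_cat; apply/raag_classP.
  exact: (RaagComm [::] [::] st).
have gen r d : cls [:: (r, d)] = if d then cls [:: (r, true)] else (cls [:: (r, true)])^-1.
  by case: d => //; rewrite -cls_linv.
rewrite !(cls_cons _ [:: _]) (gen s b) (gen t c).
have c1 := commuteV comm.
have c2 := commute_sym (commuteV (commute_sym comm)).
have c3 := commute_sym (commuteV (commute_sym c1)).
by case: b; case: c.
Qed.

Lemma scong_cls u v : scong sdep u v -> cls u = cls v.
Proof.
elim=> {u v} [//|u v w _ -> //|u x y v xy].
rewrite !cls_cat -[[:: x, y & v]]/([:: x; y] ++ v) -[[:: y, x & v]]/([:: y; x] ++ v).
by rewrite !cls_cat cls_swap.
Qed.

Definition pos (w : seq S) : seq L := [seq (s, true) | s <- w].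
Definition pg (w : seq S) : G := cls (pos w).

Lemma pg_cat a b : pg (a ++ b) = pg a * pg b.
Proof. by rewrite /pg /pos map_cat cls_cat. Qed.

Lemma pg_nil : pg [::] = 1. Proof. by []. Qed.

Lemma pg_gen s : pg [:: s] = raag_gen e s. Proof. by []. Qed.

Lemma pg_cons s (w : seq S) : pg (s :: w) = raag_gen e s * pg w.
Proof. exact: (pg_cat [:: s] w). Qed.

Lemma raag_posP g : raag_pos g <-> exists w : seq S, g = pg w.
Proof.
have E (w : seq S) : (\prod_(s <- w) raag_gen e s)%g = pg w.
  elim: w => [|s w IH]; first by rewrite big_nil.
  by rewrite big_cons IH -pg_cons.
by split=> -[w ->]; exists w; rewrite E.
Qed.

Lemma pg_pos (w : seq S) : raag_pos (pg w). Proof. by apply/raag_posP; exists w. Qed.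

Definition neg (w : seq S) : seq L := rev [seq (s, false) | s <- w].

Lemma cls_neg (w : seq S) : cls (neg w) = (pg w)^-1.
Proof.
elim: w => [|s w IH]; first by rewrite pg_nil invg1.
rewrite /neg /= rev_cons -cats1 cls_cat -/(neg w) IH pg_cons invgM.
by rewrite -[(s, false)]/(linv (s, true)) cls_linv.
Qed.

Lemma scong_pos a b : scong (dep e) a b -> scong sdep (pos a) (pos b).
Proof. exact: scong_map. Qed.

Lemma scong_fst u v : scong sdep u v -> scong (dep e) (map fst u) (map fst v).
Proof. exact: scong_map. Qed.

Lemma pos_fst a : map fst (pos a) = a.
Proof. by rewrite /pos -map_comp map_id. Qed.

Lemma reduced_sign (b : bool) u : all (fun x => x.2 == b) u -> reduced u.
Proof.
elim: u => //= x u IH /andP[/eqP xb ub]; rewrite IH //=.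
apply/negP => /ldiv_scong /scong_perm /perm_mem /(_ (linv x)).
rewrite inE eqxx /= => E; have := allP ub (linv x) E; rewrite /= xb.
by case: (b).
Qed.

Lemma pos_sign a : all (fun x => x.2 == true) (pos a).
Proof. by apply/allP => x /mapP [s _ ->]. Qed.

Lemma neg_sign a : all (fun x => x.2 == false) (neg a).
Proof. by apply/allP => x; rewrite mem_rev => /mapP [s _ ->]. Qed.

Lemma pgP a b : pg a = pg b <-> scong (dep e) a b.
Proof.
split=> [/raag_classP H|/scong_pos /scong_cls //].
rewrite -[a]pos_fst -[b]pos_fst; apply: scong_fst.
by apply: reduced_raag_cong => //; exact: reduced_sign (pos_sign _).
Qed.

(** Words of one sign are reduced, so a cancelling pair consists of a letter s of c and its inverse
    in d^-1. The letters in between commute with s, which makes s a common right divisor of c and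
    d. *)
Lemma unreduced_cancel c d : ~~ reduced (pos c ++ neg d) -> exists s c' d',
  scong (dep e) c (c' ++ [:: s]) /\ scong (dep e) d (d' ++ [:: s]).
Proof.
elim: c => [|s c IH] /=; first by rewrite (reduced_sign (neg_sign d)).
rewrite negb_and negbK; case/orP => [/IH [t [c' [d' [H1 H2]]]]|].
  by exists t, (s :: c'), d'; split=> //; exact: scong_cons.
have nin : linv (s, true) \notin pos c.
  by apply/negP => /(allP (pos_sign c)).
rewrite ldiv_cat // => /andP[sc sd].
exists s, c, (rev (map fst (rem (linv (s, true)) (neg d)))); split.
  apply: scong_front; apply/allP => t tc.
  by have := allP sc (t, true); apply; apply/mapP; exists t.
have /scong_fst /(scong_rev (dep_sym e_sym)) := ldiv_scong sd.
rewrite /= rev_cons cats1 /neg map_rev revK -map_comp map_id.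
exact.
Qed.

Lemma reduce_fraction c d : exists a b (x : seq S),
  [/\ scong (dep e) c (a ++ x), scong (dep e) d (b ++ x) &
      reduced (pos a ++ neg b)].
Proof.
have [n] := ubnP (size c); elim: n c d => // n IH c d cn.
case R : (reduced (pos c ++ neg d)).
  by exists c, d, [::]; rewrite !cats0; split=> //; exact: ScongRefl.
have [s [c' [d' [H1 H2]]]] := unreduced_cancel (negbT R).
have [|a [b [x [Ha Hb r]]]] := IH c' d'.
  have := perm_size (scong_perm H1); rewrite size_cat /= addn1 => E.
  by move: cn; rewrite E.
exists a, b, (x ++ [:: s]); split=> //; rewrite catA.
  exact: ScongTrans H1 (scong_catr _ Ha).
exact: ScongTrans H2 (scong_catr _ Hb).
Qed.

(* The reduced form a b^-1 of an element of P P^-1 is unique, so that every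
   other fraction c d^-1 with the same value arises from it by expansion: this
   makes (G, P) quasi-lattice ordered. *)
Lemma fraction_normal_form c0 d0 : exists a b,
  pg c0 * (pg d0)^-1 = pg a * (pg b)^-1 /\
  forall c d, pg c * (pg d)^-1 = pg a * (pg b)^-1 ->
    exists x : seq S, pg c = pg a * pg x /\ pg d = pg b * pg x.
Proof.
have red c d : exists a b (x : seq S), [/\ pg c = pg a * pg x, pg d = pg b * pg x,
    reduced (pos a ++ neg b) & pg c * (pg d)^-1 = pg a * (pg b)^-1].
  have [a [b [x [/pgP Ha /pgP Hb r]]]] := reduce_fraction c d.
  exists a, b, x; rewrite Ha Hb !pg_cat; split=> //.
  by rewrite mulgKA.
have [a [b [x [_ _ r ->]]]] := red c0 d0.
exists a, b; split=> // c d; have [a' [b' [y [Hc Hd r' ->]]]] := red c d.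
rewrite -!cls_neg -!cls_cat => /raag_classP /(reduced_raag_cong r' r) H.
(* Filtering by sign respects swaps, so the congruence of the two reduced words splits into one of
   the positive parts and one of the negative parts. *)
have fp (z t : seq S) : seq.filter (fun l : L => l.2) (pos z ++ neg t) = pos z.
  rewrite filter_cat (all_filterP _); last first.
    by apply/allP => l /(allP (pos_sign z)) /eqP.
  rewrite (eq_in_filter (a2 := pred0)) ?filter_pred0 ?cats0 //.
  by move=> l /(allP (neg_sign t)) /eqP.
have fn (z t : seq S) : seq.filter (fun l : L => ~~ l.2) (pos z ++ neg t) = neg t.
  rewrite filter_cat (eq_in_filter (a2 := pred0)) ?filter_pred0 /=; last first.
    by move=> l /(allP (pos_sign z)) /eqP ->.
  by apply/all_filterP; apply/allP => l /(allP (neg_sign t)) /eqP ->.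
exists y; rewrite Hc Hd.
have := scong_filter (fun l : L => l.2) H; rewrite !fp => /scong_cls Ea.
have := scong_filter (fun l : L => ~~ l.2) H; rewrite !fn => /scong_cls.
by rewrite !cls_neg => /invg_inj Eb; rewrite -/(pg a') /pg Ea -/(pg b') Eb.
Qed.

End RaagWords.

(** * Maximal directed sets *)

Section Translate.
Variable G : groupType.
Local Open Scope group_scope.
Implicit Types (t x : G) (w : subsets G).

Lemma translateE t w x : translate t w x = w (t^-1 * x). Proof. by []. Qed.

Lemma translateM s t w : translate s (translate t w) = translate (s * t) w.
Proof. by apply/funext => x; rewrite /translate invgM mulgA. Qed.

Lemma translate1 w : translate 1 w = w.
Proof. by apply/funext => x; rewrite /translate invg1 mul1g. Qed.

Lemma translateK t w : translate t^-1 (translate t w) = w.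
Proof. by rewrite translateM mulVg translate1. Qed.

Lemma translateKV t w : translate t (translate t^-1 w) = w.
Proof. by rewrite translateM mulgV translate1. Qed.

End Translate.

Section Order.
Variables (S : countType) (e : rel S).
Hypothesis e_sym : symmetric e.
Hypothesis e_irr : irreflexive e.
Local Notation G := (raag e).
Local Notation P := (@raag_pos S e).
Local Notation pg := (@pg S e).
Local Notation gen := (raag_gen e).
Local Open Scope classical_set_scope.
Local Open Scope group_scope.
Implicit Types (x y z g : G) (w : subsets G) (u v : seq S).

Lemma qleP x y : qle P x y <-> exists u, y = x * pg u.
Proof.
split=> [/raag_posP [u E]|[u ->]].
  by exists u; rewrite -E mulVKg.
by apply/raag_posP; exists u; rewrite mulKg.
Qed.

Lemma qle_refl x : qle P x x.
Proof. by apply/qleP; exists [::]; rewrite pg_nil mulg1. Qed.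

Lemma qle_trans y x z : qle P x y -> qle P y z -> qle P x z.
Proof.
by move=> /qleP [u ->] /qleP [v ->]; apply/qleP; exists (u ++ v); rewrite pg_cat mulgA.
Qed.

Lemma pg_eq_scong u v : pg u = pg v <-> scong (dep e) u v.
Proof. exact: pgP. Qed.

Lemma qle_anti x y : qle P x y -> qle P y x -> x = y.
Proof.
move=> /qleP [u ->] /qleP [v]; rewrite -mulgA -pg_cat => E.
have : pg (u ++ v) = pg [::].
  by apply: (@mulgI _ x); rewrite pg_nil mulg1.
move=> /pg_eq_scong /scong_perm /perm_size.
by case: u {E} => // _; rewrite pg_nil mulg1.
Qed.

Lemma qle_mull g x y : qle P (g * x) (g * y) <-> qle P x y.
Proof. by rewrite /qle invgM -mulgA mulKg. Qed.

Lemma qle1_pg u : qle P 1 (pg u).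
Proof. by apply/qleP; exists u; rewrite mul1g. Qed.

Lemma qle_pg u v : qle P (pg u) (pg v) <-> tr_le (dep e) u v.
Proof.
have [dr ds] := (dep_refl e_irr, dep_sym e_sym).
split=> [/qleP [p]|/(tr_leP dr ds) [p]].
  by rewrite -pg_cat => /pg_eq_scong vp; apply/(tr_leP dr ds); exists p.
by move=> /pg_eq_scong E; apply/qleP; exists p; rewrite E pg_cat.
Qed.

Lemma is_join_mull g x y z : is_join P x y z -> is_join P (g * x) (g * y) (g * z).
Proof.
case=> xz yz zmin; split; rewrite ?qle_mull // => w xw yw.
have wE : w = g * (g^-1 * w) by rewrite mulVKg.
by rewrite wE qle_mull; apply: zmin; rewrite -(qle_mull g) -wE.
Qed.

Lemma is_join_unique x y z t : is_join P x y z -> is_join P x y t -> z = t.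
Proof. by case=> xz yz zm [xt yt tm]; apply: qle_anti; [apply: zm|apply: tm]. Qed.

(** An upper bound writes x^-1 y as a fraction c d^-1. Its reduced form a b^-1 gives the join x a =
    y b, as every other common upper bound expands this fraction. *)
Lemma bounded_join x y z : qle P x z -> qle P y z -> exists j, is_join P x y j.
Proof.
move=> /qleP [c zc] /qleP [d zd].
have [a [b [E H]]] := fraction_normal_form e_sym e_irr c d.
have yE : x^-1 * y = pg a * (pg b)^-1.
  rewrite -E; apply: (@mulIg _ (pg d)); rewrite mulgVK -mulgA -zd zc.
  by rewrite mulKg.
have xay : x * pg a = y * pg b.
  by apply: (@mulgI _ x^-1); rewrite mulKg mulgA yE mulgVK.
exists (x * pg a); split.
- by apply/qleP; exists a.
- by apply/qleP; exists b.
move=> w /qleP [c' wc] /qleP [d' wd].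
have [|p [Hp _]] := H c' d'.
  rewrite -yE; apply: (@mulIg _ (pg d')); rewrite mulgVK -mulgA -wd wc.
  by rewrite mulKg.
by apply/qleP; exists p; rewrite -mulgA -Hp.
Qed.

Lemma qle_join x y z t j k : qle P x z -> qle P y t -> is_join P x y j ->
  is_join P z t k -> qle P j k.
Proof.
move=> xz yt [_ _ jm] [zk tk _]; apply: jm.
  exact: qle_trans xz zk.
exact: qle_trans yt tk.
Qed.

Section Directed.
Variable w : subsets G.
Hypothesis wd : directed P w.

Lemma directed_ub x y : w x -> w y -> exists z, [/\ w z, qle P x z & qle P y z].
Proof. by move=> wx wy; have [z [xz yz _] wz] := wd wx wy; exists z. Qed.

Definition down_closure : subsets G := fun x => `[< exists2 y, w y & qle P x y >].

Lemma down_closure_directed : directed P down_closure.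
Proof.
move=> x y /asboolP [x' wx xx] /asboolP [y' wy yy].
have [z [wz xz yz]] := directed_ub wx wy.
have xz' := qle_trans xx xz; have yz' := qle_trans yy yz.
have [j jP] := bounded_join xz' yz'; exists j => //.
by apply/asboolP; exists z => //; case: jP => _ _; apply.
Qed.

(** For w nonempty and g compatible with every element of w, this is the down-closed directed set
    generated by w and g. *)
Definition adjoin g : subsets G :=
  fun y => `[< exists x z, [/\ w x, is_join P x g z & qle P y z] >].

End Directed.

Lemma adjoin_directed w g : directed P w ->
  (forall x, w x -> exists z, qle P x z /\ qle P g z) -> directed P (adjoin w g).
Proof.
move=> wd gw y1 y2 /asboolP [x1 [z1 [w1 j1 l1]]] /asboolP [x2 [z2 [w2 j2 l2]]].
have [x [wx xx1 xx2]] := directed_ub wd w1 w2.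
have [t [xt gt]] := gw x wx; have [z jz] := bounded_join xt gt.
have z1z := qle_join xx1 (qle_refl g) j1 jz.
have z2z := qle_join xx2 (qle_refl g) j2 jz.
have y1z := qle_trans l1 z1z; have y2z := qle_trans l2 z2z.
have [j jP] := bounded_join y1z y2z; exists j => //.
by apply/asboolP; exists x, z; split=> //; case: jP => _ _; apply.
Qed.

Section Maximal.
Variable w : subsets G.
Hypothesis wm : maximal_directed P w.

Lemma maximal_down x y : w y -> qle P x y -> w x.
Proof.
case: wm => wd wmax wy xy.
rewrite -(wmax _ (down_closure_directed wd)); first by apply/asboolP; exists y.
by move=> z wz; apply/asboolP; exists z => //; exact: qle_refl.
Qed.

(** Otherwise [adjoin w g] would be strictly larger. The element x0 is there because [adjoin] of an
    empty set is empty. *)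
Lemma maximal_adjoin x0 g : w x0 ->
  (forall x, w x -> exists z, qle P x z /\ qle P g z) -> w g.
Proof.
case: wm => wd wmax wx0 H.
rewrite -(wmax _ (adjoin_directed wd H)); last first.
  move=> x wx; have [t [xt gt]] := H x wx; have [z jz] := bounded_join xt gt.
  by apply/asboolP; exists x, z; split=> //; case: jz.
have [t [xt gt]] := H x0 wx0; have [z jz] := bounded_join xt gt.
by apply/asboolP; exists x0, z; split=> //; case: jz.
Qed.

End Maximal.

Lemma maximal_directed_exists z : exists w : subsets G, maximal_directed P w /\ w z.
Proof.
pose T := {w : subsets G | directed P w /\ w z}.
pose le (a b : T) := `[< forall x, sval a x -> sval b x >].
have t0 : T.
  exists (fun x => x == z); split=> // x y /eqP -> /eqP ->; exists z => //.
  by split=> //; exact: qle_refl.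
have [|||A tot|m mP] := @Zorn T le.
- by move=> a; apply/asboolP.
- by move=> a b c /asboolP ab /asboolP bc; apply/asboolP => x /ab /bc.
- move=> [a Ha] [b Hb] /asboolP ab /asboolP ba; apply: eq_exist; apply/funext => x.
  by apply/idP/idP => [/ab|/ba].
- have [[a Aa]|nA] := pselect (exists a, A a); last first.
    by exists t0 => s As; case: nA; exists s.
  pose U : subsets G := fun x => `[< exists2 b : T, A b & sval b x >].
  have H : directed P U /\ U z.
    split; last by apply/asboolP; exists a => //; case: (svalP a).
    have key (b : T) x y : A b -> sval b x -> sval b y ->
        exists2 j, is_join P x y j & U j.
      move=> Ab bx by_; have [bd _] := svalP b; have [j jP bj] := bd _ _ bx by_.
      by exists j => //; apply/asboolP; exists b.
    move=> x y /asboolP [b Ab bx] /asboolP [c Ac cy].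
    have [/asboolP bc|/asboolP cb] := tot b c Ab Ac.
      exact: key Ac (bc _ bx) cy.
    exact: key Ab bx (cb _ cy).
  exists (exist (fun w => directed P w /\ w z) U H) => s As; apply/asboolP => x sx /=; apply/asboolP; by exists s.
exists (sval m); have [md mz] := svalP m; split=> //; split=> // w' w'd mw'.
have H : directed P w' /\ w' z by split=> //; exact: mw'.
have /mP : le m (exist _ w' H) by apply/asboolP.
by move/(congr1 sval).
Qed.

Definition X0 : set (subsets G) := [set w : subsets G | w 1 /\ maximal_directed P w].

Lemma X0_down w x y : X0 w -> w y -> qle P x y -> w x.
Proof. by case=> _ /maximal_down; apply. Qed.

Lemma X0_ub w x y : X0 w -> w x -> w y -> exists z, [/\ w z, qle P x z & qle P y z].
Proof. by case=> _ [wd _]; exact: directed_ub. Qed.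

Lemma X0_pos w x : X0 w -> w x -> exists u, w (pg u) /\ qle P x (pg u).
Proof.
move=> Xw wx; have [z [wz xz /qleP [u zE]]] := X0_ub Xw wx (proj1 Xw).
by exists u; rewrite -[pg u]mul1g -zE.
Qed.

Lemma hereditaryP w : (forall x y, w y -> qle P x y -> w x) -> hereditary P w.
Proof.
move=> H x p wx Pp; apply: H wx _.
by rewrite /qle invgM invgK mulgVK.
Qed.

Lemma hereditary_down w x y : hereditary P w -> w y -> qle P x y -> w x.
Proof.
move=> H wy /qleP [u E]; have := H y (pg u) wy (pg_pos e u).
by rewrite E mulgK.
Qed.

Lemma X0_nica w : X0 w -> nica_spectrum P w.
Proof.
move=> Xw; split; first by case: Xw.
  by apply: hereditaryP => x y; exact: X0_down.
by case: Xw => _ [].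
Qed.

Lemma X0_exists u : exists2 w, X0 w & w (pg u).
Proof.
have [w [wm wu]] := maximal_directed_exists (pg u); exists w => //; split=> //.
exact: maximal_down wu (qle1_pg u).
Qed.

Lemma translate_directed t w : directed P w -> directed P (translate t w).
Proof.
move=> wd x y wx wy; have [z zj wz] := wd _ _ wx wy.
exists (t * z); last by rewrite /translate mulKg.
by rewrite -[x](mulVKg t) -[y](mulVKg t); exact: is_join_mull.
Qed.

Lemma translate_maximal t w : maximal_directed P w -> maximal_directed P (translate t w).
Proof.
case=> wd wm; split; first exact: translate_directed.
move=> w' w'd H; rewrite -[w'](translateKV t); congr translate.
apply: wm; first exact: translate_directed.
move=> x wx; rewrite translateE invgK; apply: H.
by rewrite translateE mulKg.
Qed.

Lemma translate_X0 t w : X0 w -> w t^-1 -> X0 (translate t w).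
Proof.
by case=> _ wm wt; split; [rewrite translateE mulg1|exact: translate_maximal].
Qed.

Lemma res_is_join u v a b : res e u v = Some (a, b) ->
  is_join P (pg u) (pg v) (pg (u ++ a)) /\ pg (u ++ a) = pg (v ++ b).
Proof.
move=> E; have /pg_eq_scong E2 := res_scong e_sym E; split=> //; split.
- by apply/qleP; exists a; rewrite pg_cat.
- by apply/qleP; exists b; rewrite E2 pg_cat.
move=> z ux vx.
have [p zE] : exists p, z = pg (u ++ p).
  by move/qleP : ux => [p ->]; exists p; rewrite pg_cat.
move: ux vx; rewrite zE => /qle_pg ux /qle_pg vx; apply/qle_pg.
by have [a' [b' []]] := res_join e_sym e_irr ux vx; rewrite E => -[<- _].
Qed.

Lemma res_ub u v z : qle P (pg u) z -> qle P (pg v) z -> exists a b, res e u v = Some (a, b).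
Proof.
move=> ux vx.
have [p zE] : exists p, z = pg (u ++ p).
  by move/qleP : ux => [p ->]; exists p; rewrite pg_cat.
move: ux vx; rewrite zE => /qle_pg ux /qle_pg vx.
by have [a [b [E _]]] := res_join e_sym e_irr ux vx; exists a, b.
Qed.

Lemma res_mem w u v : X0 w -> w (pg u) -> w (pg v) -> exists a b, res e u v = Some (a, b).
Proof. by move=> Xw wu wv; have [z [_]] := X0_ub Xw wu wv; exact: res_ub. Qed.

Lemma res_pg_mem w u v a b : X0 w -> res e u v = Some (a, b) -> w (pg u) -> w (pg v) ->
  w (pg (u ++ a)).
Proof.
move=> Xw /res_is_join [[_ _ jm] _] wu wv; have [z [wz uz vz]] := X0_ub Xw wu wv.
exact: X0_down Xw wz (jm _ uz vz).
Qed.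

(** This becomes relation (4) in the crossed product. If w had no letter of F, every element of w
    would lie below a positive word without letters of F. Such words commute with s0, a vertex of F,
    so s0 is compatible with all of w and maximality forces it into w. *)
Lemma X0_component w (F : {fset S}) : X0 w -> opp_component e [set` F] ->
  exists2 s, s \in F & w (gen s).
Proof.
move=> Xw [s0 FE]; apply: contrapT => nex.
have nF s : s \in F -> ~ w (gen s) by move=> sF ws; apply: nex; exists s.
have FP s : (s \in F) = `[< exists2 p, path (opp_adj e) s0 p & s = last s0 p >].
  apply/idP/asboolP => [sF|H]; first by have : [set` F] s by []; rewrite FE.
  by have : [set` F] s by rewrite FE.
have s0F : s0 \in F by rewrite FP; apply/asboolP; exists [::].
have Fcl s t : s \in F -> opp_adj e s t -> t \in F.
  rewrite !FP => /asboolP [p pp ->] st; apply/asboolP; exists (rcons p t).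
    by rewrite rcons_path pp.
  by rewrite last_rcons.
have comm s t : s \in F -> t \notin F -> e s t.
  move=> sF tF; apply: contraT => nst; case/negP: (tF); apply: (Fcl s) => //.
  rewrite /opp_adj /= nst andbT; apply/eqP => E; case/negP: tF; rewrite -E; exact: sF.
apply: (nF s0) => //; apply: (maximal_adjoin (proj2 Xw) (proj1 Xw)) => x wx.
have [u [wu xu]] := X0_pos Xw wx.
have uF t : t \in u -> t \notin F.
  move=> tu; apply/negP => tF.
  have h : has (fun t => t \in F) u by apply/hasP; exists t.
  move: wu; case/split_find: h => r u1 u2 rF u1F wu.
  (* r is the first letter of u from F, so it commutes with all letters before it and moves to the
     front; then w, being closed downwards, contains r. *)
  have E : pg (rcons u1 r ++ u2) = pg ([:: r] ++ (u1 ++ u2)).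
    rewrite cat_rcons -cat1s catA pg_cat [in RHS]catA [in RHS]pg_cat; congr (_ * _).
    apply/pg_eq_scong; apply: scong_sym; first exact: dep_sym.
    apply: scong_front; apply/allP => q qu1; rewrite /dep negbK.
    apply: comm rF _; apply: contra u1F => qF; by apply/hasP; exists q.
  apply: (nF r) => //; apply: X0_down Xw wu _.
  by apply/qleP; exists (u1 ++ u2); rewrite -pg_gen -pg_cat -E.
exists (pg (u ++ [:: s0])); split.
  by apply: qle_trans xu _; apply/qleP; exists [:: s0]; rewrite pg_cat.
apply/qleP; exists u; rewrite -pg_gen -pg_cat; apply/pg_eq_scong.
apply: scong_sym; first exact: dep_sym.
apply: scong_front; apply/allP => q /uF qF; rewrite /dep negbK; exact: comm.
Qed.

(* No word starting with u has a common multiple with the letter s. *)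
Definition blocked s u := ~~ ldiv (dep e) s u && ~~ all (e s) u.

Lemma blocked_cat s u v : blocked s u -> blocked s (u ++ v).
Proof.
rewrite /blocked all_cat negb_and => /andP[nd na]; rewrite na andbT.
elim: u nd na => //= t u IH; rewrite negb_or negb_and /dep !negbK => /andP[/negbTE -> /=].
by case: (e s t) => //= nd /(IH nd).
Qed.

Lemma blocked_res s u : blocked s u -> res e [:: s] u = None.
Proof. by rewrite /blocked /= => /andP[/negbTE -> /negbTE ->]. Qed.

(** The letters of A are blocked one by one. From an unblocked letter of A a path of the opposite
    graph leaves A; on it some unblocked x of A has a successor y that is outside A or blocked
    already, and appending y blocks x. *)
Lemma blocking_word (A : seq S) :
  (forall F : {fset S}, opp_component e [set` F] -> exists2 s, s \in F & s \notin A) ->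
  exists z : seq S, forall s, s \in A -> blocked s z.
Proof.
move=> HA.
(* Otherwise the component of s would lie in the finite A, against [HA]. *)
have exit s : s \in A -> exists2 p, path (opp_adj e) s p & last s p \notin A.
  move=> sA; apply: contrapT => nex.
  pose C : set S := [set t | exists2 p, path (opp_adj e) s p & t = last s p].
  pose F : {fset S} := [fset t in A | `[< C t >]]%fset.
  have CA t : C t -> t \in A.
    by move=> [p pp tE]; apply: contraT => tA; case: nex; exists p; rewrite -?tE.
  have FE : [set` F] = C.
    apply/seteqP; split=> t /=; rewrite !inE /=; first by case/andP=> _ /asboolP.
    by move=> Ct; rewrite CA //=; apply/asboolP.
  have [|t tF tA] := HA F; first by exists s.
  by move: tF tA; rewrite !inE /= => /andP[->].
(* The second condition keeps an unblocked x out of z, so that x cannot divide z followed by y. *)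
suff [z [zA _]] : exists z : seq S, (forall s, s \in A -> blocked s z) /\
    (forall s, s \in z -> s \in A -> blocked s z) by exists z.
have [n] := ubnP (size [seq s <- A | ~~ blocked s [::]]).
have : forall s, s \in [::] -> s \in A -> blocked s [::] by [].
elim: n {1 2 3}[::] => // n IH z zA cn.
have [/allP zall|] := boolP (all (blocked^~ z) A); first by exists z.
rewrite -has_predC => /hasP [s sA /= sz].
have [p pp pA] := exit s sA.
have [x [y [xA xz xy yU]]] : exists x y : S, [/\ x \in A, ~~ blocked x z, opp_adj e x y &
    (y \in A) ==> blocked y z].
  elim: p s sA sz pp pA => [|y p IHp] s sA sz /=; first by rewrite sA.
  case/andP=> sy pp lA; have [yU|] := boolP ((y \in A) ==> blocked y z).
    by exists s, y.
  by rewrite negb_imply => /andP[yA yz]; exact: IHp yA yz pp lA.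
have xnz : x \notin z by apply: contra xz => xz'; exact: zA.
have bx : blocked x (z ++ [:: y]).
  move/andP: xy => [xy nxy]; rewrite /blocked all_cat negb_and /= andbT nxy orbT andbT.
  by rewrite ldiv_cat //= (negbTE xy) /= !andbF.
apply: (IH (z ++ [:: y])).
  move=> t; rewrite mem_cat inE => /orP[tz tA|/eqP -> yA].
    by apply: blocked_cat; exact: zA.
  by apply: blocked_cat; move/implyP: yU; apply.
rewrite ltnS in cn; apply: leq_trans cn.
have sub : subseq [seq s <- A | ~~ blocked s (z ++ [:: y])]
    (rem x [seq s <- A | ~~ blocked s z]).
  have -> : [seq s <- A | ~~ blocked s (z ++ [:: y])] =
      [seq s <- [seq s <- A | ~~ blocked s z] | ~~ blocked s (z ++ [:: y])].
    rewrite -filter_predI; apply: eq_in_filter => t tA /=.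
    by case B : (blocked t z) => /=; rewrite ?andbT // (blocked_cat _ B).
  move: [seq s <- A | ~~ blocked s z] => B.
  elim: B => //= t B IHB; case: ifP => [nt|_].
    case: eqP => [E|_]; first by rewrite E bx in nt.
    by rewrite /= eqxx.
  case: eqP => _; first exact: filter_subseq.
  exact: subseq_trans IHB (subseq_cons _ _).
have := size_subseq sub; rewrite size_rem ?mem_filter ?xz // => H.
apply: leq_ltn_trans H _; rewrite prednK // size_filter -has_count.
by apply/hasP; exists x.
Qed.

Lemma avoiding_maximal (A : seq S) :
  (forall F : {fset S}, opp_component e [set` F] -> exists2 s, s \in F & s \notin A) ->
  exists2 w, X0 w & forall s, s \in A -> ~ w (gen s).
Proof.
move=> /blocking_word [z zA]; have [w Xw wz] := X0_exists z; exists w => // s sA ws.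
have [|a [b]] := @res_mem w [:: s] z Xw _ wz; first exact: ws.
by rewrite blocked_res //; exact: zA.
Qed.

(* Maximality makes every positive element outside w incompatible with some
   element of w. *)
Lemma deciding_prefix w (us : seq (seq S)) : X0 w -> exists z : seq S, w (pg z) /\
  forall u, u \in us -> if w (pg u) then qle P (pg u) (pg z)
                        else forall t, qle P (pg u) t -> ~ qle P (pg z) t.
Proof.
move=> Xw; elim: us => [|u us [z [wz IH]]].
  by exists [::]; split=> //; case: Xw.
have [x [wx Hx]] : exists x, w x /\ if w (pg u) then qle P (pg u) x
    else forall t, qle P (pg u) t -> ~ qle P x t.
  case wu : (w (pg u)); first by exists (pg u); rewrite wu; split=> //; exact: qle_refl.
  apply: contrapT => nex; move: wu; rewrite (maximal_adjoin (proj2 Xw) (proj1 Xw)) // => x wx.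
  apply: contrapT => nz; apply: nex; exists x; split=> // t ut xt.
  by apply: nz; exists t.
have [t [wt zt xt]] := X0_ub Xw wz wx.
have [y [wy ty]] := X0_pos Xw wt.
have zy := qle_trans zt ty; have xy := qle_trans xt ty.
exists y; split=> // v; rewrite inE => /orP[/eqP ->|/IH].
  case: ifP Hx => _ Hx; first exact: qle_trans Hx xy.
  by move=> r ur yr; apply: (Hx r) => //; exact: qle_trans yr.
case: ifP => _ Hv; first exact: qle_trans Hv zy.
by move=> r ur yr; apply: (Hv r) => //; exact: qle_trans yr.
Qed.

Lemma cat_eq_comparable (T : eqType) (p q u v : seq T) : p ++ u = q ++ v ->
  (exists r, q = p ++ r) \/ (exists r, p = q ++ r).
Proof.
elim: p q => [|x p IH] [|y q] /=; try by move=> _; left; eexists.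
  by move=> _; right; eexists.
by case=> -> /IH [[r ->]|[r ->]]; [left|right]; exists r.
Qed.

(** In operators: V_z^* V_a V_b^* V_z = 0. Some pair of distinct noncommuting letters has different
    projections of a and b; z is the projection of b, followed by a letter x after which the two
    projections can no longer be made to agree. *)
Lemma separating_word a b : (forall s, exists t, opp_adj e s t) -> pg a <> pg b ->
  exists z : seq S, forall c d, res e b z = Some (c, d) -> res e z (a ++ c) = None.
Proof.
move=> no_isol ab.
have [s [t [st Hst]]] : exists s t, s != t /\ ~~ e s t /\ tproj s t a <> tproj s t b.
  apply: contrapT => nex; apply: ab; apply/pg_eq_scong.
  apply/(tr_eqP (dep_refl e_irr) (dep_sym e_sym)) => l m lm.
  apply: contrapT => H; have [lmE|lmN] := eqVneq l m; last by apply: nex; exists l, m.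
  (* The number of letters l differs; a neighbour t of l in the opposite graph gives a pair of
     distinct letters that detects it. *)
  have [t /andP[lt nlt]] := no_isol l.
  apply: nex; exists l, t; split=> //; split=> // E; apply: H; rewrite -lmE.
  have F (u : seq S) : tproj l l u = seq.filter (pred1 l) (tproj l t u).
    rewrite /tproj -filter_predI; apply: eq_filter => x /=.
    by case: eqP.
  by rewrite !F E.
have {Hst} [nst Hst] := Hst.
set al := tproj s t a in Hst; set be := tproj s t b in Hst.
(* If one of the projections continues the other, x avoids the next letter of the continuation;
   otherwise any letter of the pair works. *)
have [x [xst Hx]] : exists x : S, ((x == s) || (x == t)) /\
    forall p q, be ++ x :: p <> al ++ x :: q.
  have other (y : S) : exists x : S, ((x == s) || (x == t)) /\ x != y.
    by have [E|sy] := eqVneq s y; [exists t; rewrite eqxx orbT -E eq_sym|exists s; rewrite eqxx].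
  have [[[|y r] E]|n1] := pselect (exists r, al = be ++ r).
  - by case: Hst; rewrite E cats0.
  - have [x [xst xy]] := other y; exists x; split=> // p q.
    rewrite E -catA /= => /eqP; rewrite eqseq_cat // eqxx /= eqseq_cons (negbTE xy).
    by [].
  have [[[|y r] E]|n2] := pselect (exists r, be = al ++ r).
  - by case: Hst; rewrite E cats0.
  - have [x [xst xy]] := other y; exists x; split=> // p q.
    rewrite E -catA /= => /eqP; rewrite eqseq_cat // eqxx /= eqseq_cons eq_sym (negbTE xy).
    by [].
  exists s; rewrite eqxx; split=> // p q /cat_eq_comparable [H|H]; first exact: n1.
  exact: n2.
exists (be ++ [:: x]) => c d E.
case E2 : (res e (be ++ [:: x]) (a ++ c)) => [[f g]|] //.
have st' : dep e s t by [].
have dr := dep_refl e_irr; have ds := dep_sym e_sym.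
have := scong_tr dr ds (res_scong e_sym E) st'.
have := scong_tr dr ds (res_scong e_sym E2) st'.
have pbe : tproj s t (be ++ [:: x]) = be ++ [:: x].
  rewrite proj_cat {2}/tproj /= xst; congr (_ ++ _).
  by rewrite /be /tproj; apply/all_filterP; rewrite filter_all.
rewrite !(proj_cat s t (be ++ [:: x])) pbe !proj_cat -/al -/be -!catA /= => H1 H2.
move: H2 => /eqP; rewrite eqseq_cat // eqxx /= => /eqP H2.
by case: (Hx (tproj s t f) (tproj s t d ++ tproj s t g)); rewrite H1 H2.
Qed.

End Order.

Import Order.TTheory GRing.Theory Num.Theory.
Import numFieldNormedType.Exports.

Local Open Scope classical_set_scope.
Local Open Scope ring_scope.
Local Open Scope complex_scope.

(** * Real-valued norms, limits and fixed points *)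

Section ComplexNorm.
Variable R : realType.
Implicit Types c d : R[i].

(** Norms take values in [R[i]], although they are real; [cn] here and [nrm] below read them in R,
    where the order is total. *)
Definition cn c : R := complex.Re `|c|.

Lemma cnE c : `|c| = (cn c)%:C.
Proof.
have := normr_ge0 c; rewrite /cn; case: `|c| => a b.
by rewrite lecE /= => /andP[/eqP -> _].
Qed.

Lemma cnM c d : cn (c * d) = cn c * cn d.
Proof. by apply: complexI; rewrite rmorphM /= -!cnE normrM. Qed.

Lemma cn_ge0 c : 0 <= cn c.
Proof. by rewrite -lecR -[(cn c)%:C]cnE normr_ge0. Qed.

Lemma cn0 : cn 0 = 0.
Proof. by rewrite /cn normr0. Qed.

Lemma cn1 : cn 1 = 1.
Proof. by rewrite /cn normr1. Qed.

Lemma cn_eq0 c : cn c = 0 -> c = 0.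
Proof. by move=> H; apply/eqP; rewrite -normr_eq0 cnE H. Qed.

Lemma cnN c : cn (- c) = cn c.
Proof. by rewrite /cn normrN. Qed.

Lemma cnD c d : cn (c + d) <= cn c + cn d.
Proof. by have := ler_normD c d; rewrite !cnE -rmorphD lecR. Qed.

Lemma cnC (r : R) : cn r%:C = `|r|.
Proof. by rewrite /cn normc_def /= expr0n /= addr0 sqrtr_sqr. Qed.

Lemma conjR (r : R) : ((r%:C)^*)%R = r%:C.
Proof. by rewrite conj_Creal // complex_real. Qed.

Lemma conjcE (a b : R) : ((a +i* b)^*)%R = a -i* b.
Proof. by []. Qed.

Lemma cn_conj c : cn (c^*)%R = cn c.
Proof. by rewrite /cn norm_conjC. Qed.

Lemma conjM_cn c : (c^*)%R * c = (cn c ^+ 2)%:C.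
Proof. by rewrite mulrC -normCK cnE rmorphXn. Qed.

End ComplexNorm.

Section RealNorm.
Variables (R : realType) (V : normedModType R[i]).
Implicit Types x y : V.

Definition nrm x : R := complex.Re `|x|.

Lemma nrmE x : `|x| = (nrm x)%:C.
Proof.
have := normr_ge0 x; rewrite /nrm; case: `|x| => a b.
by rewrite lecE /= => /andP[/eqP -> _].
Qed.

Lemma nrm_ge0 x : 0 <= nrm x.
Proof. by have := normr_ge0 x; rewrite nrmE lecR. Qed.

Lemma nrm_eq0 x : nrm x = 0 -> x = 0.
Proof. by move=> x0; apply/eqP; rewrite -normr_eq0 nrmE x0. Qed.

Lemma nrm0 : nrm 0 = 0.
Proof. by rewrite /nrm normr0. Qed.

Lemma nrmN x : nrm (- x) = nrm x.
Proof. by rewrite /nrm normrN. Qed.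

Lemma nrmD x y : nrm (x + y) <= nrm x + nrm y.
Proof. by have := ler_normD x y; rewrite !nrmE -rmorphD lecR. Qed.

Lemma nrmB x y : nrm (x - y) = nrm (y - x).
Proof. by rewrite -nrmN opprB. Qed.

Lemma nrm_dist y x z : nrm (x - z) <= nrm (x - y) + nrm (y - z).
Proof. by rewrite (le_trans _ (nrmD _ _)) // addrA subrK. Qed.

Lemma nrm_distl x y : nrm x <= nrm y + nrm (x - y).
Proof. by rewrite addrC (le_trans _ (nrmD _ _)) // subrK. Qed.

Lemma nrmZ c x : nrm (c *: x) = cn c * nrm x.
Proof. by rewrite /nrm normrZ nrmE cnE -rmorphM. Qed.

Lemma nrm_sum (I : Type) (r : seq I) (P : pred I) (F : I -> V) :
  nrm (\sum_(i <- r | P i) F i) <= \sum_(i <- r | P i) nrm (F i).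
Proof.
elim/big_rec2 : _ => [|i a b _ ab]; first by rewrite nrm0.
by rewrite (le_trans (nrmD _ _)) // lerD2l.
Qed.

Definition nlim (u : nat -> V) (l : V) :=
  forall eps : R, 0 < eps -> exists N, forall n, (N <= n)%N -> nrm (u n - l) < eps.

End RealNorm.

Section Complete.
Variables (R : realType) (V : completeNormedModType R[i]).

Lemma nrm_complete (u : nat -> V) :
  (forall eps : R, 0 < eps -> exists N, forall m n, (N <= m)%N -> (N <= n)%N ->
     nrm (u m - u n) < eps) ->
  exists l, nlim u l.
Proof.
move=> cu.
have /cauchy_cvgP /cvg_ex [l ul] : cauchy (u @ \oo).
  apply/cauchy_ballP => eps eps0.
  have [e0 ee] : 0 < complex.Re eps /\ eps = (complex.Re eps)%:C.
    by case: (eps) eps0 => a b; rewrite ltcE /= => /andP[/eqP -> ->].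
  have [N HN] := cu _ e0.
  near_simpl; exists ([set n | N <= n], [set n | N <= n])%N.
    by split; exists N.
  move=> [m n] [/= Nm Nn].
  by rewrite -ball_normE /= nrmE ee ltcR; apply: HN.
exists l => eps eps0.
move/cvgrPdist_lt : ul => /(_ eps%:C); rewrite ltcR => /(_ eps0) [N _ HN].
exists N => n Nn; have := HN n Nn.
by rewrite /= nrmE ltcR nrmB.
Qed.

End Complete.

(** Banach's theorem on a subset U closed under limits. It yields one-sided inverses near 1 and
    square roots. *)
Lemma fixed_point (R : realType) (V : completeNormedModType R[i])
    (U : V -> Prop) (f : V -> V) (q : R) (x0 : V) :
  0 <= q < 1 -> U x0 -> (forall x, U x -> U (f x)) ->
  (forall x y, U x -> U y -> nrm (f x - f y) <= q * nrm (x - y)) ->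
  (forall u l, (forall n, U (u n)) -> nlim u l -> U l) ->
  exists2 x, U x & f x = x.
Proof.
move=> /andP[q0 q1] Ux0 Uf fq Ucl.
pose u n := iter n f x0.
have Uu n : U (u n) by elim: n => // n; exact: Uf.
pose C := nrm (u 1%N - x0).
have step n : nrm (u n.+1 - u n) <= q ^+ n * C.
  elim: n => [|n IH]; first by rewrite expr0 mul1r.
  rewrite (le_trans (fq (u n.+1) (u n) (Uu _) (Uu _))) // exprS -mulrA.
  by rewrite ler_wpM2l.
(* The estimate q^n + ... + q^(n + m - 1) <= q^n / (1 - q), cleared of its denominator. *)
have dist n m : (1 - q) * nrm (u (n + m)%N - u n) <= q ^+ n * C.
  have -> : q ^+ n * C = q ^+ n * C * q ^+ m + q ^+ n * C * (1 - q ^+ m).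
    by rewrite -mulrDr addrC subrK mulr1.
  rewrite -[leLHS]add0r lerD //.
    by rewrite !mulr_ge0 ?exprn_ge0 ?nrm_ge0.
  elim: m => [|m IH]; first by rewrite addn0 !subrr nrm0 !mulr0.
  have q2 : 0 <= 1 - q by rewrite subr_ge0 ltW.
  rewrite (le_trans (ler_wpM2l q2 (nrm_dist (u (n + m)%N) _ _))) //.
  rewrite mulrDr addnS.
  have H := ler_wpM2l q2 (step (n + m)%N).
  rewrite (le_trans (lerD H IH)) //.
  by rewrite exprD exprS le_eqVlt; apply/orP; left; apply/eqP; ring.
have qlim (eps : R) : 0 < eps -> exists N, forall n, (N <= n)%N -> q ^+ n * C < eps.
  move=> e0.
  have C0 : 0 <= C by apply: nrm_ge0.
  have e1 : 0 < eps / (C + 1) by rewrite divr_gt0 // ltr_wpDl.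
  have : (q ^+ n @[n --> \oo] --> (0 : R)) by apply: cvg_expr; rewrite ger0_norm.
  move/cvgrPdist_lt => /(_ _ e1) [N _ HN]; exists N => n Nn.
  have := HN n Nn; rewrite /= sub0r normrN ger0_norm ?exprn_ge0 // => H.
  rewrite (le_lt_trans (_ : _ <= q ^+ n * (C + 1))) -?ltr_pdivlMr //.
    by rewrite ler_wpM2l ?exprn_ge0 // lerDl.
  by rewrite ltr_wpDl.
have [l ul] : exists l, nlim u l.
  apply: nrm_complete => eps e0.
  have e1 : 0 < eps * (1 - q) by rewrite mulr_gt0 // subr_gt0.
  have [N HN] := qlim _ e1; exists N.
  move=> m n; wlog mn : m n / (n <= m)%N => [H|] Nm Nn.
    by case/orP: (leq_total n m) => H'; [|rewrite nrmB]; apply: H.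
  have := dist n (m - n)%N; rewrite subnKC // => H.
  have := le_lt_trans H (HN n Nn).
  by rewrite mulrC ltr_pM2r // subr_gt0.
have Ul := Ucl u l Uu ul.
exists l => //; apply/eqP; rewrite -subr_eq0; apply/eqP/nrm_eq0.
apply/eqP; rewrite eq_le nrm_ge0 andbT leNgt; apply/negP => d0.
have d1 : 0 < nrm (f l - l) / 2 by rewrite divr_gt0.
have [N HN] := ul _ d1.
have := nrm_dist (u N.+1) (f l) l.
have := fq _ _ Ul (Uu N); rewrite -[f (u N)]/(u N.+1) (nrmB l) => H1 H2.
have H3 := HN N (leqnn _); have H4 := HN N.+1 (leqnSn _).
have H5 : q * nrm (u N - l) <= nrm (u N - l) by rewrite ler_piMl ?nrm_ge0 ?ltW.
by move: H1 H2 H3 H4 H5; lra.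
Qed.

(** * Elementary theory of C*-algebras and their homomorphisms *)

Section CStarBasics.
Variables (R : realType) (A : cstarType R).
Implicit Types x y : A.

Lemma scaleAl c x y : (c *: x) * y = c *: (x * y).
Proof. exact: esym (cstar_scalerAl c x y). Qed.

Lemma scaleAr c x y : x * (c *: y) = c *: (x * y).
Proof. exact: esym (cstar_scalerAr c x y). Qed.

Lemma starMr x y : star (x * y) = star y * star x.
Proof. exact: starM. Qed.

Lemma starDr x y : star (x + y) = star x + star y.
Proof. exact: starD. Qed.

Lemma star0 : star (0 : A) = 0.
Proof. by apply: (addrI (star 0)); rewrite -starDr !addr0. Qed.

Lemma starN x : star (- x) = - star x.
Proof. by apply/eqP; rewrite -subr_eq0 opprK -starDr addNr star0. Qed.

Lemma starB x y : star (x - y) = star x - star y.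
Proof. by rewrite starDr starN. Qed.

Lemma star1 : star (1 : A) = 1.
Proof. by rewrite -[LHS]mul1r -{1}[1]starK -starMr mul1r starK. Qed.

Lemma star_sum (I : Type) (r : seq I) (P : pred I) (F : I -> A) :
  star (\sum_(i <- r | P i) F i) = \sum_(i <- r | P i) star (F i).
Proof. by apply: (big_morph (@star R A)); [exact: starDr|exact: star0]. Qed.

Lemma nrmM x y : nrm (x * y) <= nrm x * nrm y.
Proof. by have := @cstar_normM R A x y; rewrite !nrmE -rmorphM lecR. Qed.

Lemma nrm_star2 x : nrm (star x * x) = nrm x ^+ 2.
Proof.
apply: complexI; rewrite -nrmE rmorphXn /= -nrmE; exact: cstar_norm.
Qed.

Lemma nrm_star x : nrm (star x) = nrm x.
Proof.
have le y : nrm y <= nrm (star y).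
  have [y0|y0] := ltrP 0 (nrm y).
    by rewrite -(ler_pM2r y0) -expr2 -nrm_star2 nrmM.
  exact: le_trans y0 (nrm_ge0 _).
by apply/eqP; rewrite eq_le le andbT (le_trans (le _)) // starK.
Qed.

(** Not an equality: in the zero algebra 1 = 0. *)
Lemma nrm1_le : nrm (1 : A) <= 1.
Proof.
have := nrm_star2 1; rewrite star1 mul1r => n1.
rewrite leNgt; apply/negP => H.
by have := nrm_ge0 (1 : A); nra.
Qed.

Lemma nrm_conj_le x w : nrm w <= 1 -> nrm (star w * x * w) <= nrm x.
Proof.
move=> w1; have w0 := nrm_ge0 w.
rewrite (le_trans (nrmM _ _)) // (le_trans (ler_piMr _ w1)) ?nrm_ge0 //.
by rewrite (le_trans (nrmM _ _)) // nrm_star ler_piMl ?nrm_ge0.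
Qed.

Lemma star_exp x n : star (x ^+ n) = star x ^+ n.
Proof.
by elim: n => [|n IH]; rewrite ?expr0 ?star1 // exprS starMr IH -exprSr.
Qed.

Lemma nrm_exp2 x r : star x = x -> nrm (x ^+ (2 ^ r)) = nrm x ^+ (2 ^ r).
Proof.
move=> sx; elim: r => [|r IH]; first by rewrite expn0 !expr1.
rewrite expnS mulnC !exprM -IH expr2.
by have := nrm_star2 (x ^+ (2 ^ r)); rewrite star_exp sx.
Qed.

(** A fixed point y of y |-> 1 + (1 - x) y satisfies x y = 1. *)
Lemma right_inverse_near1 x : nrm (1 - x) < 1 -> exists y, x * y = 1.
Proof.
move=> x1.
have [|||| y _ fy] := @fixed_point R A (fun=> True) (fun y => 1 + (1 - x) * y)
  (nrm (1 - x)) 0 _ I => //.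
- by rewrite nrm_ge0.
- move=> y z _ _; rewrite (_ : _ - _ = (1 - x) * (y - z)) ?nrmM //.
  by rewrite mulrBr opprD addrACA subrr add0r.
exists y; apply/eqP; rewrite -subr_eq0 -[X in _ * y - X]/(1 : A).
by apply/eqP; move: fy; rewrite mulrBl mul1r addrCA => /eqP;
  rewrite -subr_eq0 addrAC subrr add0r subr_eq0 => /eqP <-; rewrite subrr.
Qed.

Lemma selfadjoint_pythagoras x y :
  star x = x -> star y = y -> x * y = y * x -> x * x + y * y = 1 -> nrm x <= 1.
Proof.
(* x + i y is unitary. *)
move=> sx sy xy E.
pose i : R[i] := ('i)%R.
pose u := x + i *: y.
have su : star u = x - i *: y.
  by rewrite starDr starZ sx sy conjCi scaleNr.
have uu : star u * u = 1.
  rewrite su mulrDr !mulrBl !scaleAl !scaleAr xy scalerA -[i * i]expr2 sqrCi.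
  by rewrite scaleN1r opprK addrA subrK.
have u1 : nrm u <= 1.
  have := nrm_star2 u; rewrite uu => H; have := nrm1_le; rewrite H.
  by rewrite expr_le1 // nrm_ge0.
have -> : x = (2^-1 : R[i]) *: (u + star u).
  rewrite su /u addrACA subrr addr0 scalerDr -scalerDl.
  have -> : (2^-1 + 2^-1 : R[i]) = 1; last by rewrite scale1r.
  by field.
rewrite nrmZ.
have -> : cn (2^-1 : R[i]) = 2^-1 :> R.
  have -> : (2^-1 : R[i]) = (2^-1)%:C by rewrite fmorphV rmorph_nat.
  by rewrite cnC ger0_norm // invr_ge0.
have := nrmD u (star u); rewrite nrm_star; lra.
Qed.

End CStarBasics.

Section StarHom.
Variables (R : realType).

Lemma nlim_unique (V : normedModType R[i]) (u : nat -> V) l m :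
  nlim u l -> nlim u m -> l = m.
Proof.
move=> ul um; apply/eqP; rewrite -subr_eq0; apply/eqP/nrm_eq0/eqP.
rewrite eq_le nrm_ge0 andbT leNgt; apply/negP => d0.
have d1 : 0 < nrm (l - m) / 2 by rewrite divr_gt0.
have [N1 H1] := ul _ d1; have [N2 H2] := um _ d1.
have := H1 _ (leq_maxl N1 N2); have := H2 _ (leq_maxr N1 N2).
have := nrm_dist (u (maxn N1 N2)) l m; rewrite (nrmB l (u _)); lra.
Qed.

Lemma nlim_lip (V W : normedModType R[i]) (f : V -> W) (C : R) u l :
  (forall x y, nrm (f x - f y) <= C * nrm (x - y)) -> nlim u l ->
  nlim (f \o u) (f l).
Proof.
move=> fC ul eps e0.
have C1 : 0 < `|C| + 1 by rewrite ltr_wpDl.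
have [N HN] := ul _ (divr_gt0 e0 C1); exists N => n /HN.
rewrite ltr_pdivlMr // => H; rewrite (le_lt_trans (fC _ _)) //.
apply: le_lt_trans H; rewrite mulrC ler_wpM2l ?nrm_ge0 //.
by rewrite (le_trans (ler_norm C)) // lerDl.
Qed.

Lemma nlim_le (V : normedModType R[i]) (u : nat -> V) l (c : R) :
  nlim u l -> (forall n, nrm (u n) <= c) -> nrm l <= c.
Proof.
move=> ul uc; rewrite leNgt; apply/negP => lc.
have e0 : 0 < nrm l - c by rewrite subr_gt0.
have [N HN] := ul _ e0; have := HN N (leqnn _); have := uc N.
by have := nrm_distl l (u N); rewrite nrmB; lra.
Qed.

Section Sqrt.
Variable A : cstarType R.

(* c = 1 - b, where b is the fixed point of b |-> (x + b^2) / 2. *)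
Lemma selfadjoint_sqrt (h x : A) :
  star x = x -> h * x = x * h -> nrm x < 1 ->
  exists c : A, [/\ star c = c, h * c = c * h & c * c = 1 - x].
Proof.
move=> sx hx x1.
have x0 := nrm_ge0 x.
(* r = 1 - sqrt (1 - |x|) solves (|x| + r^2) / 2 = r: the ball of radius r is mapped to itself, with
   Lipschitz constant r < 1. *)
have [r /andP[r0 r1] xr] : exists2 r : R, 0 <= r < 1 & nrm x + r * r <= 2 * r.
  pose s := Num.sqrt (1 - nrm x).
  have s0 : 0 < s by rewrite sqrtr_gt0 subr_gt0.
  have ss : s * s = 1 - nrm x by rewrite -expr2 sqr_sqrtr // subr_ge0 ltW.
  exists (1 - s); last by nra.
  by apply/andP; split; nra.
pose half : R[i] := (2^-1)%:C.
pose U (b : A) := [/\ nrm b <= r, star b = b & h * b = b * h].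
pose f (b : A) := half *: (x + b * b).
have nh (y : A) : nrm (half *: y) = 2^-1 * nrm y.
  by rewrite nrmZ cnC ger0_norm // invr_ge0.
have [|||||b [br sb hb] fb] := @fixed_point R A U f r 0.
- by rewrite r0.
- by split; rewrite ?nrm0 ?star0 ?mulr0 ?mul0r.
- move=> b [br sb hb]; split.
  + rewrite nh; have := nrmD x (b * b); have := nrmM b b.
    have := nrm_ge0 b; nra.
  + rewrite starZ starDr starMr sx sb; congr (_ *: _).
    by rewrite conj_Creal // complex_real.
  + by rewrite scaleAl scaleAr mulrDr mulrDl hx !mulrA hb -!mulrA hb.
- move=> b c [br sb _] [cr sc _].
  rewrite -scalerBr nh opprD addrACA subrr add0r.
  have -> : b * b - c * c = b * (b - c) + (b - c) * c.
    by rewrite mulrBr mulrBl addrA subrK.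
  have := nrmD (b * (b - c)) ((b - c) * c).
  have := nrmM b (b - c); have := nrmM (b - c) c.
  have := nrm_ge0 (b - c); nra.
- move=> u l Uu ul; split.
  + by apply: (nlim_le ul) => n; case: (Uu n).
  + apply: (nlim_unique _ ul).
    have {1}-> : u = @star R A \o u by apply/funext => n /=; case: (Uu n).
    apply: (@nlim_lip _ _ _ 1) ul => y z.
    by rewrite -starB nrm_star mul1r.
  + apply: (@nlim_unique _ (fun n => h * u n)).
      apply: (@nlim_lip _ _ (fun y => h * y) (nrm h)) ul => y z.
      by rewrite -mulrBr nrmM.
    have -> : (fun n => h * u n) = (fun y => y * h) \o u.
      by apply/funext => n /=; case: (Uu n).
    apply: (@nlim_lip A A ( *%R^~ h) (nrm h) u l) => // y z.
    by rewrite /= -mulrBl [nrm h * _]mulrC nrmM.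
exists (1 - b); split.
- by rewrite starB star1 sb.
- by rewrite mulrBr mulrBl mulr1 mul1r hb.
have : b + b = x + b * b.
  rewrite -[in LHS]fb /f -scalerDl.
  have -> : half + half = 1; last by rewrite scale1r.
  by rewrite /half -rmorphD /= (_ : 2^-1 + 2^-1 = 1 :> R) //; field.
move=> E; have -> : x = b + b - b * b by rewrite E addrK.
by rewrite mulrBl !mulrBr !mul1r mulr1 -addrA -opprD addrA.
Qed.

End Sqrt.

Section Contractive.
Variables (A B : cstarType R) (f : A -> B).
Hypothesis fP : star_hom f.

Lemma star_homD x y : f (x + y) = f x + f y.
Proof.
by case: fP => L _ _; have := L 1 x y; rewrite !scale1r.
Qed.

Lemma star_hom0 : f 0 = 0.
Proof. by apply: (addrI (f 0)); rewrite -star_homD !addr0. Qed.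

Lemma star_homZ c x : f (c *: x) = c *: f x.
Proof. by case: fP => L _ _; have := L c x 0; rewrite star_hom0 !addr0. Qed.

Lemma star_homN x : f (- x) = - f x.
Proof. by rewrite -scaleN1r star_homZ scaleN1r. Qed.

Lemma star_homB x y : f (x - y) = f x - f y.
Proof. by rewrite star_homD star_homN. Qed.

Lemma star_homM x y : f (x * y) = f x * f y.
Proof. by case: fP => _ [_ M] _; exact: M. Qed.

Lemma star_hom1 : f 1 = 1.
Proof. by case: fP => _ [? _] _. Qed.

Lemma star_homS x : f (star x) = star (f x).
Proof. by case: fP. Qed.

Lemma star_hom_sum (I : Type) (r : seq I) (P : pred I) (F : I -> A) :
  f (\sum_(i <- r | P i) F i) = \sum_(i <- r | P i) f (F i).
Proof. by apply: (big_morph f); [exact: star_homD|exact: star_hom0]. Qed.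

(** If h is selfadjoint with |h| < 1, a square root c of 1 - h^2 commutes with h, and the images of
    h and c satisfy the hypotheses of [selfadjoint_pythagoras]. Scaling and the C*-identity do the
    rest. *)
Lemma star_hom_le x : nrm (f x) <= nrm x.
Proof.
have sa h : star h = h -> nrm h < 1 -> nrm (f h) <= 1.
  move=> sh h1.
  have [||| c [sc hc cc]] := @selfadjoint_sqrt A h (h * h).
  - by rewrite starMr sh.
  - by rewrite mulrA.
  - have := nrmM h h; have := nrm_ge0 h; nra.
  apply: (@selfadjoint_pythagoras _ _ (f h) (f c)).
  - by rewrite -star_homS sh.
  - by rewrite -star_homS sc.
  - by rewrite -!star_homM hc.
  - by rewrite -!star_homM -star_homD cc addrCA subrr addr0 star_hom1.
have sa2 h : star h = h -> nrm (f h) <= nrm h.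
  move=> sh; rewrite leNgt; apply/negP => hf.
  (* Dividing by the midpoint t brings the norm of h below 1 and that of its image above 1. *)
  pose t := (nrm h + nrm (f h)) / 2.
  have t0 : 0 < t by have := nrm_ge0 h; rewrite /t; lra.
  have ti : 0 < t^-1 by rewrite invr_gt0.
  have := sa (t^-1%:C *: h).
  rewrite starZ conj_Creal ?complex_real // sh star_homZ !nrmZ !cnC.
  rewrite ger0_norm ?(ltW ti) // => /(_ erefl).
  rewrite mulrC ltr_pdivrMr // mul1r => /(_ _).
  rewrite mulrC ler_pdivrMr // mul1r /t => H.
  have : nrm h < (nrm h + nrm (f h)) / 2 by lra.
  by move/H; lra.
rewrite -(@ler_pXn2r _ 2) ?nnegrE ?nrm_ge0 // -!nrm_star2 -star_homS -star_homM.
by apply: sa2; rewrite starMr starK.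
Qed.

Lemma star_hom_nlim u l : nlim u l -> nlim (f \o u) (f l).
Proof.
by apply: (@nlim_lip _ _ f 1) => x y; rewrite -star_homB mul1r star_hom_le.
Qed.

End Contractive.

End StarHom.

Lemma power_trick (R : realType) (a b K : R) : 0 <= a -> 0 <= b ->
  (forall r : nat, a ^+ (2 ^ r) <= K * 2 ^+ r * b ^+ (2 ^ r)) -> a <= b.
Proof.
(* By Bernoulli a / b > 1 would make (a / b)^(2^r) outgrow K 2^r. *)
move=> a0 b0 H; rewrite leNgt; apply/negP => ba.
have [b00|b1] := eqVneq b 0.
  have := H 0%N; rewrite b00 expn0 !expr1 mulr0 => a1.
  by move: ba; rewrite b00 ltNge a1.
have bp : 0 < b by rewrite lt_neqAle eq_sym b1.
pose d := a / b - 1.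
have d0 : 0 < d by rewrite subr_gt0 ltr_pdivlMr // mul1r.
have bern n : 1 + n%:R * d <= (1 + d) ^+ n.
  elim: n => [|n IH]; first by rewrite mul0r addr0 expr0.
  have := ler_wpM2l (_ : 0 <= 1 + d) IH; rewrite -exprS => /(_ _) H1.
  apply: le_trans (H1 _); last by lra.
  by rewrite -natr1; have : 0 <= n%:R :> R by []; nra.
(* The hypothesis at r + 1 meets the square of the Bernoulli bound at r: a multiple of the square of
   2^r would stay below a multiple of 2^r. *)
have key r : (2 ^+ r * d) ^+ 2 <= 2 * K * 2 ^+ r.
  have := H r.+1; have -> : a = b * (1 + d).
    by rewrite /d addrCA subrr addr0 mulrC divfK.
  rewrite exprMn mulrC ler_pM2r ?exprn_gt0 // expnS mulnC exprM => H1.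
  rewrite [2 * K]mulrC -mulrA -exprS (le_trans _ H1) //.
  have d1 : 0 <= 1 + d by lra.
  have P0 : 0 <= 2 ^+ r * d by rewrite mulr_ge0 ?exprn_ge0 // ltW.
  rewrite ler_pXn2r ?nnegrE ?exprn_ge0 //.
  by have := bern (2 ^ r)%N; rewrite natrX; lra.
have key2 r : 2 ^+ r <= 2 * K / d ^+ 2.
  have := key r; rewrite ler_pdivlMr ?exprn_gt0 // exprMn expr2 -mulrA.
  rewrite [leRHS]mulrC ler_pM2l // exprn_gt0 //.
have [n] : exists n : nat, 2 * K / d ^+ 2 < n%:R.
  exists (Num.bound `|2 * K / d ^+ 2|); apply: le_lt_trans (ler_norm _) _.
  by rewrite archi_boundP.
move=> Hn; have : (n%:R : R) <= 2 ^+ n.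
  by rewrite -natrX ler_nat; exact/ltnW/ltn_expl.
by have := key2 n; lra.
Qed.

(** * Completion of a *-algebra with a C*-seminorm *)

Section RealLimits.
Variable R : realType.
Implicit Types u v : nat -> R.

Definition rlim u (l : R) :=
  forall eps : R, 0 < eps -> exists N, forall n, (N <= n)%N -> `|u n - l| < eps.

Lemma rlim_cauchy u :
  (forall eps : R, 0 < eps -> exists N, forall m n, (N <= m)%N -> (N <= n)%N ->
     `|u m - u n| < eps) ->
  exists l, rlim u l.
Proof.
move=> cu.
have /cauchy_cvgP /cvg_ex [l ul] : cauchy ((u : nat -> R^o) @ \oo).
  apply/cauchy_ballP => eps eps0; have [N HN] := cu _ eps0.
  near_simpl; exists ([set n | N <= n], [set n | N <= n])%N.
    by split; exists N.
  by move=> [m n] [/= Nm Nn]; rewrite -ball_normE /=; apply: HN.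
exists l => eps eps0.
move/cvgrPdist_lt : ul => /(_ _ eps0) [N _ HN].
by exists N => n Nn; have := HN n Nn; rewrite /= distrC.
Qed.

Lemma rlim_le u v l m :
  rlim u l -> rlim v m -> (forall n, u n <= v n) -> l <= m.
Proof.
move=> ul vm uv; rewrite leNgt; apply/negP => ml.
have d0 : 0 < (l - m) / 2 by rewrite divr_gt0 // subr_gt0.
have [N1 H1] := ul _ d0; have [N2 H2] := vm _ d0.
have := H1 _ (leq_maxl N1 N2); have := H2 _ (leq_maxr N1 N2).
have := uv (maxn N1 N2); rewrite !ltr_norml => ? /andP[_ ?] /andP[? _].
lra.
Qed.

Lemma rlim_unique u l m : rlim u l -> rlim u m -> l = m.
Proof.
by move=> ul um; apply/eqP; rewrite eq_le !(rlim_le ul um, rlim_le um ul).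
Qed.

Lemma rlim_cst c : rlim (fun=> c) c.
Proof. by move=> eps e0; exists 0%N => n _; rewrite subrr normr0. Qed.

Lemma rlimD u v l m : rlim u l -> rlim v m -> rlim (fun n => u n + v n) (l + m).
Proof.
move=> ul vm eps e0; have e2 : 0 < eps / 2 by rewrite divr_gt0.
have [N1 H1] := ul _ e2; have [N2 H2] := vm _ e2.
exists (maxn N1 N2) => n; rewrite geq_max => /andP[n1 n2].
rewrite opprD addrACA (le_lt_trans (ler_normD _ _)) //.
by have := H1 n n1; have := H2 n n2; lra.
Qed.

Lemma rlim_bounded u l : rlim u l -> exists2 M, 0 < M & forall n, `|u n| <= M.
Proof.
move=> /(_ 1 ltr01) [N HN].
exists (`|l| + 1 + \sum_(i < N) `|u i|) => [|n].
  by rewrite ltr_pwDl ?sumr_ge0 // ltr_wpDl.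
have [nN|Nn] := ltnP n N.
  rewrite (bigD1 (Ordinal nN)) //= addrCA lerDl !addr_ge0 ?sumr_ge0 //.
have S0 : 0 <= \sum_(i < N) `|u i| by apply: sumr_ge0.
have := HN n Nn; have := ler_normB (u n) l; have := ler_normD (u n - l) l.
rewrite subrK; lra.
Qed.

Lemma rlimM u v l m : rlim u l -> rlim v m -> rlim (fun n => u n * v n) (l * m).
Proof.
move=> ul vm eps e0; have [M M0 HM] := rlim_bounded ul.
have e1 : 0 < eps / 2 / M by rewrite !divr_gt0.
have m1 : 0 < `|m| + 1 by rewrite ltr_wpDl.
have e2 : 0 < eps / 2 / (`|m| + 1) by rewrite !divr_gt0.
have [N1 H1] := ul _ e2; have [N2 H2] := vm _ e1.
exists (maxn N1 N2) => n; rewrite geq_max => /andP[n1 n2].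
have -> : u n * v n - l * m = u n * (v n - m) + (u n - l) * m by ring.
rewrite (le_lt_trans (ler_normD _ _)) // !normrM.
have := H1 n n1; have := H2 n n2; rewrite !ltr_pdivlMr //.
have := HM n; have := normr_ge0 (v n - m); have := normr_ge0 (u n - l).
have := normr_ge0 m; nra.
Qed.

Lemma rlim_eventually0 u : (forall n, u n = 0) -> rlim u 0.
Proof. by move=> H eps e0; exists 0%N => n _; rewrite H subrr normr0. Qed.

End RealLimits.

(* The algebraic laws are only required up to distance 0, so that formal
   expressions can serve as elements. *)
Record precstar (R : realType) := PreCStar {
  pT :> Type;
  pd : pT -> pT -> R;
  p0 : pT; p1 : pT;
  padd : pT -> pT -> pT;
  psc : R[i] -> pT -> pT;
  pmul : pT -> pT -> pT;
  pst : pT -> pT;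
  pd_refl : forall x, pd x x = 0;
  pd_sym : forall x y, pd x y = pd y x;
  pd_tri : forall y x z, pd x z <= pd x y + pd y z;
  pd_add : forall x x' y y', pd (padd x y) (padd x' y') <= pd x x' + pd y y';
  pd_sc : forall c x y, pd (psc c x) (psc c y) <= cn c * pd x y;
  pd_st : forall x y, pd (pst x) (pst y) <= pd x y;
  pd_mull : forall x y y', pd (pmul x y) (pmul x y') <= pd x p0 * pd y y';
  pd_mulr : forall x x' y, pd (pmul x y) (pmul x' y) <= pd x x' * pd y p0;
  p_cstar : forall x, pd x p0 ^+ 2 <= pd (pmul (pst x) x) p0;
  p_addA : forall x y z, pd (padd x (padd y z)) (padd (padd x y) z) = 0;
  p_addC : forall x y, pd (padd x y) (padd y x) = 0;
  p_add0 : forall x, pd (padd p0 x) x = 0;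
  p_addN : forall x, pd (padd (psc (-1) x) x) p0 = 0;
  p_scA : forall a b x, pd (psc a (psc b x)) (psc (a * b) x) = 0;
  p_sc1 : forall x, pd (psc 1 x) x = 0;
  p_scDr : forall c x y, pd (psc c (padd x y)) (padd (psc c x) (psc c y)) = 0;
  p_scDl : forall x a b, pd (psc (a + b) x) (padd (psc a x) (psc b x)) = 0;
  p_mulA : forall x y z, pd (pmul x (pmul y z)) (pmul (pmul x y) z) = 0;
  p_mul1 : forall x, pd (pmul p1 x) x = 0;
  p_mulr1 : forall x, pd (pmul x p1) x = 0;
  p_mulDl : forall x y z, pd (pmul (padd x y) z) (padd (pmul x z) (pmul y z)) = 0;
  p_mulDr : forall x y z, pd (pmul x (padd y z)) (padd (pmul x y) (pmul x z)) = 0;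
  p_scAl : forall c x y, pd (psc c (pmul x y)) (pmul (psc c x) y) = 0;
  p_scAr : forall c x y, pd (psc c (pmul x y)) (pmul x (psc c y)) = 0;
  p_stD : forall x y, pd (pst (padd x y)) (padd (pst x) (pst y)) = 0;
  p_stZ : forall c x, pd (pst (psc c x)) (psc (c^*)%R (pst x)) = 0;
  p_stM : forall x y, pd (pst (pmul x y)) (pmul (pst y) (pst x)) = 0;
  p_stK : forall x, pd (pst (pst x)) x = 0
}.

Section Completion.
Variables (R : realType) (T : precstar R).
Implicit Types x y z : T.
Local Notation d := (@pd R T).
Local Notation Z := (p0 T).

Lemma pd_ge0 x y : 0 <= d x y.
Proof. by have := pd_tri y x x; rewrite pd_refl (pd_sym y x); lra. Qed.

Record cseq := CSeq {
  cval :> nat -> T;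
  _ : forall eps : R, 0 < eps -> exists N, forall m n, (N <= m)%N -> (N <= n)%N ->
     d (cval m) (cval n) < eps }.

HB.instance Definition _ := gen_eqMixin cseq.
HB.instance Definition _ := gen_choiceMixin cseq.

Lemma pd_dist4 x y x' y' : `|d x y - d x' y'| <= d x x' + d y y'.
Proof.
rewrite ler_norml; apply/andP; split.
  have := pd_tri x x' y'; have := pd_tri y x y'.
  by rewrite (pd_sym x' x); lra.
have := pd_tri x' x y; have := pd_tri y' x' y.
by rewrite (pd_sym y' y); lra.
Qed.

Lemma cdist_ex (u v : cseq) : exists l, rlim (fun n => d (u n) (v n)) l.
Proof.
case: u v => [u cu] [v cv] /=; apply: rlim_cauchy => eps e0.
have e2 : 0 < eps / 2 by rewrite divr_gt0.
have [N1 H1] := cu _ e2; have [N2 H2] := cv _ e2.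
exists (maxn N1 N2) => m n; rewrite !geq_max => /andP[m1 m2] /andP[n1 n2].
rewrite (le_lt_trans (pd_dist4 _ _ _ _)) //.
by have := H1 m n m1 n1; have := H2 m n m2 n2; lra.
Qed.

Definition cdist u v : R := projT1 (cid (cdist_ex u v)).

Lemma cdistP (u v : cseq) : rlim (fun n => d (u n) (v n)) (cdist u v).
Proof. exact: projT2 (cid _). Qed.

Lemma cdist_ge0 u v : 0 <= cdist u v.
Proof. by apply: rlim_le (rlim_cst 0) (cdistP u v) _ => n; apply: pd_ge0. Qed.

Lemma cdist_sym u v : cdist u v = cdist v u.
Proof.
apply: rlim_unique (cdistP u v) _.
by under eq_fun do rewrite pd_sym; exact: cdistP.
Qed.

Lemma cdist_tri v u w : cdist u w <= cdist u v + cdist v w.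
Proof.
apply: rlim_le (cdistP u w) (rlimD (cdistP u v) (cdistP v w)) _ => n.
exact: pd_tri.
Qed.

Lemma cdist_eq0 (u v : cseq) : (forall n, d (u n) (v n) = 0) -> cdist u v = 0.
Proof.
by move=> H; apply: rlim_unique (cdistP u v) _; exact: rlim_eventually0.
Qed.

(** Dividing Cauchy sequences by this relation completes the space and at the same time removes the
    elements of seminorm 0. *)
Definition crel (u v : cseq) : bool := `[< cdist u v = 0 >].

Lemma crel_refl : reflexive crel.
Proof. by move=> u; apply/asboolP/cdist_eq0 => n; rewrite pd_refl. Qed.

Lemma crel_sym : symmetric crel.
Proof. by move=> u v; rewrite /crel cdist_sym. Qed.

Lemma crel_trans : transitive crel.
Proof.
move=> v u w /asboolP uv /asboolP vw; apply/asboolP/eqP.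
by rewrite eq_le cdist_ge0 (le_trans (cdist_tri v _ _)) // uv vw addr0.
Qed.

Canonical crel_equiv := EquivRel crel crel_refl crel_sym crel_trans.
Definition completion := {eq_quot crel_equiv}%qT.
HB.instance Definition _ := Choice.on completion.

Definition ccl (u : cseq) : completion := (\pi_({eq_quot crel_equiv}) u)%qT.
Definition crp (x : completion) : cseq := repr x.

Lemma ccl_ind (Q : completion -> Prop) : (forall u, Q (ccl u)) -> forall xi, Q xi.
Proof. by move=> H x; rewrite -[x]reprK; exact: H. Qed.

Lemma cclP u v : ccl u = ccl v <-> cdist u v = 0.
Proof.
split=> [/eqP|uv]; last by apply/eqP; rewrite /ccl eqmodE; apply/asboolP.
by rewrite /ccl eqmodE => /asboolP.
Qed.

Lemma crp_ccl u : cdist (crp (ccl u)) u = 0.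
Proof. by apply/cclP; rewrite /ccl /crp reprK. Qed.

Lemma ccl_eq (u v : cseq) : (forall n, d (u n) (v n) = 0) -> ccl u = ccl v.
Proof. by move=> /cdist_eq0 /cclP. Qed.

Lemma cseq_lift1 (f : T -> T) (C : R) (u : cseq) :
  (forall x y, d (f x) (f y) <= C * d x y) ->
  forall eps : R, 0 < eps -> exists N, forall m n, (N <= m)%N -> (N <= n)%N ->
    d (f (u m)) (f (u n)) < eps.
Proof.
move=> fC eps e0; case: u => u cu /=.
have C1 : 0 < `|C| + 1 by rewrite ltr_wpDl.
have [N HN] := cu _ (divr_gt0 e0 C1); exists N => m n Nm Nn.
have := HN m n Nm Nn; rewrite ltr_pdivlMr // => H.
rewrite (le_lt_trans (fC _ _)) //; apply: le_lt_trans H.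
rewrite mulrC ler_wpM2l ?pd_ge0 //.
by rewrite (le_trans (ler_norm C)) // lerDl.
Qed.

Lemma cseq_add_subproof (u v : cseq) :
  forall eps : R, 0 < eps -> exists N, forall m n, (N <= m)%N -> (N <= n)%N ->
    d (padd (u m) (v m)) (padd (u n) (v n)) < eps.
Proof.
move=> eps e0; case: u v => [u cu] [v cv] /=.
have e2 : 0 < eps / 2 by rewrite divr_gt0.
have [N1 H1] := cu _ e2; have [N2 H2] := cv _ e2.
exists (maxn N1 N2) => m n; rewrite !geq_max => /andP[m1 m2] /andP[n1 n2].
rewrite (le_lt_trans (pd_add _ _ _ _)) //.
by have := H1 m n m1 n1; have := H2 m n m2 n2; lra.
Qed.

Definition ccst x : cseq.
Proof.
by exists (fun=> x) => eps e0; exists 0%N => m n _ _; rewrite pd_refl.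
Defined.

Lemma cseq_bounded (u : cseq) : exists2 M, 0 < M & forall n, d (u n) Z <= M.
Proof.
have [M M0 HM] := rlim_bounded (cdistP u (ccst Z)); exists M => // n.
by have := HM n; rewrite ger0_norm ?pd_ge0.
Qed.

Lemma cseq_mul_subproof (u v : cseq) :
  forall eps : R, 0 < eps -> exists N, forall m n, (N <= m)%N -> (N <= n)%N ->
    d (pmul (u m) (v m)) (pmul (u n) (v n)) < eps.
Proof.
move=> eps e0; have [M M0 HM] := cseq_bounded u; have [K K0 HK] := cseq_bounded v.
case: u v HM HK => [u cu] [v cv] /= HM HK.
have e1 : 0 < eps / 2 / M by rewrite !divr_gt0.
have e2 : 0 < eps / 2 / K by rewrite !divr_gt0.
have [N1 H1] := cu _ e2; have [N2 H2] := cv _ e1.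
exists (maxn N1 N2) => m n; rewrite !geq_max => /andP[m1 m2] /andP[n1 n2].
rewrite (le_lt_trans (pd_tri (pmul (u m) (v n)) _ _)) //.
have := H1 m n m1 n1; have := H2 m n m2 n2; rewrite !ltr_pdivlMr //.
have := pd_mull (u m) (v m) (v n); have := pd_mulr (u m) (u n) (v n).
have := HM m; have := HK n; have := pd_ge0 (u m) (u n).
have := pd_ge0 (v m) (v n); nra.
Qed.

Definition cadd u v : cseq := CSeq (@cseq_add_subproof u v).
Definition cmul u v : cseq := CSeq (@cseq_mul_subproof u v).
Definition csc c u : cseq := CSeq (cseq_lift1 u (pd_sc c)).
Lemma pd_st1 x y : d (pst x) (pst y) <= 1 * d x y.
Proof. by rewrite mul1r pd_st. Qed.
Definition cst u : cseq := CSeq (cseq_lift1 u pd_st1).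

Definition qadd (a b : completion) := ccl (cadd (crp a) (crp b)).
Definition qmul (a b : completion) := ccl (cmul (crp a) (crp b)).
Definition qsc c (a : completion) := ccl (csc c (crp a)).
Definition qst (a : completion) := ccl (cst (crp a)).
Definition qopp (a : completion) := qsc (-1) a.
Definition q0 := ccl (ccst Z).
Definition q1 := ccl (ccst (p1 T)).

Lemma cdist_le0 u v : cdist u v <= 0 -> ccl u = ccl v.
Proof. by move=> H; apply/cclP/eqP; rewrite eq_le H cdist_ge0. Qed.

Lemma qaddE u v : qadd (ccl u) (ccl v) = ccl (cadd u v).
Proof.
apply: cdist_le0; rewrite -[leRHS]addr0 -{1}(crp_ccl u) -(crp_ccl v).
apply: rlim_le (cdistP _ _) (rlimD (cdistP _ _) (cdistP _ _)) _ => n.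
exact: pd_add.
Qed.

Lemma qscE c u : qsc c (ccl u) = ccl (csc c u).
Proof.
apply: cdist_le0; rewrite -[leRHS](mulr0 (cn c)) -(crp_ccl u).
apply: rlim_le (cdistP _ _) (rlimM (rlim_cst _) (cdistP _ _)) _ => n.
exact: pd_sc.
Qed.

Lemma qstE u : qst (ccl u) = ccl (cst u).
Proof.
apply: cdist_le0; rewrite -(crp_ccl u).
apply: rlim_le (cdistP _ _) (cdistP _ _) _ => n.
exact: pd_st.
Qed.

Lemma qmulE u v : qmul (ccl u) (ccl v) = ccl (cmul u v).
Proof.
pose u' := crp (ccl u); pose v' := crp (ccl v).
apply: cdist_le0.
have -> : 0 = cdist u' (ccst Z) * cdist v' v + cdist u' u * cdist v (ccst Z).
  by rewrite !crp_ccl mulr0 mul0r addr0.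
apply: rlim_le (cdistP _ _) (rlimD (rlimM (cdistP _ _) (cdistP _ _))
  (rlimM (cdistP _ _) (cdistP _ _))) _ => n.
rewrite (le_trans (pd_tri (pmul (u' n) (v n)) _ _)) // lerD //.
  exact: pd_mull.
exact: pd_mulr.
Qed.

Definition qE := (qaddE, qscE, qstE, qmulE).

Lemma qaddA : associative qadd.
Proof.
elim/ccl_ind=> u; elim/ccl_ind=> v; elim/ccl_ind=> w; rewrite !qE.
by apply: ccl_eq => n; apply: p_addA.
Qed.

Lemma qaddC : commutative qadd.
Proof.
elim/ccl_ind=> u; elim/ccl_ind=> v; rewrite !qE.
by apply: ccl_eq => n; apply: p_addC.
Qed.

Lemma qadd0 : left_id q0 qadd.
Proof. by elim/ccl_ind=> u; rewrite !qE; apply: ccl_eq => n; apply: p_add0. Qed.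

Lemma qaddN : left_inverse q0 qopp qadd.
Proof.
by elim/ccl_ind=> u; rewrite /qopp !qE; apply: ccl_eq => n; apply: p_addN.
Qed.

HB.instance Definition _ :=
  GRing.isZmodule.Build completion qaddA qaddC qadd0 qaddN.

Lemma qscA a b (x : completion) : qsc a (qsc b x) = qsc (a * b) x.
Proof. by elim/ccl_ind: x => u; rewrite !qE; apply: ccl_eq => n; apply: p_scA. Qed.

Lemma qsc1 : left_id 1 qsc.
Proof. by elim/ccl_ind=> u; rewrite !qE; apply: ccl_eq => n; apply: p_sc1. Qed.

Lemma qscDr : right_distributive qsc +%R.
Proof.
move=> c; elim/ccl_ind=> u; elim/ccl_ind=> v; rewrite /GRing.add /= !qE.
by apply: ccl_eq => n; apply: p_scDr.
Qed.

Lemma qscDl (x : completion) : {morph qsc^~ x : a b / a + b}.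
Proof.
move=> a b; elim/ccl_ind: x => u; rewrite [RHS]/GRing.add /= !qE.
by apply: ccl_eq => n; apply: p_scDl.
Qed.

HB.instance Definition _ :=
  GRing.Zmodule_isLmodule.Build R[i] completion qscA qsc1 qscDr qscDl.

Definition qn (a : completion) : R := cdist (crp a) (ccst Z).

Lemma qnE u : qn (ccl u) = cdist u (ccst Z).
Proof.
have H := crp_ccl u; apply/eqP; rewrite eq_le /qn.
have := cdist_tri u (crp (ccl u)) (ccst Z).
have := cdist_tri (crp (ccl u)) u (ccst Z).
by rewrite (cdist_sym u (crp _)) H !add0r => -> ->.
Qed.

Lemma qnD (x y : completion) : qn (x + y) <= qn x + qn y.
Proof.
elim/ccl_ind: x => u; elim/ccl_ind: y => v; rewrite [_ + _]qaddE !qnE.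
have -> : cdist (cadd u v) (ccst Z) = cdist (cadd u v) (cadd (ccst Z) (ccst Z)).
  apply/eqP; rewrite eq_le.
  have H : cdist (cadd (ccst Z) (ccst Z)) (ccst Z) = 0.
    by apply: cdist_eq0 => n; apply: p_add0.
  have := cdist_tri (cadd (ccst Z) (ccst Z)) (cadd u v) (ccst Z).
  have := cdist_tri (ccst Z) (cadd u v) (cadd (ccst Z) (ccst Z)).
  by rewrite (cdist_sym (ccst Z) (cadd _ _)) H !addr0 => -> ->.
apply: rlim_le (cdistP _ _) (rlimD (cdistP _ _) (cdistP _ _)) _ => n.
exact: pd_add.
Qed.

Lemma qn_ge0 (x : completion) : 0 <= qn x.
Proof. exact: cdist_ge0. Qed.

Lemma qn_eq0 (x : completion) : qn x = 0 -> x = 0.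
Proof. by elim/ccl_ind: x => u; rewrite qnE => /cclP. Qed.

Lemma qnZ_le c (x : completion) : qn (c *: x) <= cn c * qn x.
Proof.
elim/ccl_ind: x => u; rewrite [_ *: _]qscE !qnE.
have -> : cdist (csc c u) (ccst Z) = cdist (csc c u) (csc c (ccst Z)).
  have H : cdist (csc c (ccst Z)) (ccst Z) = 0.
    by apply/cclP; rewrite -qscE; exact: (scaler0 _ c).
  have := cdist_tri (csc c (ccst Z)) (csc c u) (ccst Z).
  have := cdist_tri (ccst Z) (csc c u) (csc c (ccst Z)).
  rewrite (cdist_sym (ccst Z) (csc _ _)) H !addr0 => H1 H2.
  by apply/eqP; rewrite eq_le H1 H2.
apply: rlim_le (cdistP _ _) (rlimM (rlim_cst _) (cdistP _ _)) _ => n.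
exact: pd_sc.
Qed.

Lemma qnZ c (x : completion) : qn (c *: x) = cn c * qn x.
Proof.
apply/eqP; rewrite eq_le qnZ_le /=.
have [->|c0] := eqVneq c 0; first by rewrite cn0 mul0r qn_ge0.
rewrite -{1}[x](scalerK c0) (le_trans (ler_wpM2l _ (qnZ_le _ _))) ?cn_ge0 //.
by rewrite mulrA -cnM divff // cn1 mul1r.
Qed.

Definition qnorm (x : completion) : R[i] := (qn x)%:C.

Lemma qnormD (x y : completion) : qnorm (x + y) <= qnorm x + qnorm y.
Proof. by rewrite -rmorphD lecR qnD. Qed.

Lemma qnormZ c (x : completion) : qnorm (c *: x) = `|c| * qnorm x.
Proof. by rewrite cnE -rmorphM /= /qnorm qnZ. Qed.

Lemma qnorm_eq0 (x : completion) : qnorm x = 0 -> x = 0.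
Proof. by move=> H; apply/qn_eq0/complexI. Qed.

HB.instance Definition _ :=
  Lmodule_isNormed.Build R[i] completion qnormD qnormZ qnorm_eq0.

Lemma nrm_qn (x : completion) : nrm x = qn x.
Proof. by []. Qed.

Definition emb (x : T) : completion := ccl (ccst x).

Lemma cdist_cst x y : cdist (ccst x) (ccst y) = d x y.
Proof. by apply: rlim_unique (cdistP _ _) _; exact: (rlim_cst (d x y)). Qed.

Lemma qn_sub u v : qn (ccl u - ccl v) = cdist u v.
Proof.
have HN w : - ccl w = ccl (csc (-1) w) by rewrite [LHS]qscE.
have le w w' : qn (ccl w - ccl w') <= cdist w w'.
  rewrite HN [_ + _]qaddE qnE.
  have E : ccl (cadd w' (csc (-1) w')) = ccl (ccst Z).
    by rewrite -qaddE -qscE; exact: (subrr (ccl w')).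
  move/cclP : E => E.
  rewrite (le_trans (cdist_tri (cadd w' (csc (-1) w')) _ _)) // E addr0.
  apply: rlim_le (cdistP _ _) (cdistP _ _) _ => n.
  rewrite (le_trans (pd_add _ _ _ _)) //= pd_refl addr0 //.
apply/eqP; rewrite eq_le le /=.
pose w := cadd u (csc (-1) v).
have Eu : ccl (cadd w v) = ccl u.
  by rewrite -!qaddE -qscE; exact: (subrK (ccl v) (ccl u)).
have Ev : ccl (cadd (ccst Z) v) = ccl v.
  by rewrite -!qaddE; exact: (add0r (ccl v)).
have -> : cdist u v = cdist (cadd w v) (cadd (ccst Z) v).
  move/cclP : Eu => Eu; move/cclP : Ev => Ev; apply/eqP; rewrite eq_le.
  have := cdist_tri (cadd w v) u v.
  have := cdist_tri (cadd (ccst Z) v) (cadd w v) v.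
  have := cdist_tri u (cadd w v) (cadd (ccst Z) v).
  have := cdist_tri v u (cadd (ccst Z) v).
  rewrite (cdist_sym u (cadd w v)) (cdist_sym v (cadd (ccst Z) v)) Eu Ev; lra.
rewrite HN [_ + _]qaddE qnE.
apply: rlim_le (cdistP _ _) (cdistP _ _) _ => n.
by rewrite (le_trans (pd_add _ _ _ _)) //= pd_refl addr0.
Qed.

Lemma qn_emb_sub x y : qn (emb x - emb y) = d x y.
Proof. by rewrite qn_sub cdist_cst. Qed.

Lemma emb_dense (xi : completion) (eps : R) : 0 < eps ->
  exists x, nrm (xi - emb x) < eps.
Proof.
move=> e0; have e2 : 0 < eps / 2 by rewrite divr_gt0.
elim/ccl_ind: xi => u; case Eu : u => [v cv] /=; rewrite -Eu.
have [N HN] := cv _ e2; exists (v N).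
rewrite nrm_qn qn_sub.
have [M HM] := cdistP u (ccst (v N)) e2.
have := HM _ (leq_maxl M N); have := HN (maxn M N) N (leq_maxr _ _) (leqnn _).
by rewrite Eu /= ltr_norml => ? /andP[? _]; lra.
Qed.

Lemma emb_seq_limit (t : nat -> T) :
  (forall eps : R, 0 < eps -> exists N, forall m n, (N <= m)%N -> (N <= n)%N ->
     d (t m) (t n) < eps) ->
  exists xi : completion, forall eps : R, 0 < eps ->
    exists N, forall n, (N <= n)%N -> nrm (emb (t n) - xi) < eps.
Proof.
move=> ct; exists (ccl (CSeq ct)) => eps e0.
have e2 : 0 < eps / 2 by rewrite divr_gt0.
have [N HN] := ct _ e2; exists N => n Nn.
rewrite nrm_qn qn_sub.
have [M HM] := cdistP (ccst (t n)) (CSeq ct) e2.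
have := HM _ (leq_maxl M N).
have := HN n (maxn M N) Nn (leq_maxr _ _).
by rewrite /= ltr_norml => ? /andP[? _]; lra.
Qed.

Lemma ltc_realP (eps : R[i]) : 0 < eps -> 0 < complex.Re eps /\ eps = (complex.Re eps)%:C.
Proof. by case: eps => a b; rewrite ltcE /= => /andP[/eqP -> ->]. Qed.

(** Completeness is stated for filters. For each n an embedded element of T is chosen whose ball of
    radius 2 / (n + 1) belongs to the filter; these elements form a Cauchy sequence, and the filter
    converges to its limit. *)
Lemma completion_complete (F : set_system completion) :
  ProperFilter F -> cauchy F -> cvg F.
Proof.
move=> FF /cauchy_ballP Fc; apply/cvg_ex.
have [iv iv0 small] : exists2 iv : nat -> R, forall n, 0 < iv n &
    forall eps : R, 0 < eps -> exists N, forall n, (N <= n)%N -> iv n < eps.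
  exists (fun n => n.+1%:R^-1) => [n|eps e0]; first by rewrite invr_gt0 ltr0n.
  exists (Num.bound eps^-1) => n Nn.
  rewrite invf_plt ?posrE ?ltr0n //.
  have := archi_boundP (_ : 0 <= eps^-1); rewrite invr_ge0 (ltW e0) => /(_ isT).
  by move=> /lt_le_trans -> //; rewrite ler_nat (leq_trans Nn).
have ballP_ (x y : completion) (r : R) : ball x r%:C y <-> nrm (x - y) < r.
  by rewrite -ball_normE /= nrmE ltcR.
have key n : exists t : T, F [set y | nrm (emb t - y) < iv n + iv n].
  have /cauchyP /(_ (iv n)%:C) : cauchy F by apply/cauchy_ballP.
  rewrite ltcR => /(_ (iv0 n)) [xi Fxi].
  have [t tP] := emb_dense xi (iv0 n); exists t.
  apply: filterS Fxi => y /ballP_ yxi /=.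
  have H : nrm (emb t - y) <= nrm (xi - emb t) + nrm (xi - y).
    by rewrite (nrmB xi (emb t)); exact: nrm_dist.
  by rewrite (le_lt_trans H) // ltrD.
have [t tP] := choice key.
have tt m n : d (t m) (t n) < (iv m + iv m) + (iv n + iv n).
  have [y [/= Hm Hn]] := filter_ex (filterI (tP m) (tP n)).
  rewrite -qn_emb_sub -nrm_qn.
  by rewrite (le_lt_trans (nrm_dist y _ _)) // ltrD // nrmB.
have [|xi xiP] := @emb_seq_limit t.
  move=> eps e0; have e4 : 0 < eps / 4 by rewrite divr_gt0.
  have [N HN] := small _ e4; exists N => m n Nm Nn.
  by have := tt m n; have := HN _ Nm; have := HN _ Nn; lra.
exists xi; apply/cvgrPdist_lt => eps /ltc_realP [e0 ->].
have e4 : 0 < complex.Re eps / 4 by rewrite divr_gt0.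
have [N HN] := small _ e4; have [M HM] := xiP _ e4.
have := HN _ (leq_maxl N M); have := HM _ (leq_maxr N M).
move=> H1 H2; apply: filterS (tP (maxn N M)) => y /= H3.
rewrite nrmE ltcR.
rewrite (le_lt_trans (nrm_dist (emb (t (maxn N M))) _ _)) // nrmB; lra.
Qed.

HB.instance Definition _ :=
  Uniform_isComplete.Build completion completion_complete.

Lemma qmulA : associative qmul.
Proof.
elim/ccl_ind=> u; elim/ccl_ind=> v; elim/ccl_ind=> w; rewrite !qE.
by apply: ccl_eq => n; apply: p_mulA.
Qed.

Lemma qmul1 : left_id q1 qmul.
Proof. by elim/ccl_ind=> u; rewrite !qE; apply: ccl_eq => n; apply: p_mul1. Qed.

Lemma qmulr1 : right_id q1 qmul.
Proof. by elim/ccl_ind=> u; rewrite !qE; apply: ccl_eq => n; apply: p_mulr1. Qed.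

Lemma qmulDl : left_distributive qmul +%R.
Proof.
elim/ccl_ind=> u; elim/ccl_ind=> v; elim/ccl_ind=> w; rewrite /GRing.add /= !qE.
by apply: ccl_eq => n; apply: p_mulDl.
Qed.

Lemma qmulDr : right_distributive qmul +%R.
Proof.
elim/ccl_ind=> u; elim/ccl_ind=> v; elim/ccl_ind=> w; rewrite /GRing.add /= !qE.
by apply: ccl_eq => n; apply: p_mulDr.
Qed.

Lemma qscAl c (x y : completion) : c *: qmul x y = qmul (c *: x) y.
Proof.
elim/ccl_ind: x => u; elim/ccl_ind: y => v; rewrite /GRing.scale /= !qE.
by apply: ccl_eq => n; apply: p_scAl.
Qed.

Lemma qscAr c (x y : completion) : c *: qmul x y = qmul x (c *: y).
Proof.
elim/ccl_ind: x => u; elim/ccl_ind: y => v; rewrite /GRing.scale /= !qE.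
by apply: ccl_eq => n; apply: p_scAr.
Qed.

Lemma qstD : {morph qst : x y / x + y}.
Proof.
elim/ccl_ind=> u; elim/ccl_ind=> v; rewrite /GRing.add /= !qE.
by apply: ccl_eq => n; apply: p_stD.
Qed.

Lemma qstZ c (x : completion) : qst (c *: x) = (c^*)%R *: qst x.
Proof.
elim/ccl_ind: x => u; rewrite /GRing.scale /= !qE.
by apply: ccl_eq => n; apply: p_stZ.
Qed.

Lemma qstM (x y : completion) : qst (qmul x y) = qmul (qst y) (qst x).
Proof.
elim/ccl_ind: x => u; elim/ccl_ind: y => v; rewrite !qE.
by apply: ccl_eq => n; apply: p_stM.
Qed.

Lemma qstK : involutive qst.
Proof. by elim/ccl_ind=> u; rewrite !qE; apply: ccl_eq => n; apply: p_stK. Qed.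

Lemma qnM (x y : completion) : qn (qmul x y) <= qn x * qn y.
Proof.
elim/ccl_ind: x => u; elim/ccl_ind: y => v; rewrite !qE !qnE.
have -> : cdist (cmul u v) (ccst Z) = cdist (cmul u v) (cmul u (ccst Z)).
  have H : cdist (cmul u (ccst Z)) (ccst Z) = 0.
    apply/eqP; rewrite eq_le cdist_ge0 andbT.
    have H0 : cdist (cmul u (ccst Z)) (cmul u (csc 0 (ccst Z))) <= 0.
      have -> : 0 = cdist u (ccst Z) * cdist (ccst Z) (csc 0 (ccst Z)) :> R.
        have /cclP -> : ccl (ccst Z) = ccl (csc 0 (ccst Z)).
          by rewrite -qscE; exact: esym (scale0r _).
        by rewrite mulr0.
      apply: rlim_le (cdistP _ _) (rlimM (cdistP _ _) (cdistP _ _)) _ => n.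
      exact: pd_mull.
    have H1 : cdist (cmul u (csc 0 (ccst Z))) (ccst Z) = 0.
      apply/cclP; rewrite -qmulE -qscE -[qsc 0 _]/(0 *: ccl (ccst Z)) -qscAr.
      by rewrite scale0r.
    by rewrite (le_trans (cdist_tri (cmul u (csc 0 (ccst Z))) _ _)) // H1 addr0.
  have := cdist_tri (cmul u (ccst Z)) (cmul u v) (ccst Z).
  have := cdist_tri (ccst Z) (cmul u v) (cmul u (ccst Z)).
  rewrite (cdist_sym (ccst Z) (cmul _ _)) H !addr0 => H1 H2.
  by apply/eqP; rewrite eq_le H1 H2.
apply: rlim_le (cdistP _ _) (rlimM (cdistP _ _) (cdistP _ _)) _ => n.
exact: pd_mull.
Qed.

Lemma qn_cstar_ge (x : completion) : qn x ^+ 2 <= qn (qmul (qst x) x).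
Proof.
elim/ccl_ind: x => u; rewrite !qE !qnE expr2.
apply: rlim_le (rlimM (cdistP _ _) (cdistP _ _)) (cdistP _ _) _ => n.
by rewrite -expr2 p_cstar.
Qed.

Lemma qn_st_le (x : completion) : qn (qst x) <= qn x.
Proof.
elim/ccl_ind: x => u; rewrite !qE !qnE.
have -> : cdist (cst u) (ccst Z) = cdist (cst u) (cst (ccst Z)).
  have H : cdist (cst (ccst Z)) (ccst Z) = 0.
    apply/cclP; rewrite -qstE.
    by apply: (addrI (qst q0)); rewrite -[ccl _]/(0 : completion) -qstD !addr0.
  have := cdist_tri (cst (ccst Z)) (cst u) (ccst Z).
  have := cdist_tri (ccst Z) (cst u) (cst (ccst Z)).
  rewrite (cdist_sym (ccst Z) (cst _)) H !addr0 => H1 H2.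
  by apply/eqP; rewrite eq_le H1 H2.
apply: rlim_le (cdistP _ _) (cdistP _ _) _ => n.
exact: pd_st.
Qed.

Lemma qnorm_mul (x y : completion) : `|qmul x y| <= `|x| * `|y|.
Proof. by rewrite !nrmE -rmorphM lecR !nrm_qn qnM. Qed.

Lemma qnorm_cstar (x : completion) : `|qmul (qst x) x| = `|x| ^+ 2.
Proof.
rewrite !nrmE -rmorphXn /= !nrm_qn; congr _%:C.
apply/eqP; rewrite eq_le qn_cstar_ge andbT (le_trans (qnM _ _)) // expr2.
by rewrite ler_wpM2r ?qn_ge0 // qn_st_le.
Qed.

HB.instance Definition _ := isCStarAlgebra.Build R completion
  qmulA qmul1 qmulr1 qmulDl qmulDr qscAl qscAr qstD qstZ qstM qstK
  qnorm_mul qnorm_cstar.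

Definition cstar_completion : cstarType R := completion.
Definition cemb (x : T) : cstar_completion := emb x.

Lemma nrm_cemb x : nrm (cemb x) = d x Z.
Proof. by rewrite [LHS]qnE cdist_cst. Qed.

Lemma nrm_cembB x y : nrm (cemb x - cemb y) = d x y.
Proof. exact: qn_emb_sub. Qed.

Lemma cembD x y : cemb (padd x y) = cemb x + cemb y.
Proof. by rewrite [RHS]qaddE; apply: ccl_eq => n /=; rewrite pd_refl. Qed.

Lemma cembZ c x : cemb (psc c x) = c *: cemb x.
Proof. by rewrite [RHS]qscE; apply: ccl_eq => n /=; rewrite pd_refl. Qed.

Lemma cembM x y : cemb (pmul x y) = cemb x * cemb y.
Proof. by rewrite [RHS]qmulE; apply: ccl_eq => n /=; rewrite pd_refl. Qed.

Lemma cembS x : cemb (pst x) = star (cemb x).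
Proof. by rewrite [RHS]qstE; apply: ccl_eq => n /=; rewrite pd_refl. Qed.

Lemma cemb_dense (xi : cstar_completion) (eps : R) : 0 < eps ->
  exists x, nrm (xi - cemb x) < eps.
Proof. exact: emb_dense. Qed.

End Completion.

(** * Universal C*-algebras *)

Section Universal.
Variables (R : realType) (X : Type).

Inductive term :=
| TVar of X | T0 | T1
| TAdd of term & term | TSc of R[i] & term | TMul of term & term | TSt of term.

Fixpoint ev (D : cstarType R) (phi : X -> D) (t : term) : D :=
  match t with
  | TVar x => phi x
  | T0 => 0
  | T1 => 1
  | TAdd a b => ev phi a + ev phi b
  | TSc c a => c *: ev phi a
  | TMul a b => ev phi a * ev phi b
  | TSt a => star (ev phi a)
  end.

Lemma star_hom_ev (D E : cstarType R) (f : D -> E) (phi : X -> D) t :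
  star_hom f -> f (ev phi t) = ev (f \o phi) t.
Proof.
move=> fP; elim: t => //= [||a IHa b IHb|c a IHa|a IHa b IHb|a IHa].
- exact: star_hom0.
- exact: star_hom1.
- by rewrite star_homD // IHa IHb.
- by rewrite star_homZ // IHa.
- by rewrite star_homM // IHa IHb.
- by rewrite star_homS // IHa.
Qed.

Variable K : forall D : cstarType R, (X -> D) -> Prop.
Variable M : X -> R.
Hypothesis K_bound :
  forall (D : cstarType R) (phi : X -> D) x, K phi -> nrm (phi x) <= M x.

(** A bound that does not depend on the representation; it makes the supremum below finite. *)
Fixpoint tbound (t : term) : R :=
  match t with
  | TVar x => `|M x|
  | T0 => 0
  | T1 => 1
  | TAdd a b => tbound a + tbound b
  | TSc c a => cn c * tbound a
  | TMul a b => tbound a * tbound b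
  | TSt a => tbound a
  end.

Lemma tboundP (D : cstarType R) (phi : X -> D) t :
  K phi -> nrm (ev phi t) <= tbound t.
Proof.
move=> Kphi; elim: t => /= [x|||a IHa b IHb|c a IHa|a IHa b IHb|a IHa].
- exact: le_trans (K_bound x Kphi) (ler_norm _).
- by rewrite nrm0.
- exact: nrm1_le.
- by rewrite (le_trans (nrmD _ _)) // lerD.
- by rewrite nrmZ ler_wpM2l // cn_ge0.
- by rewrite (le_trans (nrmM _ _)) // ler_pM ?nrm_ge0.
- by rewrite nrm_star.
Qed.

(** D ranges over all C*-algebras, yet the values form a set of reals. The member 0 keeps this set
    inhabited when K has no representation. *)
Definition usup (t s : term) : set R := [set r | r = 0 \/
  exists (D : cstarType R) (phi : X -> D), K phi /\ r = nrm (ev phi t - ev phi s)].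

Definition ud (t s : term) : R := sup (usup t s).

Lemma ud_has_sup t s : has_sup (usup t s).
Proof.
split; first by exists 0; left.
exists (`|tbound t| + `|tbound s|) => r [->|[D [phi [Kphi ->]]]].
  by rewrite addr_ge0.
rewrite (le_trans (nrmD _ _)) // nrmN lerD //.
  exact: le_trans (tboundP _ Kphi) (ler_norm _).
exact: le_trans (tboundP _ Kphi) (ler_norm _).
Qed.

Lemma ud_ge (D : cstarType R) (phi : X -> D) t s :
  K phi -> nrm (ev phi t - ev phi s) <= ud t s.
Proof.
move=> Kphi; apply: (sup_upper_bound (ud_has_sup t s)).
by right; exists D, phi.
Qed.

Lemma ud_ge0 t s : 0 <= ud t s.
Proof. by apply: (sup_upper_bound (ud_has_sup t s)); left. Qed.

Lemma ud_le t s c : 0 <= c ->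
  (forall (D : cstarType R) (phi : X -> D), K phi ->
     nrm (ev phi t - ev phi s) <= c) -> ud t s <= c.
Proof.
move=> c0 H; apply: ge_sup; first by case: (ud_has_sup t s).
by move=> r [->//|[D [phi [Kphi ->]]]]; apply: H.
Qed.

Lemma ud_eq0 t s :
  (forall (D : cstarType R) (phi : X -> D), K phi -> ev phi t = ev phi s) ->
  ud t s = 0.
Proof.
move=> H; apply/eqP; rewrite eq_le ud_ge0 andbT; apply: ud_le => // D phi Kphi.
by rewrite (H _ _ Kphi) subrr nrm0.
Qed.

Lemma ud0_ge (D : cstarType R) (phi : X -> D) t :
  K phi -> nrm (ev phi t) <= ud t T0.
Proof. by move=> Kphi; have := ud_ge t T0 Kphi; rewrite /= subr0. Qed.

Definition uprecstar : precstar R.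
Proof.
apply: (@PreCStar R term ud T0 T1 TAdd TSc TMul TSt).
- by move=> x; apply: ud_eq0.
- by move=> x y; apply/eqP; rewrite eq_le; apply/andP; split;
    apply: ud_le (ud_ge0 _ _) _ => D phi Kphi; rewrite nrmB ud_ge.
- move=> y x z; apply: ud_le => [|D phi Kphi]; first by rewrite addr_ge0 ?ud_ge0.
  by rewrite (le_trans (nrm_dist (ev phi y) _ _)) // lerD ?ud_ge.
- move=> x x' y y'; apply: ud_le => [|D phi Kphi]; first by rewrite addr_ge0 ?ud_ge0.
  by rewrite /= opprD addrACA (le_trans (nrmD _ _)) // lerD ?ud_ge.
- move=> c x y; apply: ud_le => [|D phi Kphi]; first by rewrite mulr_ge0 ?cn_ge0 ?ud_ge0.
  by rewrite /= -scalerBr nrmZ ler_wpM2l ?cn_ge0 ?ud_ge.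
- move=> x y; apply: ud_le => [|D phi Kphi]; first exact: ud_ge0.
  by rewrite /= -starB nrm_star ud_ge.
- move=> x y y'; apply: ud_le => [|D phi Kphi]; first by rewrite mulr_ge0 ?ud_ge0.
  by rewrite /= -mulrBr (le_trans (nrmM _ _)) // ler_pM ?nrm_ge0 ?ud_ge ?ud0_ge.
- move=> x x' y; apply: ud_le => [|D phi Kphi]; first by rewrite mulr_ge0 ?ud_ge0.
  by rewrite /= -mulrBl (le_trans (nrmM _ _)) // ler_pM ?nrm_ge0 ?ud_ge ?ud0_ge.
- move=> x; set c := ud (TMul _ _) _.
  have c0 : 0 <= c by exact: ud_ge0.
  rewrite -[leRHS]sqr_sqrtr // ler_pXn2r ?nnegrE ?ud_ge0 ?sqrtr_ge0 //.
  apply: ud_le; rewrite ?sqrtr_ge0 // => D phi Kphi.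
  rewrite -(@ler_pXn2r _ 2) ?nnegrE ?nrm_ge0 ?sqrtr_ge0 // sqr_sqrtr //=.
  by rewrite subr0 -nrm_star2; exact: (ud0_ge (TMul (TSt x) x) Kphi).
- by move=> x y z; apply: ud_eq0 => D phi _ /=; rewrite addrA.
- by move=> x y; apply: ud_eq0 => D phi _ /=; rewrite addrC.
- by move=> x; apply: ud_eq0 => D phi _ /=; rewrite add0r.
- by move=> x; apply: ud_eq0 => D phi _ /=; rewrite scaleN1r addNr.
- by move=> a b x; apply: ud_eq0 => D phi _ /=; rewrite scalerA.
- by move=> x; apply: ud_eq0 => D phi _ /=; rewrite scale1r.
- by move=> c x y; apply: ud_eq0 => D phi _ /=; rewrite scalerDr.
- by move=> x a b; apply: ud_eq0 => D phi _ /=; rewrite scalerDl.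
- by move=> x y z; apply: ud_eq0 => D phi _ /=; rewrite mulrA.
- by move=> x; apply: ud_eq0 => D phi _ /=; rewrite mul1r.
- by move=> x; apply: ud_eq0 => D phi _ /=; rewrite mulr1.
- by move=> x y z; apply: ud_eq0 => D phi _ /=; rewrite mulrDl.
- by move=> x y z; apply: ud_eq0 => D phi _ /=; rewrite mulrDr.
- by move=> c x y; apply: ud_eq0 => D phi _ /=; rewrite scaleAl.
- by move=> c x y; apply: ud_eq0 => D phi _ /=; rewrite scaleAr.
- by move=> x y; apply: ud_eq0 => D phi _ /=; rewrite starDr.
- by move=> c x; apply: ud_eq0 => D phi _ /=; rewrite starZ.
- by move=> x y; apply: ud_eq0 => D phi _ /=; rewrite starMr.
- by move=> x; apply: ud_eq0 => D phi _ /=; rewrite starK.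
Defined.

Definition univ : cstarType R := cstar_completion uprecstar.
Definition ugen (x : X) : univ := @cemb R uprecstar (TVar x).
Definition uemb (t : term) : univ := @cemb R uprecstar t.

Lemma ev_ugen t : ev ugen t = uemb t.
Proof.
elim: t => //= [a IHa b IHb|c a IHa|a IHa b IHb|a IHa].
- by rewrite IHa IHb; exact: esym (@cembD R uprecstar a b).
- by rewrite IHa; exact: esym (@cembZ R uprecstar c a).
- by rewrite IHa IHb; exact: esym (@cembM R uprecstar a b).
- by rewrite IHa; exact: esym (@cembS R uprecstar a).
Qed.

Lemma nrm_uembB t s : nrm (uemb t - uemb s) = ud t s.
Proof. exact: (@nrm_cembB R uprecstar t s). Qed.

Lemma ugen_eq t s :
  (forall (D : cstarType R) (phi : X -> D), K phi -> ev phi t = ev phi s) ->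
  ev ugen t = ev ugen s.
Proof.
move=> H; rewrite !ev_ugen; apply/eqP; rewrite -subr_eq0; apply/eqP/nrm_eq0.
by rewrite nrm_uembB ud_eq0.
Qed.

Lemma uemb_dense (xi : univ) (eps : R) : 0 < eps ->
  exists t, nrm (xi - ev ugen t) < eps.
Proof.
move=> /(@cemb_dense R uprecstar xi) [t Ht]; exists t.
by rewrite ev_ugen.
Qed.

Section Lift.
Variables (D : cstarType R) (phi : X -> D).
Hypothesis Kphi : K phi.

(** y is the limit of the evaluations along terms that tend to xi. The inequality over all t
    determines y, and the later properties of the lift follow from it by approximation. *)
Lemma lift_ex (xi : univ) :
  exists y : D, forall t, nrm (y - ev phi t) <= nrm (xi - uemb t).
Proof.
have inv0 n : 0 < (n.+1%:R^-1 : R) by rewrite invr_gt0 ltr0n.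
have [t tP] := choice (fun n => @cemb_dense R uprecstar xi _ (inv0 n)).
have evd a b : nrm (ev phi a - ev phi b) <= nrm (uemb a - uemb b).
  by rewrite nrm_uembB ud_ge.
have tlim : nlim (fun n => uemb (t n)) xi.
  move=> eps e0; exists (Num.bound eps^-1) => n Nn.
  rewrite nrmB (lt_trans (tP n)) //.
  rewrite invf_plt ?posrE ?ltr0n //.
  have := archi_boundP (_ : 0 <= eps^-1); rewrite invr_ge0 (ltW e0) => /(_ isT).
  by move=> /lt_le_trans -> //; rewrite ler_nat (leq_trans Nn).
have [eps e0|y yP] := @nrm_complete R D (fun n => ev phi (t n)).
  have e2 : 0 < eps / 2 by rewrite divr_gt0.
  have [N HN] := tlim _ e2; exists N => m n Nm Nn.
  rewrite (le_lt_trans (evd _ _)) // (le_lt_trans (nrm_dist xi _ _)) //.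
  by have := HN _ Nm; have := HN _ Nn; rewrite (nrmB _ xi); lra.
exists y => s; rewrite leNgt; apply/negP => H.
pose e := (nrm (y - ev phi s) - nrm (xi - uemb s)) / 2.
have e0 : 0 < e by rewrite divr_gt0 // subr_gt0.
have [N1 H1] := yP _ e0; have [N2 H2] := tlim _ e0.
have := H1 _ (leq_maxl N1 N2); have := H2 _ (leq_maxr N1 N2).
set n := maxn N1 N2 => A2 A1.
have := nrm_dist (ev phi (t n)) y (ev phi s); rewrite (nrmB y (ev phi (t n))).
have := evd (t n) s; have := nrm_dist xi (uemb (t n)) (uemb s).
by move: A1 A2; rewrite /e; lra.
Qed.

Definition ulift (xi : univ) : D := projT1 (cid (lift_ex xi)).

Lemma uliftP xi t : nrm (ulift xi - ev phi t) <= nrm (xi - uemb t).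
Proof. exact: (projT2 (cid (lift_ex xi))). Qed.

Lemma ulift_uemb t : ulift (uemb t) = ev phi t.
Proof.
apply/eqP; rewrite -subr_eq0; apply/eqP/nrm_eq0/eqP.
by rewrite eq_le nrm_ge0 andbT (le_trans (uliftP _ _)) // subrr nrm0.
Qed.

Lemma small_eq (E : cstarType R) (x y : E) (C : R) :
  (forall eps, 0 < eps -> nrm (x - y) <= C * eps) -> x = y.
Proof.
move=> H; apply/eqP; rewrite -subr_eq0; apply/eqP/nrm_eq0/eqP.
rewrite eq_le nrm_ge0 andbT leNgt; apply/negP => d0.
have C1 : 0 < `|C| + 1 by rewrite ltr_wpDl.
have e0 : 0 < nrm (x - y) / (`|C| + 1) / 2 by rewrite !divr_gt0.
have := H _ e0; set d := nrm _ in d0 *.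
have : C * (d / (`|C| + 1) / 2) <= (`|C| + 1) * (d / (`|C| + 1) / 2).
  have pe : 0 <= d / (`|C| + 1) / 2 by rewrite !divr_ge0 // ?ltW.
  rewrite ler_wpM2r // (le_trans (ler_norm C)) // lerDl //.
have -> : (`|C| + 1) * (d / (`|C| + 1) / 2) = d / 2.
  by rewrite mulrA mulrCA divff ?mulr1 // gt_eqF.
lra.
Qed.

Lemma ulift_star_hom : star_hom ulift.
Proof.
have ap xi eps (e0 : 0 < eps) : exists t,
    nrm (xi - uemb t) < eps /\ nrm (ulift xi - ev phi t) < eps.
  have [t Ht] := @cemb_dense R uprecstar xi _ e0; exists t.
  by split=> //; rewrite (le_lt_trans (uliftP _ _)).
split; last first.
- move=> x; apply: (@small_eq _ _ _ 2) => eps e0.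
  have [t [t1 t2]] := ap x _ e0.
  rewrite (le_trans (nrm_dist (ev phi (TSt t)) _ _)) //.
  rewrite (_ : 2 * eps = eps + eps); last by rewrite mulr_natl mulr2n.
  rewrite lerD //.
    rewrite (le_trans (uliftP _ _)) //.
    rewrite (_ : uemb (TSt t) = star (uemb t)); last exact: (@cembS R uprecstar t).
    by rewrite -starB nrm_star ltW.
  by rewrite /= -starB nrm_star nrmB ltW.
- split; first by rewrite -[1 in LHS]/(uemb T1) ulift_uemb.
  move=> x y.
  apply: (@small_eq _ _ _ ((nrm x + nrm y + 1) + (nrm (ulift x) + nrm (ulift y) + 1))) => eps e0.
  (* The cap at 1 bounds the norm of the approximating second factor by 1 more than that of the
     given one, so the error stays linear in eps. *)
  pose e := Num.min eps 1.
  have e1 : 0 < e by rewrite lt_min e0 ltr01.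
  have ele : e <= eps by rewrite ge_min lexx.
  have e11 : e <= 1 by rewrite ge_min lexx orbT.
  have [t [t1 t2]] := ap x _ e1; have [s [s1 s2]] := ap y _ e1.
  have prod (E : cstarType R) (a b c d : E) : nrm (a - c) < e -> nrm (b - d) < e ->
      nrm (a * b - c * d) <= (nrm a + nrm b + 1) * eps.
    move=> ac bd.
    have -> : a * b - c * d = a * (b - d) + (a - c) * (b - (b - d)).
      by rewrite subKr mulrBr mulrBl addrA subrK.
    have := nrmD (a * (b - d)) ((a - c) * (b - (b - d))).
    have := nrmM a (b - d); have := nrmM (a - c) (b - (b - d)).
    have := nrmD b (- (b - d)); rewrite nrmN.
    have := nrm_ge0 a; have := nrm_ge0 b; have := nrm_ge0 (a - c).
    have := nrm_ge0 (b - d); have := nrm_ge0 (b - (b - d)).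
    move=> B1 B2 B3 B4 B5 B6 B7 B8 B9.
    have C1 : nrm a * nrm (b - d) <= nrm a * eps by rewrite ler_wpM2l //; lra.
    have C2 : nrm (a - c) * nrm (b - (b - d)) <= eps * (nrm b + 1).
      by rewrite ler_pM //; lra.
    lra.
  rewrite (le_trans (nrm_dist (ev phi (TMul t s)) _ _)) // mulrDl lerD //.
    rewrite (le_trans (uliftP _ _)) //.
    rewrite (_ : uemb (TMul t s) = uemb t * uemb s); last exact: (@cembM R uprecstar t s).
    exact: prod.
  rewrite nrmB /=; exact: prod.
- move=> c x y.
  apply: (@small_eq _ _ _ ((cn c + 1) + (cn c + 1))) => eps e0.
  have [t [t1 t2]] := ap x _ e0; have [s [s1 s2]] := ap y _ e0.
  have lin (E : cstarType R) (a b a' b' : E) : nrm (a - a') < eps ->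
      nrm (b - b') < eps -> nrm (c *: a + b - (c *: a' + b')) <= (cn c + 1) * eps.
    move=> A1 B1; rewrite opprD addrACA -scalerBr (le_trans (nrmD _ _)) //.
    rewrite nrmZ mulrDl mul1r lerD // ?(ltW B1) //.
    by rewrite ler_wpM2l ?cn_ge0 // ltW.
  rewrite (le_trans (nrm_dist (ev phi (TAdd (TSc c t) s)) _ _)) // mulrDl lerD //.
    rewrite (le_trans (uliftP _ _)) //.
    rewrite (_ : uemb (TAdd (TSc c t) s) = c *: uemb t + uemb s); first exact: lin.
    rewrite (_ : c *: uemb t = uemb (TSc c t)); last exact: esym (@cembZ R uprecstar c t).
    exact: (@cembD R uprecstar (TSc c t) s).
  rewrite nrmB /=; exact: lin.
Qed.

Lemma ulift_gen x : ulift (ugen x) = phi x.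
Proof. exact: (ulift_uemb (TVar x)). Qed.

End Lift.

Lemma univ_hom_unique (D : cstarType R) (f g : univ -> D) :
  star_hom f -> star_hom g -> (forall x, f (ugen x) = g (ugen x)) -> f = g.
Proof.
move=> fP gP fg; apply/funext => xi; apply: (@small_eq _ _ _ 2) => eps e0.
have [t Ht] := uemb_dense xi e0.
have E : f (ev ugen t) = g (ev ugen t).
  by rewrite !star_hom_ev //; congr (ev _ t); apply/funext.
rewrite (le_trans (nrm_dist (f (ev ugen t)) _ _)) // {2}E -!star_homB //.
have := star_hom_le fP (xi - ev ugen t); have := star_hom_le gP (ev ugen t - xi).
by rewrite (nrmB _ xi); lra.
Qed.

End Universal.

(** * Adjointable bounded operators on a pre-Hilbert space *)

Section BoundedOperators.
Variables (R : realType) (H : lmodType R[i]) (ip : H -> H -> R[i]).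
Hypothesis ip_lin : forall c x y z, ip (c *: x + y) z = c * ip x z + ip y z.
Hypothesis ip_conj : forall x y, ip y x = ((ip x y)^*)%R.
Hypothesis ip_ge0 : forall x, 0 <= ip x x.

Definition hq x : R := complex.Re (ip x x).
Definition hn x : R := Num.sqrt (hq x).

Lemma hqE x : ip x x = (hq x)%:C.
Proof.
have := ip_ge0 x; rewrite /hq; case: (ip x x) => a b.
by rewrite lecE /= => /andP[/eqP -> _].
Qed.

Lemma hq_ge0 x : 0 <= hq x.
Proof. by have := ip_ge0 x; rewrite hqE lecR. Qed.

Lemma hn_ge0 x : 0 <= hn x. Proof. exact: sqrtr_ge0. Qed.

Lemma hn_sqr x : hn x ^+ 2 = hq x.
Proof. by rewrite sqr_sqrtr // hq_ge0. Qed.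

Lemma ip0l x : ip 0 x = 0.
Proof.
have := ip_lin (-1) 0 0 x; rewrite scaler0 addr0 => E.
by rewrite E mulN1r addNr.
Qed.

Lemma ipD x y z : ip (x + y) z = ip x z + ip y z.
Proof. by have := ip_lin 1 x y z; rewrite scale1r mul1r. Qed.

Lemma ipZ c x z : ip (c *: x) z = c * ip x z.
Proof. by have := ip_lin c x 0 z; rewrite addr0 ip0l addr0. Qed.

Lemma ipDr x y z : ip z (x + y) = ip z x + ip z y.
Proof. by rewrite ip_conj ipD rmorphD /= -!ip_conj. Qed.

Lemma ipZr c x z : ip z (c *: x) = (c^*)%R * ip z x.
Proof. by rewrite ip_conj ipZ rmorphM /= -ip_conj. Qed.

Lemma hqZ c x : hq (c *: x) = cn c ^+ 2 * hq x.
Proof.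
by apply: complexI; rewrite -hqE ipZ ipZr mulrA (mulrC c) conjM_cn hqE [RHS]rmorphM.
Qed.

Lemma hnZ c x : hn (c *: x) = cn c * hn x.
Proof. by rewrite /hn hqZ sqrtrM ?exprn_ge0 ?cn_ge0 // sqrtr_sqr ger0_norm ?cn_ge0. Qed.

Lemma cauchy_schwarz x y : cn (ip x y) <= hn x * hn y.
Proof.
set b := ip x y.
(* This is the squared norm of x - t b y. The value t = 1 / |y|^2 gives the claim; if |y| = 0, a
   large t forces b = 0. *)
have key (t : R) : 0 <= hq x - 2 * t * cn b ^+ 2 + t ^+ 2 * cn b ^+ 2 * hq y.
  have := ip_ge0 (x - (t%:C * b) *: y).
  rewrite -scaleNr ipD !ipDr !ipZ !ipZr (ip_conj x y) -/b !hqE.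
  rewrite !rmorphN !rmorphM /= conjR.
  have bb := conjM_cn b.
  have -> : (hq x)%:C + - (t%:C * (b^*)%R) * b +
    (- (t%:C * b) * (b^*)%R + - (t%:C * b) * (- (t%:C * (b^*)%R) * (hq y)%:C)) =
    (hq x)%:C - 2 * t%:C * ((b^*)%R * b) + t%:C ^+ 2 * ((b^*)%R * b) * (hq y)%:C.
    by ring.
  rewrite bb -[2]/(2%:R) -(rmorph_nat (real_complex R)) -!rmorphXn /= -!rmorphM /=.
  by rewrite -rmorphN -!rmorphD /= lecR.
have b0 := cn_ge0 b; have x0 := hq_ge0 x; have y0 := hq_ge0 y.
have H2 : cn b ^+ 2 <= hq x * hq y.
  have [yz|yp] := eqVneq (hq y) 0.
    rewrite yz mulr0 leNgt; apply/negP => bp.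
    have := key ((hq x + 1) / cn b ^+ 2); rewrite yz mulr0 addr0 mulrA.
    rewrite [_ * cn b ^+ 2]mulrAC -mulrA divff ?gt_eqF //; lra.
  have yp0 : 0 < hq y by rewrite lt_neqAle eq_sym yp.
  have := key (hq y)^-1.
  have -> : hq x - 2 * (hq y)^-1 * cn b ^+ 2 + (hq y)^-1 ^+ 2 * cn b ^+ 2 * hq y =
    hq x - cn b ^+ 2 / hq y by field.
  by rewrite subr_ge0 ler_pdivrMr.
rewrite -(@ler_pXn2r _ 2) ?nnegrE ?mulr_ge0 ?hn_ge0 //.
by rewrite exprMn !hn_sqr.
Qed.

Lemma hnD x y : hn (x + y) <= hn x + hn y.
Proof.
rewrite -(@ler_pXn2r _ 2) ?nnegrE ?addr_ge0 ?hn_ge0 // hn_sqr.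
have E : ip x y + ip y x = (complex.Re (ip x y + ip y x))%:C.
  rewrite (ip_conj x y); case: (ip x y) => a b; rewrite conjcE.
  by apply/eqP; rewrite eq_complex /= addrN !eqxx.
have -> : hq (x + y) = hq x + hq y + complex.Re (ip x y + ip y x).
  apply: complexI; rewrite -hqE ipD !ipDr !hqE.
  by rewrite addrA -(addrA (hq x)%:C) E /= -!rmorphD /=; congr _%:C; ring.
have H1 : complex.Re (ip x y + ip y x) <= 2 * (hn x * hn y).
  have cs1 := cauchy_schwarz x y; have cs2 := cauchy_schwarz y x.
  have Re_le (c : R[i]) : complex.Re c <= cn c.
    case: c => a b; rewrite /cn normc_def /= (le_trans (ler_norm a)) //.
    by rewrite -sqrtr_sqr ler_wsqrtr // lerDl sqr_ge0.
  rewrite (le_trans (Re_le _)) // (le_trans (cnD _ _)) //.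
  by move: cs1 cs2; rewrite (mulrC (hn y)); lra.
have := hn_sqr x; have := hn_sqr y; have := hn_ge0 x; have := hn_ge0 y; nra.
Qed.

Lemma hnN x : hn (- x) = hn x.
Proof. by rewrite -scaleN1r hnZ cnN cn1 mul1r. Qed.

Lemma hn0 : hn 0 = 0.
Proof. by rewrite -(scale0r (0 : H)) hnZ cn0 mul0r. Qed.

Lemma hnB x y : hn (x - y) = hn (y - x).
Proof. by rewrite -hnN opprB. Qed.

(** The space need not be complete, so a bounded operator may lack an adjoint; the adjoint is
    therefore part of the data. *)
Record bop := BOp {
  bf : H -> H;
  ba : H -> H;
  bf_lin : linear bf;
  ba_lin : linear ba;
  b_adj : forall x y, ip (bf x) y = ip x (ba y);
  b_bound : exists C : R, forall x, hn (bf x) <= C * hn x }.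

Implicit Types f g h : bop.

Lemma b_adj' f x y : ip (ba f x) y = ip x (bf f y).
Proof. by rewrite ip_conj -b_adj -ip_conj. Qed.

Definition bset f g : set R := [set r | exists2 x, hn x <= 1 & r = hn (bf f x - bf g x)].
Definition bd f g : R := sup (bset f g).

Lemma bd_has_sup f g : has_sup (bset f g).
Proof.
split; first by exists (hn (bf f 0 - bf g 0)), 0; rewrite ?hn0.
have [C HC] := b_bound f; have [K HK] := b_bound g.
exists (`|C| + `|K|) => r [x x1 ->].
rewrite (le_trans (hnD _ _)) // hnN lerD //.
  rewrite (le_trans (HC _)) // (le_trans (ler_wpM2r (hn_ge0 _) (ler_norm _))) //.
  by rewrite ler_piMr.
rewrite (le_trans (HK _)) // (le_trans (ler_wpM2r (hn_ge0 _) (ler_norm _))) //.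
by rewrite ler_piMr.
Qed.

Lemma bf0 f : bf f 0 = 0.
Proof.
have := bf_lin f (-1) 0 0; rewrite scaler0 addr0 => E.
by rewrite E scaleN1r addNr.
Qed.

Lemma bfZ f c x : bf f (c *: x) = c *: bf f x.
Proof. by have := bf_lin f c x 0; rewrite bf0 !addr0. Qed.

Lemma bfD f x y : bf f (x + y) = bf f x + bf f y.
Proof. by have := bf_lin f 1 x y; rewrite !scale1r. Qed.

Lemma bd_ge f g x : hn (bf f x - bf g x) <= bd f g * hn x.
Proof.
have ub y : hn y <= 1 -> hn (bf f y - bf g y) <= bd f g.
  by move=> y1; apply: (sup_upper_bound (bd_has_sup f g)); exists y.
(* [hn] is only a seminorm. All multiples of a null vector lie in the unit ball, so the two images
   of it can only differ by a null vector. *)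
have [x0|x0] := eqVneq (hn x) 0.
  have z c : cn c * hn (bf f x - bf g x) <= bd f g.
    rewrite -hnZ scalerBr -!bfZ; apply: ub.
    by rewrite hnZ x0 mulr0.
  rewrite x0 mulr0 leNgt; apply/negP => d0.
  have := z (((`|bd f g| + 1) / hn (bf f x - bf g x))%:C).
  rewrite cnC ger0_norm ?divr_ge0 ?hn_ge0 ?addr_ge0 // divfK ?gt_eqF //.
  by have := ler_norm (bd f g); lra.
have xp : 0 < hn x by rewrite lt_neqAle eq_sym x0 hn_ge0.
rewrite -ler_pdivrMr // mulrC.
have := ub ((hn x)^-1%:C *: x); rewrite !bfZ -scalerBr !hnZ cnC.
by rewrite ger0_norm ?invr_ge0 ?hn_ge0 // mulVf // lexx; apply.
Qed.

Lemma bd_ge0 f g : 0 <= bd f g.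
Proof.
apply: (sup_upper_bound (bd_has_sup f g)).
by exists 0; rewrite ?hn0 ?bf0 ?subrr ?hn0.
Qed.

Lemma bd_le f g c : 0 <= c ->
  (forall x, hn (bf f x - bf g x) <= c * hn x) -> bd f g <= c.
Proof.
move=> c0 Hc; apply: ge_sup; first by case: (bd_has_sup f g).
by move=> r [x x1 ->]; rewrite (le_trans (Hc x)) // ler_piMr.
Qed.

Lemma bd_eq0 f g : bf f =1 bf g -> bd f g = 0.
Proof.
move=> E; apply/eqP; rewrite eq_le bd_ge0 andbT.
by apply: bd_le => // x; rewrite E subrr hn0 mul0r.
Qed.

Lemma idlin : linear (@id H). Proof. by []. Qed.

Definition bid : bop.
Proof.
by apply: (@BOp id id idlin idlin) => //; exists 1 => x; rewrite mul1r.
Defined.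

Lemma zlin : linear (fun _ : H => 0 : H).
Proof. by move=> c x y; rewrite scaler0 addr0. Qed.

Lemma zadj x y : ip 0 y = ip x 0.
Proof. by rewrite ip0l ip_conj ip0l rmorph0. Qed.

Lemma zbound : exists C : R, forall x : H, hn 0 <= C * hn x.
Proof. by exists 0 => x; rewrite hn0 mul0r. Qed.

Definition bzero : bop := BOp zlin zlin zadj zbound.

Definition badd f g : bop.
Proof.
apply: (@BOp (fun x => bf f x + bf g x) (fun x => ba f x + ba g x)).
- by move=> c x y; rewrite !bf_lin scalerDr addrACA.
- by move=> c x y; rewrite !ba_lin scalerDr addrACA.
- by move=> x y; rewrite ipD ipDr !b_adj.
have [C HC] := b_bound f; have [K HK] := b_bound g.
by exists (C + K) => x; rewrite (le_trans (hnD _ _)) // mulrDl lerD.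
Defined.

Definition bscale (c : R[i]) f : bop.
Proof.
apply: (@BOp (fun x => c *: bf f x) (fun x => (c^*)%R *: ba f x)).
- by move=> d x y; rewrite bf_lin scalerDr !scalerA mulrC.
- by move=> d x y; rewrite ba_lin scalerDr !scalerA mulrC.
- by move=> x y; rewrite ipZ ipZr conjCK b_adj.
have [C HC] := b_bound f; exists (cn c * C) => x.
by rewrite hnZ -mulrA ler_wpM2l ?cn_ge0.
Defined.

Definition bmul f g : bop.
Proof.
apply: (@BOp (bf f \o bf g) (ba g \o ba f)).
- by move=> d x y /=; rewrite !bf_lin.
- by move=> d x y /=; rewrite !ba_lin.
- by move=> x y /=; rewrite !b_adj.
have [C HC] := b_bound f; have [K HK] := b_bound g; exists (`|C| * K) => x /=.
rewrite (le_trans (HC _)) // (le_trans (ler_wpM2r (hn_ge0 _) (ler_norm _))) //.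
by rewrite -mulrA ler_wpM2l.
Defined.

(** With z the difference of the adjoints at x, |z|^2 is the inner product of (f - g) z with x,
    hence at most C |z| |x|. *)
Lemma adj_le f g (C : R) : 0 <= C -> (forall x, hn (bf f x - bf g x) <= C * hn x) ->
  forall x, hn (ba f x - ba g x) <= C * hn x.
Proof.
move=> C0 HC x; set z := ba f x - ba g x.
have E : ip z z = ip (bf f z - bf g z) x.
  rewrite -scaleN1r ipD ipZ !b_adj -[in RHS](conjCK (-1)) -ipZr -ipDr.
  by rewrite rmorphN rmorph1 scaleN1r.
have Hz : hn z ^+ 2 <= C * hn z * hn x.
  rewrite hn_sqr.
  have -> : hq z = cn (ip (bf f z - bf g z) x).
    by rewrite -E hqE cnC ger0_norm // hq_ge0.
  rewrite (le_trans (cauchy_schwarz _ _)) // ler_wpM2r ?hn_ge0 //.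
have [z0|z0] := eqVneq (hn z) 0; first by rewrite z0 mulr_ge0 ?hn_ge0.
have zp : 0 < hn z by rewrite lt_neqAle eq_sym z0 hn_ge0.
by rewrite -(ler_pM2r zp) -expr2 (le_trans Hz) // mulrAC.
Qed.

Definition bstar f : bop.
Proof.
apply: (@BOp (ba f) (bf f)).
- exact: ba_lin.
- exact: bf_lin.
- exact: b_adj'.
have [C HC] := b_bound f; exists `|C| => x.
have := @adj_le f bzero `|C| (normr_ge0 _); rewrite /= => /(_ _ x).
rewrite subr0; apply=> y; rewrite subr0 (le_trans (HC _)) //.
by rewrite ler_wpM2r ?hn_ge0 ?ler_norm.
Defined.

Lemma bd_sym f g : bd f g = bd g f.
Proof.
by apply/eqP; rewrite eq_le; apply/andP; split; apply: bd_le (bd_ge0 _ _) _ => x;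
  rewrite hnB bd_ge.
Qed.

Lemma bd0_ge f x : hn (bf f x) <= bd f bzero * hn x.
Proof. by have := bd_ge f bzero x; rewrite subr0. Qed.

Definition bprecstar : precstar R.
Proof.
apply: (@PreCStar R bop bd bzero bid badd bscale bmul bstar).
- by move=> x; apply: bd_eq0.
- exact: bd_sym.
- move=> g f h; apply: bd_le => [|x]; first by rewrite addr_ge0 ?bd_ge0.
  have -> : bf f x - bf h x = (bf f x - bf g x) + (bf g x - bf h x).
    by rewrite addrA subrK.
  by rewrite (le_trans (hnD _ _)) // mulrDl lerD ?bd_ge.
- move=> f f' g g'; apply: bd_le => [|x]; first by rewrite addr_ge0 ?bd_ge0.
  by rewrite /= opprD addrACA (le_trans (hnD _ _)) // mulrDl lerD ?bd_ge.
- move=> c f g; apply: bd_le => [|x]; first by rewrite mulr_ge0 ?cn_ge0 ?bd_ge0.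
  by rewrite /= -scalerBr hnZ -mulrA ler_wpM2l ?cn_ge0 ?bd_ge.
- move=> f g; apply: bd_le => [|x]; first exact: bd_ge0.
  by apply: adj_le; [exact: bd_ge0|exact: bd_ge].
- move=> f g g'; apply: bd_le => [|x]; first by rewrite mulr_ge0 ?bd_ge0.
  rewrite /= -[_ - _](_ : bf f (bf g x - bf g' x) = _).
    by rewrite (le_trans (bd0_ge _ _)) // -mulrA ler_wpM2l ?bd_ge0 ?bd_ge.
  by rewrite -scaleN1r bfD bfZ scaleN1r.
- move=> f f' g; apply: bd_le => [|x]; first by rewrite mulr_ge0 ?bd_ge0.
  rewrite /= (le_trans (bd_ge _ _ _)) // -mulrA ler_wpM2l ?bd_ge0 //.
  exact: bd0_ge.
- move=> f; set c := bd (bmul _ _) _.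
  have c0 : 0 <= c by exact: bd_ge0.
  rewrite -[leRHS]sqr_sqrtr // ler_pXn2r ?nnegrE ?bd_ge0 ?sqrtr_ge0 //.
  apply: bd_le; rewrite ?sqrtr_ge0 // => x.
  rewrite -(@ler_pXn2r _ 2) ?nnegrE ?mulr_ge0 ?hn_ge0 ?sqrtr_ge0 //.
  rewrite exprMn (sqr_sqrtr c0) /= subr0 hn_sqr.
  have -> : hq (bf f x) = cn (ip (bf (bmul (bstar f) f) x) x).
    by rewrite /= b_adj' hqE cnC ger0_norm // hq_ge0.
  rewrite (le_trans (cauchy_schwarz _ _)) // expr2 mulrA ler_wpM2r ?hn_ge0 //.
  exact: bd0_ge.
- by move=> x y z; apply: bd_eq0 => v /=; rewrite addrA.
- by move=> x y; apply: bd_eq0 => v /=; rewrite addrC.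
- by move=> x; apply: bd_eq0 => v /=; rewrite add0r.
- by move=> x; apply: bd_eq0 => v /=; rewrite scaleN1r addNr.
- by move=> a b x; apply: bd_eq0 => v /=; rewrite scalerA.
- by move=> x; apply: bd_eq0 => v /=; rewrite scale1r.
- by move=> c x y; apply: bd_eq0 => v /=; rewrite scalerDr.
- by move=> x a b; apply: bd_eq0 => v /=; rewrite scalerDl.
- by move=> x y z; apply: bd_eq0 => v.
- by move=> x; apply: bd_eq0 => v.
- by move=> x; apply: bd_eq0 => v.
- by move=> x y z; apply: bd_eq0 => v.
- by move=> x y z; apply: bd_eq0 => v /=; rewrite bfD.
- by move=> c x y; apply: bd_eq0 => v.
- by move=> c x y; apply: bd_eq0 => v /=; rewrite bfZ.
- by move=> x y; apply: bd_eq0 => v.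
- by move=> c x; apply: bd_eq0 => v.
- by move=> x y; apply: bd_eq0 => v.
- by move=> x; apply: bd_eq0 => v.
Defined.

Definition operators : cstarType R := cstar_completion bprecstar.
Definition oemb (f : bop) : operators := @cemb R bprecstar f.

Lemma nrm_oemb_ge f x : hn (bf f x) <= nrm (oemb f) * hn x.
Proof. by rewrite (@nrm_cemb R bprecstar f) bd0_ge. Qed.

Lemma nrm_oemb_le f c : 0 <= c -> (forall x, hn (bf f x) <= c * hn x) ->
  nrm (oemb f) <= c.
Proof.
move=> c0 Hc; rewrite (@nrm_cemb R bprecstar f); apply: bd_le => // x.
by rewrite subr0.
Qed.

Lemma oemb_eq f g : bf f =1 bf g -> oemb f = oemb g.
Proof.
move=> E; apply/eqP; rewrite -subr_eq0; apply/eqP/nrm_eq0.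
by rewrite (@nrm_cembB R bprecstar f g); apply: bd_eq0.
Qed.

Lemma oembD f g : oemb (badd f g) = oemb f + oemb g.
Proof. exact: (@cembD R bprecstar f g). Qed.

Lemma oembZ c f : oemb (bscale c f) = c *: oemb f.
Proof. exact: (@cembZ R bprecstar c f). Qed.

Lemma oembM f g : oemb (bmul f g) = oemb f * oemb g.
Proof. exact: (@cembM R bprecstar f g). Qed.

Lemma oembS f : oemb (bstar f) = star (oemb f).
Proof. exact: (@cembS R bprecstar f). Qed.

Lemma oemb1 : oemb bid = 1. Proof. by []. Qed.

Lemma oemb0 : oemb bzero = 0. Proof. by []. Qed.

End BoundedOperators.

(** * Finitely supported functions and weighted shifts *)

Section FiniteSupport.
Variables (R : realType) (I : choiceType) (Q : set I).
Implicit Types f g : I -> R[i].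

Definition supported f (A : {fset I}) := forall i, i \notin A -> f i = 0.

Definition tot f : R[i] := \sum_(i \in [set: I]) f i.

Lemma totE f A : supported f A -> tot f = \sum_(i <- A) f i.
Proof. exact: fsbigTE. Qed.

(** Vectors are functions on all of I that vanish outside Q, so that a partial bijection of Q can be
    given as a weighted shift of I. The algebra of operators is completed, not this space. *)
Record hsp := HSp {
  hv :> I -> R[i];
  hv_fin : exists A, supported hv A;
  hv_in : forall i, hv i <> 0 -> Q i }.

HB.instance Definition _ := gen_eqMixin hsp.
HB.instance Definition _ := gen_choiceMixin hsp.
Implicit Types x y z : hsp.

Lemma hsp_eq x y : (forall i, x i = y i) -> x = y.
Proof.
case: x y => [f ff fi] [g gf gi] /= /funext E; subst g.
by rewrite (Prop_irrelevance ff gf) (Prop_irrelevance fi gi).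
Qed.

Lemma hsp_fin2 x y : exists A, supported x A /\ supported y A.
Proof.
have [A HA] := hv_fin x; have [B HB] := hv_fin y; exists (A `|` B)%fset.
by split=> i; rewrite inE negb_or => /andP[? ?]; [apply: HA|apply: HB].
Qed.

Definition h0 : hsp.
Proof. by exists (fun=> 0) => //; exists fset0. Defined.

Definition hadd x y : hsp.
Proof.
exists (fun i => x i + y i).
  have [A [HA HB]] := hsp_fin2 x y; exists A => i iA.
  by rewrite HA // HB // addr0.
move=> i H; have [xi|/eqP xi] := eqVneq (x i) 0; last exact: (hv_in xi).
by apply: (@hv_in y) => yi; apply: H; rewrite xi yi addr0.
Defined.

Definition hscale (c : R[i]) x : hsp.
Proof.
exists (fun i => c * x i).
  by have [A HA] := hv_fin x; exists A => i iA; rewrite HA // mulr0.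
by move=> i H; apply: (@hv_in x) => xi; apply: H; rewrite xi mulr0.
Defined.

Definition hopp x := hscale (-1) x.

Lemma haddA : associative hadd.
Proof. by move=> x y z; apply: hsp_eq => i /=; rewrite addrA. Qed.
Lemma haddC : commutative hadd.
Proof. by move=> x y; apply: hsp_eq => i /=; rewrite addrC. Qed.
Lemma hadd0 : left_id h0 hadd.
Proof. by move=> x; apply: hsp_eq => i /=; rewrite add0r. Qed.
Lemma haddN : left_inverse h0 hopp hadd.
Proof. by move=> x; apply: hsp_eq => i /=; rewrite mulN1r addNr. Qed.

HB.instance Definition _ := GRing.isZmodule.Build hsp haddA haddC hadd0 haddN.

Lemma hscaleA a b x : hscale a (hscale b x) = hscale (a * b) x.
Proof. by apply: hsp_eq => i /=; rewrite mulrA. Qed.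
Lemma hscale1 : left_id 1 hscale.
Proof. by move=> x; apply: hsp_eq => i /=; rewrite mul1r. Qed.
Lemma hscaleDr : right_distributive hscale +%R.
Proof. by move=> c x y; apply: hsp_eq => i /=; rewrite mulrDr. Qed.
Lemma hscaleDl x : {morph hscale^~ x : a b / a + b}.
Proof. by move=> a b; apply: hsp_eq => i /=; rewrite mulrDl. Qed.

HB.instance Definition _ :=
  GRing.Zmodule_isLmodule.Build R[i] hsp hscaleA hscale1 hscaleDr hscaleDl.

Lemma hvD x y i : (x + y) i = x i + y i. Proof. by []. Qed.
Lemma hvZ c x i : (c *: x) i = c * x i. Proof. by []. Qed.
Lemma hv0 i : (0 : hsp) i = 0. Proof. by []. Qed.

Definition hip x y : R[i] := tot (fun i => x i * ((y i)^*)%R).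

Lemma hipE x y A : supported x A -> hip x y = \sum_(i <- A) x i * ((y i)^*)%R.
Proof. by move=> HA; apply: totE => i iA; rewrite HA // mul0r. Qed.

Lemma hip_lin c x y z : hip (c *: x + y) z = c * hip x z + hip y z.
Proof.
have [A [HA HB]] := hsp_fin2 x y.
rewrite !(@hipE _ _ A) //; last by move=> i iA; rewrite hvD hvZ HA // HB // mulr0 addr0.
rewrite mulr_sumr -big_split /=; apply: eq_bigr => i _.
by rewrite mulrDl mulrA.
Qed.

Lemma hip_conj x y : hip y x = ((hip x y)^*)%R.
Proof.
have [A [HA HB]] := hsp_fin2 x y.
rewrite (hipE y HA) (hipE x HB) rmorph_sum; apply: eq_bigr => i _ /=.
by rewrite rmorphM /= conjCK mulrC.
Qed.

Lemma hip_ge0 x : 0 <= hip x x.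
Proof.
have [A HA] := hv_fin x; rewrite (hipE x HA); apply: sumr_ge0 => i _.
by rewrite mul_conjC_ge0.
Qed.

Lemma hq_sum x A : supported x A -> hq hip x = \sum_(i <- A) cn (x i) ^+ 2.
Proof.
move=> HA; apply: complexI; rewrite -(hqE hip_ge0) (hipE x HA) rmorph_sum /=.
by apply: eq_bigr => i _; rewrite mulrC conjM_cn.
Qed.

Lemma hq_coord x i : cn (x i) ^+ 2 <= hq hip x.
Proof.
have [A HA] := hv_fin x; rewrite (hq_sum HA).
have [iA|iA] := boolP (i \in A); last first.
  by rewrite HA // cn0 expr0n /= sumr_ge0 // => j _; rewrite exprn_ge0 ?cn_ge0.
rewrite (big_rem i) //= lerDl sumr_ge0 // => j _.
by rewrite exprn_ge0 ?cn_ge0.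
Qed.

Definition hrestr (p : pred I) x : hsp.
Proof.
exists (fun i => if p i then x i else 0).
  by have [A HA] := hv_fin x; exists A => i /HA ->; case: ifP.
by move=> i; case: ifP => // _; exact: (@hv_in x).
Defined.

Definition hdelta i (Qi : Q i) : hsp.
Proof.
exists (fun j => (j == i)%:R).
  by exists [fset i]%fset => j; rewrite inE => /negbTE ->.
by move=> j; case: eqP => [->|].
Defined.

Lemma hq_delta i (Qi : Q i) : hq hip (hdelta Qi) = 1.
Proof.
rewrite (@hq_sum _ [fset i]%fset); last by move=> j; rewrite inE /= => /negbTE ->.
by rewrite big_seq_fset1 /= eqxx cn1 expr1n.
Qed.

Section Shift.
Variables (phi psi : I -> I) (f : I -> R[i]) (C : R).
Hypothesis phiK : cancel phi psi.
Hypothesis psiK : cancel psi phi.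
Hypothesis C0 : 0 <= C.
Hypothesis fC : forall i, cn (f i) <= C.
Hypothesis fQ : forall i, f i <> 0 -> (Q i <-> Q (psi i)).

Lemma shift_fin x : exists A, supported (fun i => f i * x (psi i)) A.
Proof.
have [A HA] := hv_fin x; exists (phi @` A)%fset => i iA.
rewrite HA ?mulr0 //; apply: contra iA => pA.
by apply/imfsetP; exists (psi i).
Qed.

(** [fQ] demands that psi respect Q only where the weight f is nonzero: this is how a partial action
    enters. *)
Definition wshift x : hsp.
Proof.
exists (fun i => f i * x (psi i)); first exact: shift_fin.
move=> i H; have [fi|/eqP fi] := eqVneq (f i) 0; first by rewrite fi mul0r in H.
by apply/(fQ fi); apply: (@hv_in x) => xi; apply: H; rewrite xi mulr0.
Defined.

Definition wshift_adj x : hsp.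
Proof.
exists (fun i => ((f (phi i))^*)%R * x (phi i)).
  have [A HA] := hv_fin x; exists (psi @` A)%fset => i iA.
  rewrite HA ?mulr0 //; apply: contra iA => pA.
  by apply/imfsetP; exists (phi i).
move=> i H; have [fi|/eqP fi] := eqVneq (f (phi i)) 0.
  by rewrite fi rmorph0 mul0r in H.
rewrite -(phiK i); apply/(fQ fi); apply: (@hv_in x) => xi.
by apply: H; rewrite xi mulr0.
Defined.

Lemma wshift_lin : linear wshift.
Proof. by move=> c x y; apply: hsp_eq => i /=; rewrite mulrDr mulrCA. Qed.

Lemma wshift_adj_lin : linear wshift_adj.
Proof. by move=> c x y; apply: hsp_eq => j /=; rewrite mulrDr mulrCA. Qed.

Lemma wshift_adjP x y : hip (wshift x) y = hip x (wshift_adj y).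
Proof.
rewrite /hip /tot (@reindex_fsbigT _ _ _ _ _ phi) /=; last by exists psi.
by apply: eq_fsbigr => i _; rewrite phiK rmorphM /= conjCK mulrAC mulrC mulrA.
Qed.

Lemma wshift_bound x : hn hip (wshift x) <= C * hn hip x.
Proof.
have [A HA] := hv_fin x.
have H : hq hip (wshift x) <= C ^+ 2 * hq hip x.
  have SB : supported (wshift x) (phi @` A)%fset.
    move=> i iA /=; rewrite HA ?mulr0 //; apply: contra iA => pA.
    by apply/imfsetP; exists (psi i).
  rewrite (hq_sum SB) (hq_sum HA) big_imfset /=; last by move=> i j _ _ /(can_inj phiK).
  rewrite mulr_sumr; apply: ler_sum => i _.
  rewrite phiK cnM exprMn ler_wpM2r ?exprn_ge0 ?cn_ge0 //.
  by rewrite lerXn2r ?nnegrE ?cn_ge0.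
rewrite -(@ler_pXn2r _ 2) ?nnegrE ?mulr_ge0 ?hn_ge0 // exprMn.
by rewrite !(hn_sqr (@hip_ge0)).
Qed.

Definition bshift : bop hip :=
  BOp wshift_lin wshift_adj_lin wshift_adjP (ex_intro _ C wshift_bound).

End Shift.

Definition bsum (T : Type) (r : seq T) (F : T -> bop hip) : bop hip :=
  foldr (fun t b => badd hip_lin hip_conj hip_ge0 (F t) b)
    (bzero hip_lin hip_conj hip_ge0) r.

Lemma bsumE (T : Type) (r : seq T) (F : T -> bop hip) x i :
  bf (bsum r F) x i = \sum_(t <- r) bf (F t) x i.
Proof. by elim: r => [|t r IH] /=; rewrite ?big_nil // big_cons -IH. Qed.

End FiniteSupport.

(** * Words in the generators *)

Section Calculus.
Variables (R : realType) (S : countType) (e : rel S).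
Hypothesis e_sym : symmetric e.
Hypothesis e_irr : irreflexive e.
Variables (A : cstarType R) (V : S -> A).
Hypothesis HV : boundary_relations e V.
Local Notation G := (raag e).
Local Notation pg := (@pg S e).
Local Notation X0 := (@X0 S e).
Implicit Types (u v : seq S).
Local Notation fterm := (R[i] * (seq S * seq S))%type.

Definition vw u : A := \prod_(s <- u) V s.

Lemma vw_nil : vw [::] = 1. Proof. by rewrite /vw big_nil. Qed.

Lemma vw_cons s u : vw (s :: u) = V s * vw u.
Proof. by rewrite /vw big_cons. Qed.

Lemma vw_cat u v : vw (u ++ v) = vw u * vw v.
Proof. by rewrite /vw big_cat. Qed.

Lemma vw1 s : vw [:: s] = V s.
Proof. by rewrite vw_cons vw_nil mulr1. Qed.

Lemma V_iso s : star (V s) * V s = 1. Proof. by case: HV => H _ _ _; exact: H. Qed.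

Lemma V_comm s t : e s t -> V s * V t = V t * V s.
Proof. by case: HV => _ H _ _ /H []. Qed.

Lemma V_scomm s t : e s t -> star (V s) * V t = V t * star (V s).
Proof. by case: HV => _ H _ _ /H []. Qed.

Lemma vw_scong u v : scong (dep e) u v -> vw u = vw v.
Proof.
elim=> {u v} [//|u v w _ -> //|u s t v]; rewrite /dep negbK => st.
by rewrite !vw_cat !vw_cons !mulrA -(mulrA _ (V s)) V_comm // mulrA.
Qed.

Lemma vw_pg u v : pg u = pg v -> vw u = vw v.
Proof. by move/(pgP e_sym e_irr); exact: vw_scong. Qed.

Lemma vw_iso u : star (vw u) * vw u = 1.
Proof.
elim: u => [|s u IH]; first by rewrite vw_nil star1 mulr1.
by rewrite vw_cons starMr mulrA -(mulrA (star (vw u))) V_iso mulr1.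
Qed.

Lemma nrm_vw u : nrm (vw u) <= 1.
Proof.
have := nrm_star2 (vw u); rewrite vw_iso => H; have := nrm1_le A; rewrite H.
by rewrite expr_le1 // nrm_ge0.
Qed.

(** The adjoint travels through v: it passes letters that commute with s by (2), is absorbed by the
    first s by (1), and gives 0 at any other letter by (3). *)
Lemma starV_vw s v : star (V s) * vw v =
  if ldiv (dep e) s v then vw (rem s v)
  else if all (e s) v then vw v * star (V s) else 0.
Proof.
case: ifP => [/(ldiv_scong (dep_sym e_sym)) /vw_scong ->|].
  by rewrite vw_cons mulrA V_iso mul1r.
elim: v => [|t v IH] /=; first by rewrite vw_nil mulr1 mul1r.
case: (eqVneq s t) => //= st; rewrite {1}/dep negbK vw_cons mulrA.
case est : (e s t) => /=.
  by move/IH => H; rewrite V_scomm // -mulrA H; case: ifP; rewrite ?mulrA ?mulr0.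
by case: HV => _ _ H _; rewrite H ?est // mul0r.
Qed.

(** Nica covariance. [res] follows the same recursion as the letters of u on their way through v. *)
Lemma nica u v : star (vw u) * vw v =
  if res e u v is Some (a, b) then vw a * star (vw b) else 0.
Proof.
elim: u v => [|s u IH] v /=; first by rewrite vw_nil star1 mul1r mulr1.
rewrite vw_cons starMr -mulrA starV_vw; case: ifP => // _.
case: ifP => _; last by rewrite mulr0.
rewrite mulrA IH; case: (res e u v) => [[a b]|]; last by rewrite mul0r.
by rewrite vw_cons starMr mulrA.
Qed.

Definition pj u : A := vw u * star (vw u).

Lemma pj_star u : star (pj u) = pj u.
Proof. by rewrite /pj starMr starK. Qed.

Lemma pj_mul u v : pj u * pj v = if res e u v is Some (a, _) then pj (u ++ a) else 0.
Proof.
rewrite /pj !mulrA -(mulrA _ (star (vw u))) nica.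
case E : (res e u v) => [[a b]|]; last by rewrite mulr0 mul0r.
have /vw_scong E2 := res_scong e_sym E.
by rewrite mulrA -vw_cat -mulrA -starMr -vw_cat -E2.
Qed.

Lemma pj_idem u : pj u * pj u = pj u.
Proof. by rewrite /pj mulrA -(mulrA (vw u)) vw_iso mulr1. Qed.

(** The product is selfadjoint, being again a [pj] or 0. *)
Lemma pj_comm u v : pj u * pj v = pj v * pj u.
Proof.
have H : star (pj u * pj v) = pj u * pj v.
  rewrite pj_mul; case: (res e u v) => [[a b]|]; last by rewrite star0.
  exact: pj_star.
by rewrite -[LHS]H starMr !pj_star.
Qed.

Lemma pj_vw u v : star (vw u) * pj v * vw u =
  if res e u v is Some (a, _) then pj a else 0.
Proof.
have -> : star (vw u) * pj v * vw u = (star (vw u) * vw v) * star (star (vw u) * vw v).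
  by rewrite starMr starK /pj !mulrA.
rewrite nica; case: (res e u v) => [[a b]|]; last by rewrite mul0r.
by rewrite starMr starK mulrA -(mulrA (vw a)) vw_iso mulr1.
Qed.

(* [pattern c] corresponds to the characteristic function of the set of all w
   such that, for every (u, b) in c, w contains u iff b. *)
Definition pattern_proj (x : seq S * bool) : A := if x.2 then pj x.1 else 1 - pj x.1.
Definition pattern (c : seq (seq S * bool)) : A := \prod_(x <- c) pattern_proj x.

Lemma pattern_proj_comm x u : pattern_proj x * pj u = pj u * pattern_proj x.
Proof.
rewrite /pattern_proj; case: ifP => _; first exact: pj_comm.
by rewrite mulrBl mulrBr mul1r mulr1 pj_comm.
Qed.

Lemma pattern_proj_comm2 x y :
  pattern_proj x * pattern_proj y = pattern_proj y * pattern_proj x.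
Proof.
rewrite {2 3}/pattern_proj; case: ifP => _; first exact: pattern_proj_comm.
by rewrite mulrBl mulrBr mul1r mulr1 pattern_proj_comm.
Qed.

Lemma pattern_nil : pattern [::] = 1. Proof. exact: big_nil. Qed.

Lemma pattern_cons x c : pattern (x :: c) = pattern_proj x * pattern c.
Proof. exact: big_cons. Qed.

Lemma pattern_comm c u : pattern c * pj u = pj u * pattern c.
Proof.
elim: c => [|x c IH]; first by rewrite pattern_nil mul1r mulr1.
by rewrite pattern_cons -mulrA IH mulrA pattern_proj_comm mulrA.
Qed.

Lemma pattern_commp c x : pattern c * pattern_proj x = pattern_proj x * pattern c.
Proof.
rewrite /pattern_proj; case: ifP => _; first exact: pattern_comm.
by rewrite mulrBl mulrBr mul1r mulr1 pattern_comm.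
Qed.

Lemma pattern_perm c d : perm_eq c d -> pattern c = pattern d.
Proof.
elim: c d => [|x c IH] d H; first by move/perm_size/esym/size0nil : H => ->.
have xd : x \in d by rewrite -(perm_mem H) mem_head.
case/splitPr: xd H => d1 d2.
rewrite perm_sym (perm_catCA d1 [:: x] d2) perm_sym perm_cons => /IH E.
rewrite pattern_cons E.
by rewrite /pattern !big_cat big_cons /= !mulrA -/(pattern d1) pattern_commp.
Qed.

Lemma pattern_proj_idem x : pattern_proj x * pattern_proj x = pattern_proj x.
Proof.
rewrite /pattern_proj; case: ifP => _; first exact: pj_idem.
by rewrite mulrBl mul1r mulrBr mulr1 pj_idem subrr subr0.
Qed.

Lemma pattern_mem c x : x \in c -> pattern_proj x * pattern c = pattern c.
Proof.
elim: c => //= y c IH; rewrite inE pattern_cons mulrA => /orP[/eqP ->|/IH E].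
  by rewrite pattern_proj_idem.
by rewrite pattern_proj_comm2 -mulrA E.
Qed.

Lemma nrm_proj (p : A) : star p = p -> p * p = p -> nrm p <= 1.
Proof.
move=> sp pp; have := nrm_star2 p; rewrite sp pp => H.
by have := nrm_ge0 p; rewrite leNgt => n0; apply/negP; nra.
Qed.

Lemma nrm_pattern c : nrm (pattern c) <= 1.
Proof.
elim: c => [|x c IH]; first by rewrite pattern_nil nrm1_le.
rewrite pattern_cons (le_trans (nrmM _ _)) //.
have : nrm (pattern_proj x) <= 1.
  apply: nrm_proj (pattern_proj_idem x); rewrite /pattern_proj; case: ifP => _.
    exact: pj_star.
  by rewrite starB star1 pj_star.
have := nrm_ge0 (pattern_proj x); have := nrm_ge0 (pattern c); move: IH; nra.
Qed.

(** Translation of the conditions by u^-1. A word v incompatible with u belongs to no w that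
    contains u: as a positive condition it makes the pattern empty, as a negative one it is
    dropped. *)
Fixpoint conj_pattern u (c : seq (seq S * bool)) : option (seq (seq S * bool)) :=
  if c is (v, b) :: c' then
    match conj_pattern u c', res e u v with
    | Some d, Some (a, _) => Some ((a, b) :: d)
    | Some d, None => if b then None else Some d
    | None, _ => None
    end
  else Some [::].

Lemma conj_patternP u c : star (vw u) * pattern c * vw u =
  if conj_pattern u c is Some d then pattern d else 0.
Proof.
elim: c => [|[v b] c IH] /=; first by rewrite pattern_nil mulr1 vw_iso.
have -> : star (vw u) * pattern ((v, b) :: c) * vw u =
    (star (vw u) * pattern_proj (v, b) * vw u) * (star (vw u) * pattern c * vw u).
  rewrite pattern_cons; set p := pattern_proj _; set q := pattern c.
  have -> : star (vw u) * p * vw u * (star (vw u) * q * vw u) =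
      star (vw u) * (p * pj u) * q * vw u by rewrite /pj !mulrA.
  by rewrite pattern_proj_comm /pj !mulrA vw_iso mul1r.
rewrite IH; case: (conj_pattern u c) => [d|]; last by rewrite mulr0.
have E : star (vw u) * pattern_proj (v, b) * vw u =
    if b then (if res e u v is Some (a, _) then pj a else 0)
    else 1 - (if res e u v is Some (a, _) then pj a else 0).
  rewrite /pattern_proj /=; case: b; first exact: pj_vw.
  by rewrite mulrBr mulr1 mulrBl vw_iso pj_vw.
rewrite E; case: (res e u v) => [[a ?]|]; first by rewrite pattern_cons.
by case: b {E}; rewrite ?mul0r // subr0 mul1r.
Qed.

Definition realizes (w : subsets G) (c : seq (seq S * bool)) :=
  forall x, x \in c -> w (pg x.1) = x.2.

Lemma X0_pg u w : X0 w -> X0 (translate (pg u) w).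
Proof.
move=> Xw; apply: (translate_X0 Xw); apply: (X0_down e_sym e_irr Xw (proj1 Xw)).
by apply/qleP; exists u; rewrite mulVg.
Qed.

Lemma pj_sandwich u (q : A) : star (vw u) * q * vw u = 0 -> pj u * (q * pj u) = 0.
Proof.
move=> H; have -> : pj u * (q * pj u) = vw u * (star (vw u) * q * vw u) * star (vw u).
  by rewrite /pj !mulrA.
by rewrite H mulr0 mul0r.
Qed.

Lemma realizes_conj u c d w : X0 w -> conj_pattern u c = Some d ->
  realizes w d -> realizes (translate (pg u) w) c.
Proof.
move=> Xw; have Xt := X0_pg u Xw.
have wu : translate (pg u) w (pg u) by rewrite translateE mulVg; case: Xw.
elim: c d => [|[v b] c IH] d //=.
case E : (conj_pattern u c) => [d'|] //.
case E2 : (res e u v) => [[a a']|].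
  move=> [<-] H x; rewrite inE => /orP[/eqP -> /=|]; last first.
    by apply: (IH d') => // y yd; apply: H; rewrite inE yd orbT.
  have Ha : w (pg a) = b by have := H (a, b); rewrite mem_head; apply.
  have tE : translate (pg u) w (pg (u ++ a)) = w (pg a).
    by rewrite translateE pg_cat mulKg.
  rewrite -Ha -tE; apply/idP/idP => H'.
    exact: (res_pg_mem e_sym e_irr Xt E2 wu H').
  have [[_ vj _] _] := res_is_join e_sym e_irr E2.
  exact: (X0_down e_sym e_irr Xt H' vj).
case: b => // -[<-] H x; rewrite inE => /orP[/eqP -> /=|]; last exact: (IH d').
apply/negbTE/negP => H'; have [a [b]] := res_mem e_sym e_irr Xt wu H'.
by rewrite E2.
Qed.

Lemma conj_pattern_le u c d : conj_pattern u c = Some d ->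
  count (fun x => x.2) d = count (fun x => x.2) c.
Proof.
elim: c d => [|[v b] c IH] d /=; first by case=> <-.
case: (conj_pattern u c) IH => [d'|] // IH.
case: (res e u v) => [[a a']|]; first by case=> <- /=; rewrite (IH d').
by case: b => // -[<-]; rewrite (IH d').
Qed.

(** The decreasing measure for [pattern_realized]: conjugation by V_s shortens the words that s
    divides and lengthens none. *)
Lemma conj_pattern_size s c d : conj_pattern [:: s] c = Some d ->
  (\sum_(x <- d) size x.1 <= \sum_(x <- c) size x.1)%N /\
  ((exists2 x, x \in c & ldiv (dep e) s x.1) ->
    (\sum_(x <- d) size x.1 < \sum_(x <- c) size x.1)%N).
Proof.
elim: c d => [|[v b] c IH] d; first by case=> <-; rewrite !big_nil; split=> // -[].
rewrite [conj_pattern _ _]/=; case: (conj_pattern _ c) IH => [d'|] // IH.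
have [IH1 IH2] := IH d' erefl.
have sz : ldiv (dep e) s v -> size (rem s v) = (size v).-1.
  move=> sv; have := perm_size (scong_perm (ldiv_scong (dep_sym e_sym) sv)).
  by move=> -> .
have sz1 : ldiv (dep e) s v -> (0 < size v)%N by case: (v).
rewrite /=; case sv : (ldiv (dep e) s v) => /=.
  case=> <-; rewrite !big_cons /= sz //; have := sz1 sv.
  by split=> [|_]; lia.
have H2 : (exists2 x, x \in (v, b) :: c & ldiv (dep e) s x.1) ->
    exists2 x, x \in c & ldiv (dep e) s x.1.
  case=> x; rewrite inE => /orP[/eqP -> /=|xc xs]; first by rewrite sv.
  by exists x.
case: ifP => _.
  case=> <-; rewrite !big_cons /=; split; first by lia.
  by move=> /H2 /IH2; lia.
case: b H2 => // H2 [<-]; rewrite !big_cons /=; split; first by lia.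
by move=> /H2 /IH2; lia.
Qed.

(** Induction on the number of positive conditions, then on the total length. A positive condition u
    is removed by conjugating with V_u. If all conditions are negative, either the pattern survives
    the exclusion of all their first letters, and relation (4) lets [avoiding_maximal] find w, or
    its product with [pj [:: s]] is nonzero for some first letter s, and conjugation by V_s shortens
    it. *)
Lemma pattern_realized c : pattern c <> 0 -> exists2 w, X0 w & realizes w c.
Proof.
have [n] := ubnP (count (fun x => x.2) c); elim: n c => // n IHn c cn.
have [m] := ubnP (\sum_(x <- c) size x.1); elim: m c cn => // m IHm c cn cm c0.
have [/hasP [[u b] uc /= ub]|/hasPn neg] := boolP (has (fun x => x.2) c).
  have pc : perm_eq c ((u, true) :: rem (u, true) c).
    by apply: perm_to_rem; case: b uc ub.
  have E : pattern c = pj u * pattern (rem (u, true) c).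
    by rewrite (pattern_perm pc) pattern_cons.
  have : star (vw u) * pattern (rem (u, true) c) * vw u <> 0.
    move=> H; apply: c0; rewrite E -{1}pj_idem -mulrA -pattern_comm; exact: pj_sandwich.
  rewrite conj_patternP; case E2 : (conj_pattern _ _) => [d|] // d0.
  have [|w Xw wd] := IHn d _ d0.
    rewrite (conj_pattern_le E2); move: cn; have /permP -> := pc.
    by rewrite /= add1n ltnS.
  exists (translate (pg u) w); first exact: X0_pg.
  have Hr := realizes_conj Xw E2 wd.
  move=> x; rewrite (perm_mem pc) inE => /orP[/eqP -> /=|]; last exact: Hr.
  by rewrite translateE mulVg; case: Xw.
(* The first letters of the excluded words. A maximal w that contains none of them realizes c, being
   closed downwards. *)
pose H := flatten [seq take 1 x.1 | x <- c].
have cne x : x \in c -> exists s u, x = (s :: u, false) /\ s \in H.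
  case: x => [[|s u] b] xc; have := neg _ xc; rewrite /= => /negbTE bf; subst b.
    case: c0; rewrite -(pattern_mem xc) /pattern_proj /= /pj vw_nil star1 mulr1.
    by rewrite subrr mul0r.
  exists s, u; split=> //; apply/flattenP; exists [:: s]; last exact: mem_head.
  by apply/mapP; exists (s :: u, false); rewrite //= take0.
have Hc s : s \in H -> exists u, (s :: u, false) \in c.
  move=> /flattenP [q /mapP [[x b] xc ->]] /=.
  have [t [u [[E1 E2] _]]] := cne _ xc; rewrite E1 /= take0 inE => /eqP ->.
  by exists u; rewrite -E1 -E2.
pose Q := \prod_(s <- H) (1 - pj [:: s]).
(* If the product is nonzero, H contains no finite component of the opposite graph: by (4) such a
   component would make Q vanish. *)
have [QH|QH] := eqVneq (pattern c * Q) 0; last first.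
  have [|w Xw wH] := avoiding_maximal e_sym e_irr (A := H).
    move=> F FC; apply: contrapT => nex.
    have FH s : s \in F -> s \in H.
      by move=> sF; apply: contraT => sH; case: nex; exists s.
    case/eqP: QH.
    have QE : Q = pattern [seq ([:: s], false) | s <- H].
      by rewrite /pattern big_map.
    have F0 : pattern [seq ([:: s], false) | s <- F] = 0.
      case: HV => _ _ _ H4; rewrite /pattern big_map -[RHS](H4 F) //.
      by apply: eq_bigr => s _; rewrite /pattern_proj /= /pj vw1.
    rewrite QE.
    have : pattern [seq ([:: s], false) | s <- F] * pattern [seq ([:: s], false) | s <- H] =
        pattern [seq ([:: s], false) | s <- H].
      have : {subset [seq ([:: s], false) | s <- F] <= [seq ([:: s], false) | s <- H]}.
        by move=> x /mapP [s sF ->]; apply: map_f; exact: FH.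
      elim: [seq _ | s <- F] => [|x q IHq] sub; first by rewrite pattern_nil mul1r.
      rewrite pattern_cons -mulrA IHq; last by move=> y yq; apply: sub; rewrite inE yq orbT.
      by apply: pattern_mem; apply: sub; rewrite mem_head.
    by rewrite F0 mul0r => <-; rewrite mulr0.
  exists w => // x xc; have [s [u [-> sH]]] := cne x xc.
  apply/negbTE/negP => /= H'; apply: (wH s sH).
  by apply: (X0_down e_sym e_irr Xw H'); apply/qleP; exists u; rewrite -pg_gen -pg_cat.
(* If every [pattern c * pj [:: s]] were 0, multiplication by Q would fix [pattern c], which would
   then be 0. *)
have [s sH cs] : exists2 s, s \in H & pattern c * pj [:: s] <> 0.
  apply: contrapT => nex; apply: c0; rewrite -QH /Q.
  have : {subset H <= H} by [].
  elim: {1 3}H => [|s q IHq] sub; first by rewrite big_nil mulr1.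
  rewrite big_cons mulrA mulrBr mulr1.
  have -> : pattern c * pj [:: s] = 0.
    by apply: contrapT => H'; apply: nex; exists s => //; apply: sub; rewrite mem_head.
  by rewrite subr0; apply: IHq => t tq; apply: sub; rewrite inE tq orbT.
have : star (vw [:: s]) * pattern c * vw [:: s] <> 0.
  move=> H'; apply: cs; rewrite -{1}pj_idem mulrA pattern_comm -mulrA; exact: pj_sandwich.
rewrite conj_patternP; case E2 : (conj_pattern _ _) => [d|] // d0.
have [_ szlt] := conj_pattern_size E2.
have [u uc] := Hc s sH.
have [||w Xw wd] := IHm d _ _ d0.
- by rewrite (conj_pattern_le E2).
- rewrite -ltnS; apply: leq_trans cm; rewrite ltnS; apply: szlt.
  by exists (s :: u, false) => //=; rewrite eqxx.
by exists (translate (pg [:: s]) w); [exact: X0_pg|exact: realizes_conj Xw E2 wd].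
Qed.

(* (c, (u, v)) stands for c V_u V_v^*. *)
Definition fsum := seq fterm.
Implicit Types (t r : fterm) (x y z : fsum).

Definition fval x : A := \sum_(t <- x) t.1 *: (vw t.2.1 * star (vw t.2.2)).

Definition fstar x : fsum := [seq ((t.1^*)%R, (t.2.2, t.2.1)) | t <- x].

Definition fmul1 t r : fsum :=
  if res e t.2.2 r.2.1 is Some (a, b) then [:: (t.1 * r.1, (t.2.1 ++ a, r.2.2 ++ b))]
  else [::].

Definition fmul x y : fsum := flatten [seq flatten [seq fmul1 t r | r <- y] | t <- x].

Lemma fval_nil : fval [::] = 0. Proof. exact: big_nil. Qed.

Lemma fval_cat x y : fval (x ++ y) = fval x + fval y.
Proof. by rewrite /fval big_cat. Qed.

Lemma fval_flatten (T : Type) (F : T -> fsum) (r : seq T) :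
  fval (flatten [seq F i | i <- r]) = \sum_(i <- r) fval (F i).
Proof. by elim: r => [|i r IH] /=; rewrite ?big_nil ?big_cons ?fval_cat ?IH // fval_nil. Qed.

Lemma fval_star x : fval (fstar x) = star (fval x).
Proof.
rewrite /fval star_sum big_map; apply: eq_bigr => t _ /=.
by rewrite starZ starMr starK.
Qed.

Lemma fval_mul1 t r : fval (fmul1 t r) =
  (t.1 *: (vw t.2.1 * star (vw t.2.2))) * (r.1 *: (vw r.2.1 * star (vw r.2.2))).
Proof.
rewrite scaleAl scaleAr scalerA mulrA -(mulrA (vw t.2.1)) nica /fmul1.
case: (res e _ _) => [[a b]|]; last by rewrite fval_nil mulr0 mul0r scaler0.
rewrite /fval big_seq1 /= !vw_cat starMr !mulrA.
by rewrite -!mulrA.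
Qed.

Lemma fval_mul x y : fval (fmul x y) = fval x * fval y.
Proof.
rewrite fval_flatten {2}/fval mulr_suml; apply: eq_bigr => t _.
rewrite fval_flatten {1}/fval mulr_sumr; apply: eq_bigr => r _.
exact: fval_mul1.
Qed.

Definition diagonal_sum x := forall t, t \in x -> pg t.2.1 = pg t.2.2.

Definition symbol (w : subsets G) x : R[i] := \sum_(t <- x | w (pg t.2.1)) t.1.

Lemma pattern_star c : star (pattern c) = pattern c.
Proof.
have H (x : seq S * bool) : star (pattern_proj x) = pattern_proj x.
  by rewrite /pattern_proj; case: ifP => _; rewrite ?starB ?star1 pj_star.
elim: c => [|x c IH]; first by rewrite pattern_nil star1.
by rewrite pattern_cons starMr IH H pattern_commp.
Qed.

Lemma fval_pattern x c w : diagonal_sum x -> (forall t, t \in x -> (t.2.1, w (pg t.2.1)) \in c) ->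
  fval x * pattern c = symbol w x *: pattern c /\
  pattern c * fval x = symbol w x *: pattern c.
Proof.
move=> dx H.
have E t : t \in x -> (vw t.2.1 * star (vw t.2.2)) * pattern c =
    (if w (pg t.2.1) then pattern c else 0).
  move=> tx; rewrite -(vw_pg (dx t tx)) -/(pj t.2.1).
  have := pattern_mem (H t tx); rewrite /pattern_proj /=; case: ifP => // _.
  by rewrite mulrBl mul1r => /eqP; rewrite subr_eq addrC -subr_eq subrr => /eqP <-.
have E' t : t \in x -> pattern c * (vw t.2.1 * star (vw t.2.2)) =
    (vw t.2.1 * star (vw t.2.2)) * pattern c.
  by move=> tx; rewrite -(vw_pg (dx t tx)) -/(pj t.2.1) pattern_comm.
split; rewrite /fval ?mulr_suml ?mulr_sumr /symbol scaler_suml [RHS]big_mkcond /=;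
  rewrite big_seq [RHS]big_seq; apply: eq_bigr => t tx.
  by rewrite scaleAl E //; case: ifP; rewrite ?scaler0.
by rewrite scaleAr E' // E //; case: ifP; rewrite ?scaler0.
Qed.

(* Cutting 1 into patterns costs a factor 2^(size x), which is negligible for
   high powers of x^* x; on each nonzero pattern x is a scalar. *)
Lemma diagonal_norm x (C : R) : diagonal_sum x -> 0 <= C ->
  (forall w, X0 w -> cn (symbol w x) <= C) -> nrm (fval x) <= C.
Proof.
move=> dx C0 HC.
pose h := star (fval x) * fval x.
have hs : star h = h by rewrite /h starMr starK.
(* [us] contains the words of x that c has not decided yet; each member of it splits the pattern in
   two. *)
have key (us : seq (seq S)) (M : nat) (c : seq (seq S * bool)) :
    (forall t, t \in x -> t.2.1 \in us \/ exists b, (t.2.1, b) \in c) ->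
    nrm (h ^+ M * pattern c) <= 2 ^+ size us * (C ^+ 2) ^+ M.
  elim: us c => [|u us IH] c Hc; last first.
    have -> : h ^+ M * pattern c =
        h ^+ M * pattern ((u, true) :: c) + h ^+ M * pattern ((u, false) :: c).
      rewrite -mulrDr !pattern_cons -mulrDl /pattern_proj /=.
      by rewrite addrCA subrr addr0 mul1r.
    rewrite (le_trans (nrmD _ _)) // [size _]/= exprS -mulrA mulr_natl mulr2n.
    have Hb b t : t \in x -> t.2.1 \in us \/ exists b', (t.2.1, b') \in (u, b) :: c.
      move=> /Hc [|[b' Hb']]; last by right; exists b'; rewrite inE Hb' orbT.
      rewrite inE => /orP[/eqP ->|]; last by left.
      by right; exists b; rewrite mem_head.
    by rewrite lerD //; apply: IH; apply: Hb.
  have [->|/eqP c0] := eqVneq (pattern c) 0.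
    by rewrite mulr0 nrm0 mulr_ge0 ?exprn_ge0.
  have [w Xw wc] := pattern_realized c0.
  have Hw t : t \in x -> (t.2.1, w (pg t.2.1)) \in c.
    by move=> /Hc [//|[b bc]]; rewrite (wc _ bc).
  have [E1 E2] := fval_pattern dx Hw.
  have E3 : star (fval x) * pattern c = ((symbol w x)^*)%R *: pattern c.
    by rewrite -{1}pattern_star -starMr E2 starZ pattern_star.
  have E4 : h * pattern c = (cn (symbol w x) ^+ 2)%:C *: pattern c.
    by rewrite /h -mulrA E1 scaleAr E3 scalerA mulrC conjM_cn.
  have E5 : h ^+ M * pattern c = ((cn (symbol w x) ^+ 2) ^+ M)%:C *: pattern c.
    elim: (M) => [|k IHM] //; first by rewrite !expr0 mul1r scale1r.
    by rewrite exprSr -mulrA E4 scaleAr IHM scalerA -rmorphM /= -exprS.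
  rewrite E5 nrmZ cnC expr0 mul1r ger0_norm ?exprn_ge0 ?cn_ge0 //.
  rewrite (le_trans (ler_piMr _ (nrm_pattern c))) ?exprn_ge0 ?cn_ge0 //.
  have c00 := cn_ge0 (symbol w x); have cC := HC w Xw.
  by rewrite lerXn2r ?nnegrE ?exprn_ge0 // lerXn2r ?nnegrE.
have : nrm h <= C ^+ 2.
  apply: (@power_trick _ _ _ (2 ^+ size [seq t.2.1 | t <- x])); rewrite ?nrm_ge0 ?exprn_ge0 //.
  move=> r; rewrite -nrm_exp2 // -[h ^+ _]mulr1 -pattern_nil.
  rewrite (le_trans (key [seq t.2.1 | t <- x] _ _ _)) //.
    by move=> t tx; left; apply: map_f.
  rewrite ler_wpM2r ?exprn_ge0 // ler_peMr ?exprn_ge0 // -natrX ler1n.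
  by rewrite expn_gt0.
by rewrite /h nrm_star2 ler_pXn2r // ?nnegrE ?nrm_ge0.
Qed.

End Calculus.

(** * Partial crossed products *)

Section Cylinders.
Variable G : groupType.
Implicit Types (w : subsets G) (l : seq G).

Definition agree l w w' := forall g, g \in l -> w g = w' g.

Lemma agree_cat l m w w' : agree (l ++ m) w w' -> agree l w w' /\ agree m w w'.
Proof. by move=> H; split=> g gl; apply: H; rewrite mem_cat gl ?orbT. Qed.

Lemma agree_trans l w w' w'' : agree l w w' -> agree l w' w'' -> agree l w w''.
Proof. by move=> H K g gl; rewrite H // K. Qed.

Lemma nbhs_cylinder w l : nbhs w [set w' | agree l w w'].
Proof.
elim: l => [|g l IH]; first by apply: filterS filterT => w' _ h.
have Hg : nbhs w [set w' : subsets G | w g = w' g].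
  have : {for w, continuous (fun f : subsets G => f g)}.
    exact: (@proj_continuous G (fun=> bool) g).
  move=> /(_ [set b | w g = b]); apply.
  by rewrite nbhs_principalE.
apply: filterS (filterI Hg IH) => w' [/= wg H] h; rewrite inE => /orP[/eqP -> //|].
exact: H.
Qed.

(** Cylinders are a base of the product topology: closure and continuity can be read off finitely
    many coordinates. *)
Lemma nbhs_agree w B : nbhs w B <-> exists l, forall w', agree l w w' -> B w'.
Proof.
split; last by case=> l H; apply: filterS (nbhs_cylinder w l).
pose F : set_system (subsets G) := [set A | exists l, forall w', agree l w w' -> A w'].
have FF : Filter F.
  split.
  - by exists [::].
  - move=> A A' [l Hl] [m Hm]; exists (l ++ m) => w' /agree_cat [/Hl ? /Hm ?].
    by split.
  - by move=> A A' AA [l Hl]; exists l => w' /Hl /AA.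
suff : F --> w by move=> /(_ B).
apply/cvg_sup => g U; have /= -> := @nbhsE (initial_topology (fun f : subsets G => f g)) w.
case=> A [[C oC <- ?]] /filterS; apply; exists [:: g] => w' H /=.
by rewrite -H ?mem_head.
Qed.

Lemma closure_agree (A : set (subsets G)) w :
  closure A w <-> forall l, exists2 w', A w' & agree l w w'.
Proof.
split=> [H l|H B /nbhs_agree [l Hl]].
  by have [w' [Aw' ww']] := H _ (nbhs_cylinder w l); exists w'.
by have [w' Aw' ww'] := H l; exists w'; split=> //; exact: Hl.
Qed.

Lemma closed_agree (A : set (subsets G)) :
  (forall w, (forall l, exists2 w', A w' & agree l w w') -> A w) -> closed A.
Proof. by move=> H w /closure_agree; exact: H. Qed.

Lemma subsets_compact (A : set (subsets G)) : closed A -> compact A.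
Proof.
move=> cA; apply: (subclosed_compact cA) (@tychonoff G (fun=> bool) (fun=> setT) _) _ => //.
by move=> _; exact: bool_compact.
Qed.

Section Continuity.
Variables (R : realType) (X : set (subsets G)).
Implicit Types f g : subsets G -> R[i].

Definition cylcont f := forall w, X w -> forall eps : R, 0 < eps ->
  exists l, forall w', X w' -> agree l w w' -> cn (f w - f w') < eps.

Lemma cylcontP f : {within X, continuous (f : subsets G -> R[i]^o)} <-> cylcont f.
Proof.
split=> [/subspace_continuousP H w Xw eps e0|H].
  have /cvgrPdist_lt /(_ eps%:C) := H w Xw; rewrite ltcR => /(_ e0).
  move=> /nbhs_agree [l Hl]; exists l => w' Xw' /Hl /(_ Xw').
  by rewrite cnE ltcR.
apply/subspace_continuousP => w Xw; apply/cvgrPdist_lt => eps.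
case: eps => er ei; rewrite ltcE /= => /andP[/eqP -> e0].
have [l Hl] := H w Xw er e0; apply/nbhs_agree; exists l => w' ww' Xw'.
by rewrite cnE ltcR; exact: Hl.
Qed.

Lemma cylcont_local f :
  (forall w, X w -> exists l, forall w', X w' -> agree l w w' -> f w = f w') -> cylcont f.
Proof.
move=> H w Xw eps e0; have [l Hl] := H w Xw; exists l => w' Xw' /Hl ->//.
by rewrite subrr cn0.
Qed.

Lemma cylcontD f g : cylcont f -> cylcont g -> cylcont (fun w => f w + g w).
Proof.
move=> cf cg w Xw eps e0; have e2 : 0 < eps / 2 by rewrite divr_gt0.
have [l Hl] := cf w Xw _ e2; have [m Hm] := cg w Xw _ e2.
exists (l ++ m) => w' Xw' /agree_cat [/(Hl _ Xw') H1 /(Hm _ Xw') H2].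
by rewrite opprD addrACA (le_lt_trans (cnD _ _)) //; lra.
Qed.

Lemma cylcontM f g : cylcont f -> cylcont g -> cylcont (fun w => f w * g w).
Proof.
move=> cf cg w Xw eps e0.
pose M := cn (f w) + cn (g w) + 1.
have MM0 : 0 < M + M by rewrite /M; have := cn_ge0 (f w); have := cn_ge0 (g w); lra.
pose d := Num.min 1 (eps / (M + M)).
have d0 : 0 < d by rewrite lt_min ltr01 divr_gt0.
have [l Hl] := cf w Xw _ d0; have [m Hm] := cg w Xw _ d0.
exists (l ++ m) => w' Xw' /agree_cat [/(Hl _ Xw') H1 /(Hm _ Xw') H2].
have -> : f w * g w - f w' * g w' = f w * (g w - g w') + (f w - f w') * g w' by ring.
rewrite (le_lt_trans (cnD _ _)) // !cnM.
have d1 : d <= 1 by rewrite /d ge_min lexx.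
have dM : d * (M + M) <= eps.
  rewrite -ler_pdivlMr //.
  by rewrite /d ge_min lexx orbT.
have G2 : cn (g w') <= cn (g w) + 1.
  rewrite (_ : g w' = g w - (g w - g w')); last by rewrite subKr.
  by rewrite (le_trans (cnD _ _)) // cnN lerD2l (le_trans (ltW H2)).
have A1 : cn (f w) * cn (g w - g w') <= cn (f w) * d.
  by rewrite ler_wpM2l ?cn_ge0 // ltW.
have A2 : cn (f w - f w') * cn (g w') <= d * (cn (g w) + 1).
  by rewrite ler_pM ?cn_ge0 // ltW.
rewrite (le_lt_trans (lerD A1 A2)) // (lt_le_trans _ dM) //.
have := cn_ge0 (f w); have := cn_ge0 (g w); rewrite /M; nra.
Qed.

Lemma cylcont_cst (c : R[i]) : cylcont (fun=> c).
Proof. by apply: cylcont_local => w _; exists [::]. Qed.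

Lemma cylcont_conj f : cylcont f -> cylcont (fun w => ((f w)^*)%R).
Proof.
move=> cf w Xw eps e0; have [l Hl] := cf w Xw _ e0; exists l => w' Xw' /(Hl _ Xw').
by rewrite -rmorphB /= cn_conj.
Qed.

Lemma cylcont_sqrt f : cylcont f ->
  cylcont (fun w => (Num.sqrt (complex.Re (f w)))%:C).
Proof.
move=> cf w Xw eps e0; have e2 : 0 < eps ^+ 2 by rewrite exprn_gt0.
have [l Hl] := cf w Xw _ e2; exists l => w' Xw' /(Hl _ Xw').
set a := f w; set b := f w' => ab.
rewrite -rmorphB /= cnC.
have H : `|complex.Re a - complex.Re b| < eps ^+ 2.
  have Rle (c : R[i]) : `|complex.Re c| <= cn c.
    by case: (c) => x y; rewrite /cn normc_def /= -sqrtr_sqr ler_wsqrtr // lerDl sqr_ge0.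
  apply: le_lt_trans ab; apply: le_trans (Rle _).
  by case: (a) => ? ?; case: (b).
move: H; set x := complex.Re a; set y := complex.Re b => H.
(* The square root is Hoelder continuous of exponent 1/2; it is 0 on negative numbers, hence the
   cases. *)
have key (p q : R) : `|Num.sqrt p - Num.sqrt q| ^+ 2 <= `|p - q|.
  wlog pq : p q / q <= p => [Hw|].
    by case/orP: (le_total q p) => ?; [|rewrite distrC (distrC p)]; exact: Hw.
  have spq : Num.sqrt q <= Num.sqrt p by rewrite ler_wsqrtr.
  rewrite !ger0_norm ?subr_ge0 //.
  have [p0|p0] := lerP p 0.
    by rewrite !ler0_sqrtr ?(le_trans pq) // subrr expr0n /= subr_ge0.
  have [q0|q0] := lerP q 0.
    by rewrite (ler0_sqrtr q0) subr0 sqr_sqrtr ?(ltW p0) // lerBrDr gerDl.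
  have := sqr_sqrtr (ltW p0); have := sqr_sqrtr (ltW q0).
  have := sqrtr_ge0 q; nra.
rewrite -(@ltr_pXn2r _ 2) ?nnegrE // ?(ltW e0) //.
exact: le_lt_trans (key x y) H.
Qed.

(** If no list works, the sets [bad l] generate a proper filter; by compactness it has a cluster
    point, and continuity fails there. *)
Lemma cylcont_uniform f (eps : R) : closed X -> cylcont f -> 0 < eps ->
  exists l, forall w w', X w -> X w' -> agree l w w' -> cn (f w - f w') < eps.
Proof.
move=> cX cf e0; apply: contrapT => N.
pose bad l : set (subsets G) := [set w | X w /\ exists2 w', X w' /\ agree l w w' &
  eps <= cn (f w - f w')].
pose F : set_system (subsets G) := [set A | exists l, bad l `<=` A].
have badI l m : bad (l ++ m) `<=` bad l `&` bad m.
  move=> w [Xw [w' [Xw' /agree_cat [Hl Hm]] He]].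
  by split; split=> //; exists w'.
have FF : ProperFilter F.
  split; [|split].
  - case=> l Hl; apply: N; exists l => w w' Xw Xw' ww'; rewrite ltNge; apply/negP => He.
    by apply: (Hl w); split=> //; exists w'.
  - by exists [::].
  - move=> A A' [l Hl] [m Hm]; exists (l ++ m) => w /badI [/Hl ? /Hm ?].
    by split.
  - by move=> A A' AA [l Hl]; exists l => w /Hl /AA.
have e2 : 0 < eps / 2 by rewrite divr_gt0.
have [|w [Xw clw]] := @subsets_compact X cX F FF; first by exists [::] => w [].
have [l Hl] := cf w Xw _ e2.
have [|w1 [[Xw1 [w2 [Xw2 H12] He]] Hw1]] := clw (bad l) _ _ (nbhs_cylinder w l).
  by exists l.
have := Hl _ Xw1 Hw1; have := Hl _ Xw2 (agree_trans Hw1 H12).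
have E : f w1 - f w2 = (f w - f w2) - (f w - f w1) by ring.
move=> H1 H2; move: He; rewrite leNgt => /negP; apply.
by rewrite E (le_lt_trans (cnD _ _)) // cnN; lra.
Qed.

End Continuity.

End Cylinders.

Section PartialCrossedProductTheory.
Variables (R : realType) (G : groupType) (X : set (subsets G)).
Hypothesis X1 : forall w, X w -> w 1%g.
Hypothesis Xt : forall t w, X w -> w t^-1%g -> X (translate t w).
Hypothesis Xclosed : closed X.
Local Notation ideal := (@pcp_ideal R G X).
Local Notation mono := (@pcp_mono R G).
Local Notation elt := (@pcp_elt R G X).
Local Notation tr := (@translate G).
Implicit Types (s t r : G) (w : subsets G) (f g : subsets G -> R[i]) (a b : pcp R G).

Lemma idealP t f : ideal t f <-> cylcont X f /\ forall w, f w <> 0 -> X w /\ w t.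
Proof. by split=> -[H1 H2]; split=> //; apply/cylcontP. Qed.

Lemma ideal_cont t f : ideal t f -> cylcont X f. Proof. by case/idealP. Qed.

Lemma ideal_supp t f w : ideal t f -> f w <> 0 -> X w /\ w t.
Proof. by case/idealP => _; exact. Qed.

Lemma ideal_out t f w : ideal t f -> ~ (X w /\ w t) -> f w = 0.
Proof. by move=> It H; apply: contrapT => /(ideal_supp It). Qed.

Lemma XtV t w : X w -> w t -> X (tr t^-1%g w).
Proof. by move=> Xw wt; apply: Xt; rewrite ?invgK. Qed.

Lemma ideal0 t : ideal t (fun=> 0).
Proof. by apply/idealP; split=> //; exact: cylcont_cst. Qed.

Lemma idealD t f g : ideal t f -> ideal t g -> ideal t (fun w => f w + g w).
Proof.
move=> If Ig; apply/idealP; split; first exact: cylcontD (ideal_cont If) (ideal_cont Ig).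
move=> w fg; apply: contrapT => N; apply: fg.
by rewrite (ideal_out If N) (ideal_out Ig N) addr0.
Qed.

Lemma idealMl t f g : cylcont X g -> ideal t f -> ideal t (fun w => g w * f w).
Proof.
move=> cg If; apply/idealP; split; first by apply: cylcontM => //; exact: ideal_cont If.
by move=> w fg; apply: (ideal_supp If) => f0; apply: fg; rewrite f0 mulr0.
Qed.

Lemma idealZ t c f : ideal t f -> ideal t (fun w => c * f w).
Proof. by apply: idealMl; exact: cylcont_cst. Qed.

(** U_t is clopen, so the extension by 0 stays continuous; the coordinate h of the translate is the
    coordinate t h of w. *)
Lemma cylcont_translate t f : cylcont X f ->
  cylcont X (fun w => if w t then f (tr t^-1%g w) else 0).
Proof.
move=> cf w Xw eps e0; have [wt|wt] := boolP (w t); last first.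
  by exists [:: t] => w' _ /(_ t (mem_head _ _)) <-; rewrite (negbTE wt) subrr cn0.
have [l Hl] := cf _ (XtV Xw wt) _ e0.
exists (t :: [seq t * h | h <- l]%g) => w' Xw' H.
rewrite -(H t (mem_head _ _)) wt; apply: Hl.
  by apply: XtV => //; rewrite -(H t (mem_head _ _)).
by move=> h hl; rewrite !translateE invgK; apply: H; rewrite inE map_f ?orbT.
Qed.

Lemma ideal_prod s t f g : ideal s f -> ideal t g ->
  ideal (s * t)%g (fun w => f w * g (tr s^-1%g w)).
Proof.
move=> If Ig.
have E w : f w * g (tr s^-1%g w) = f w * (if w s then g (tr s^-1%g w) else 0).
  have [f0|/eqP /(ideal_supp If)[_ ->]//] := eqVneq (f w) 0.
  by rewrite f0 !mul0r.
apply/idealP; split.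
  rewrite (funext E); apply: cylcontM; first exact: ideal_cont If.
  exact: cylcont_translate (ideal_cont Ig).
move=> w fg; have fw : f w <> 0 by move=> f0; apply: fg; rewrite f0 mul0r.
have gw : g (tr s^-1%g w) <> 0 by move=> g0; apply: fg; rewrite g0 mulr0.
have [Xw _] := ideal_supp If fw; have [_] := ideal_supp Ig gw.
by rewrite translateE invgK.
Qed.

Lemma ideal_star t f : ideal t f -> ideal t^-1%g (fun w => ((f (tr t w))^*)%R).
Proof.
move=> If.
have supp w : f (tr t w) <> 0 -> X w /\ w t^-1%g.
  move=> /(ideal_supp If)[Xw wt]; split.
    by have := XtV Xw wt; rewrite translateK.
  by have := X1 Xw; rewrite translateE mulg1.
have E w : f (tr t w) = if w t^-1%g then f (tr (t^-1)^-1%g w) else 0.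
  rewrite invgK; case: ifPn => // wt; apply: contrapT => /supp[_].
  by apply/negP.
apply/idealP; split.
  apply: cylcont_conj; rewrite (funext E); exact: cylcont_translate (ideal_cont If).
by move=> w fw; apply: supp => f0; apply: fw; rewrite f0 conjC0.
Qed.

(** By uniform continuity f varies by less than 1 on each of the finitely many pieces into which the
    coordinates in l divide X; the induction on l splits by one coordinate at a time. *)
Lemma cylcont_bounded f : cylcont X f -> exists C, 0 <= C /\ forall w, X w -> cn (f w) <= C.
Proof.
move=> cf; have [l Hl] := cylcont_uniform Xclosed cf ltr01.
have {Hl} : forall w w', X w -> X w' -> agree l w w' -> cn (f w - f w') < 1 by [].
have : X `<=` X by [].
elim: l {-2}X => [|h l IH] Y YX Hl.
  have [[w0 Yw0]|N] := pselect (exists w0, Y w0).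
    exists (cn (f w0) + 1); split=> [|w Yw]; first by rewrite addr_ge0 ?cn_ge0.
    rewrite -[f w](subrK (f w0)) addrC (le_trans (cnD _ _)) // lerD2l ltW //.
    exact: Hl.
  by exists 0; split=> // w Yw; case: N; exists w.
have [||C1 [C10 H1]] := IH (fun w => Y w /\ w h).
- by move=> w [/YX].
- move=> w w' [Yw wh] [Yw' wh'] H; apply: Hl => // k; rewrite inE => /orP[/eqP ->|/H//].
  by rewrite wh wh'.
have [||C2 [C20 H2]] := IH (fun w => Y w /\ ~~ w h).
- by move=> w [/YX].
- move=> w w' [Yw wh] [Yw' wh'] H; apply: Hl => // k; rewrite inE => /orP[/eqP ->|/H//].
  by rewrite (negbTE wh) (negbTE wh').
exists (C1 + C2); split=> [|w Yw]; first by rewrite addr_ge0.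
have [wh|wh] := boolP (w h).
  by rewrite (le_trans (H1 w _)) // lerDl.
by rewrite (le_trans (H2 w _)) // lerDr.
Qed.

Lemma ideal_bounded t f : ideal t f -> exists C, 0 <= C /\ forall w, cn (f w) <= C.
Proof.
move=> If; have [C [C0 HC]] := cylcont_bounded (ideal_cont If).
exists C; split=> // w; have [Xw|nXw] := pselect (X w); first exact: HC.
by rewrite (ideal_out If) ?cn0 // => -[].
Qed.

Lemma ideal_char t : ideal t (@pcp_char R G X t).
Proof.
apply/idealP; split; last first.
  by move=> w; rewrite /pcp_char; case: asboolP.
apply: cylcont_local => w Xw; exists [:: t] => w' Xw' H; rewrite /pcp_char.
by congr (nat_of_bool _)%:R; apply/asboolP/asboolP => -[_]; rewrite (H t (mem_head _ _)).
Qed.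

Lemma charE t w : X w -> @pcp_char R G X t w = (w t)%:R.
Proof. by move=> Xw; rewrite /pcp_char; case: asboolP => [[_ ->]//|]; case: (w t) => // -[]. Qed.

Lemma char1E w : X w -> @pcp_char R G X 1%g w = 1.
Proof. by move=> Xw; rewrite charE // X1. Qed.

Lemma eltP a : elt a <-> (exists l : seq G, uniq l /\ forall t, t \notin l -> a t = fun=> 0) /\
  forall t, ideal t (a t).
Proof.
split=> -[fa Ia]; split=> //.
  exists (finmap.enum_fset (fset_set [set t | a t <> 0])); split; first exact: finmap.fset_uniq.
  move=> t; apply: contraNeq => /eqP H.
  by rewrite in_fset_set // inE.
case: fa => l [_ H]; apply: (sub_finite_set _ (finite_seq l)) => t /= at0.
by apply: contraT => /H.
Qed.

Lemma elt_mono t f : ideal t f -> elt (mono f t).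
Proof.
move=> If; apply/eltP; split.
  by exists [:: t]; split=> // r; rewrite inE /pcp_mono => /negbTE ->.
by move=> r; rewrite /pcp_mono; case: eqP => [->//|_]; exact: ideal0.
Qed.

Lemma elt_add a b : elt a -> elt b -> elt (pcp_add a b).
Proof.
move=> /eltP[[l [_ Hl]] Ia] /eltP[[m [_ Hm]] Ib]; apply/eltP; split; last first.
  by move=> t; exact: idealD.
exists (undup (l ++ m)); split; first exact: undup_uniq.
move=> t; rewrite mem_undup mem_cat negb_or => /andP[/Hl a0 /Hm b0].
by apply/funext => w; rewrite /pcp_add a0 b0 addr0.
Qed.

Lemma elt_scale c a : elt a -> elt (pcp_scale c a).
Proof.
move=> /eltP[[l [ul Hl]] Ia]; apply/eltP; split; last by move=> t; exact: idealZ.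
by exists l; split=> // t /Hl a0; apply/funext => w; rewrite /pcp_scale a0 mulr0.
Qed.

Lemma elt_one : elt (@pcp_one R G X).
Proof. by apply: elt_mono; exact: ideal_char. Qed.

Lemma elt_star a : elt a -> elt (pcp_star a).
Proof.
move=> /eltP[[l [ul Hl]] Ia]; apply/eltP; split.
  exists [seq t^-1 | t <- l]%g; split; first by rewrite map_inj_uniq //; exact: invg_inj.
  move=> t tl; apply/funext => w; rewrite /pcp_star /pcp_alpha Hl ?conjC0 //.
  by apply: contra tl => tl; apply/mapP; exists t^-1%g; rewrite ?invgK.
move=> t; have := ideal_star (Ia t^-1%g); rewrite invgK.
by rewrite /pcp_star /pcp_alpha.
Qed.

(** The two translations in alpha_s (alpha_{s^-1} f * g) cancel on f: the coefficient is f times a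
    translate of g. *)
Lemma pcp_mulE a b l r w : uniq l -> (forall t, t \notin l -> a t = fun=> 0) ->
  pcp_mul a b r w = \sum_(s <- l) a s w * b (s^-1 * r)%g (tr s^-1%g w).
Proof.
move=> ul Hl; rewrite /pcp_mul (fsbigE l) //.
  rewrite big_mkcond; apply: eq_bigr => s _; rewrite in_setT /pcp_alpha.
  by rewrite invgK translateKV.
by move=> s _ sl; rewrite /pcp_alpha (Hl s sl) mul0r.
Qed.

Lemma elt_mul a b : elt a -> elt b -> elt (pcp_mul a b).
Proof.
move=> /eltP[[l [ul Hl]] Ia] /eltP[[m [um Hm]] Ib]; apply/eltP; split.
  exists (undup [seq s * t | s <- l, t <- m]%g); split; first exact: undup_uniq.
  move=> r; rewrite mem_undup => rlm; apply/funext => w.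
  rewrite (pcp_mulE _ _ _ ul Hl) big_seq big1 // => s sl; rewrite Hm ?mulr0 //.
  apply: contra rlm => rm; apply/allpairsP; exists (s, s^-1 * r)%g.
  by rewrite /= mulgA mulgV mul1g.
move=> r.
have -> : pcp_mul a b r = fun w => \sum_(s <- l) a s w * b (s^-1 * r)%g (tr s^-1%g w).
  by apply/funext => w; exact: pcp_mulE.
elim: l {ul Hl} => [|s l IH].
  by under eq_fun do rewrite big_nil; exact: ideal0.
under eq_fun do rewrite big_cons.
apply: idealD IH; have := ideal_prod (Ia s) (Ib (s^-1 * r)%g).
by rewrite mulgA mulgV mul1g.
Qed.

Lemma mono_mul s t f g :
  pcp_mul (mono f s) (mono g t) = mono (fun w => f w * g (tr s^-1%g w)) (s * t)%g.
Proof.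
apply/funext => r; apply/funext => w; rewrite (@pcp_mulE _ _ [:: s]) //; last first.
  by move=> h; rewrite inE /pcp_mono => /negbTE ->.
rewrite big_seq1 /pcp_mono eqxx.
have -> : ((s^-1 * r)%g == t) = (r == (s * t)%g).
  by apply/eqP/eqP => [<-|->]; rewrite ?mulgA ?mulgV ?mulVg mul1g.
by case: eqP => // _; rewrite mulr0.
Qed.

Lemma mono_star t f : pcp_star (mono f t) = mono (fun w => ((f (tr t w))^*)%R) t^-1%g.
Proof.
apply/funext => r; apply/funext => w; rewrite /pcp_star /pcp_alpha /pcp_mono.
have -> : (r^-1%g == t) = (r == t^-1%g) by apply/eqP/eqP => [<-|->]; rewrite invgK.
by case: eqP => [->|_]; rewrite ?invgK ?conjC0.
Qed.

Lemma mono_add t f g : pcp_add (mono f t) (mono g t) = mono (fun w => f w + g w) t.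
Proof.
apply/funext => r; apply/funext => w; rewrite /pcp_add /pcp_mono.
by case: eqP => // _; rewrite addr0.
Qed.

Lemma mono_scale c t f : pcp_scale c (mono f t) = mono (fun w => c * f w) t.
Proof.
apply/funext => r; apply/funext => w; rewrite /pcp_scale /pcp_mono.
by case: eqP => // _; rewrite mulr0.
Qed.

Section Hom.
Variables (D : cstarType R) (k : pcp R G -> D).
Hypothesis kP : pcp_hom X k.

Lemma pcp_homD a b : elt a -> elt b -> k (pcp_add a b) = k a + k b.
Proof. by case: kP => H _ _ _ _; exact: H. Qed.
Lemma pcp_homZ c a : elt a -> k (pcp_scale c a) = c *: k a.
Proof. by case: kP => _ H _ _ _; exact: H. Qed.
Lemma pcp_homM a b : elt a -> elt b -> k (pcp_mul a b) = k a * k b.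
Proof. by case: kP => _ _ H _ _; exact: H. Qed.
Lemma pcp_homS a : elt a -> k (pcp_star a) = star (k a).
Proof. by case: kP => _ _ _ H _; exact: H. Qed.
Lemma pcp_hom1 : k (@pcp_one R G X) = 1.
Proof. by case: kP. Qed.

Lemma homD t f g : ideal t f -> ideal t g ->
  k (mono (fun w => f w + g w) t) = k (mono f t) + k (mono g t).
Proof. by move=> If Ig; rewrite -mono_add pcp_homD //; exact: elt_mono. Qed.

Lemma homZ c t f : ideal t f -> k (mono (fun w => c * f w) t) = c *: k (mono f t).
Proof. by move=> If; rewrite -mono_scale pcp_homZ //; exact: elt_mono. Qed.

Lemma homM s t f g : ideal s f -> ideal t g ->
  k (mono f s) * k (mono g t) = k (mono (fun w => f w * g (tr s^-1%g w)) (s * t)%g).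
Proof. by move=> If Ig; rewrite -mono_mul pcp_homM //; exact: elt_mono. Qed.

Lemma homM1 f g : ideal 1%g f -> ideal 1%g g ->
  k (mono f 1%g) * k (mono g 1%g) = k (mono (fun w => f w * g w) 1%g).
Proof.
move=> If Ig; rewrite homM // mulg1; congr (k (mono _ _)).
by apply/funext => w; rewrite invg1 translate1.
Qed.

Lemma homS t f : ideal t f ->
  star (k (mono f t)) = k (mono (fun w => ((f (tr t w))^*)%R) t^-1%g).
Proof. by move=> If; rewrite -mono_star pcp_homS //; exact: elt_mono. Qed.

Lemma homS1 f : ideal 1%g f -> star (k (mono f 1%g)) = k (mono (fun w => ((f w)^*)%R) 1%g).
Proof.
move=> If; rewrite homS // invg1; congr (k (mono _ _)).
by apply/funext => w; rewrite translate1.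
Qed.

Lemma hom0 t : k (mono (fun=> 0) t) = 0.
Proof.
have -> : (fun=> 0) = (fun w : subsets G => (0 : R[i]) * 0) by rewrite mulr0.
by rewrite homZ ?scale0r //; exact: ideal0.
Qed.

Lemma hom_decomp a l : elt a -> uniq l -> (forall t, t \notin l -> a t = fun=> 0) ->
  k a = \sum_(t <- l) k (mono (a t) t).
Proof.
move=> /eltP[_ Ia] ul Hl.
pose psum (m : seq G) : pcp R G := fun t => if t \in m then a t else (fun=> 0).
have aE : a = psum l by apply/funext => t; rewrite /psum; case: ifPn => // /Hl.
have Ip m t : ideal t (psum m t) by rewrite /psum; case: ifP => _ //; exact: ideal0.
have Ep m : elt (psum m).
  apply/eltP; split=> //; exists (undup m); split; first exact: undup_uniq.
  by move=> t; rewrite mem_undup /psum => /negbTE ->.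
rewrite {1}aE; elim: l {Hl aE} ul => [_|t m IH /= /andP[tm um]].
  rewrite big_nil -(hom0 1%g); congr k; apply/funext => t.
  by rewrite /psum /pcp_mono; case: eqP.
rewrite big_cons -IH // -pcp_homD //; last exact: elt_mono.
congr k; apply/funext => r; apply/funext => w; rewrite /pcp_add /psum /pcp_mono inE.
by case: eqP => [->|_] /=; rewrite ?(negbTE tm) ?addr0 ?add0r.
Qed.

(* With h = |f|^2 / c^2, the images of h and sqrt (1 - h^2) are as in
   [selfadjoint_pythagoras], which bounds the image of f^* f. *)
Lemma nrm_hom1 f (c : R) : ideal 1%g f -> 0 <= c -> (forall w, X w -> cn (f w) <= c) ->
  nrm (k (mono f 1%g)) <= c.
Proof.
move=> If; rewrite le_eqVlt => /orP[/eqP <- f0|c0 fc].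
  have -> : f = fun=> 0; last by rewrite hom0 nrm0.
  apply/funext => w; apply: contrapT => fw; apply: (fw); apply: cn_eq0.
  by apply/eqP; rewrite eq_le cn_ge0 andbT; apply: f0; case: (ideal_supp If fw).
pose h w : R := (cn (f w) / c) ^+ 2.
have h01 w : 0 <= h w <= 1.
  rewrite sqr_ge0 /= expr_le1 // ?divr_ge0 ?cn_ge0 ?(ltW c0) //.
  rewrite ler_pdivrMr // mul1r; have [/fc//|nX] := pselect (X w).
  by rewrite (ideal_out If) ?cn0 ?(ltW c0) // => -[].
pose hC w := (h w)%:C : R[i].
have hE w : hC w = ((c ^- 2)%:C * (f w)^* * f w)%R.
  rewrite /hC /h -mulrA conjM_cn -rmorphM /= exprMn mulrC exprVn; congr _%:C.
have Ih : ideal 1%g hC.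
  rewrite (funext hE); apply: (idealMl _ If); apply: cylcontM; first exact: cylcont_cst.
  exact: cylcont_conj (ideal_cont If).
pose q w := (Num.sqrt (1 - h w ^+ 2))%:C * @pcp_char R G X 1%g w.
have Iq : ideal 1%g q.
  apply: idealMl; last exact: ideal_char.
  have -> : (fun w => (Num.sqrt (1 - h w ^+ 2))%:C) =
      (fun w => (Num.sqrt (complex.Re (1 - hC w * hC w)))%:C).
    apply/funext => w; congr (Num.sqrt _)%:C.
    by rewrite /hC -rmorphM /= expr2.
  apply: cylcont_sqrt; apply: cylcontD; first exact: cylcont_cst.
  have -> : (fun w => - (hC w * hC w)) = (fun w => (-1) * (hC w * hC w)).
    by apply/funext => w; rewrite mulN1r.
  apply: cylcontM; first exact: cylcont_cst.
  by apply: cylcontM; exact: ideal_cont Ih.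
have H1 : nrm (k (mono hC 1%g)) <= 1.
  apply: (@selfadjoint_pythagoras _ _ _ (k (mono q 1%g))).
  - rewrite homS1 //; congr (k (mono _ _)); apply/funext => w; exact: conjR.
  - rewrite homS1 //; congr (k (mono _ _)); apply/funext => w.
    by rewrite /q rmorphM /= conjR /pcp_char conjC_nat.
  - by rewrite !homM1 //; congr (k (mono _ _)); apply/funext => w; rewrite mulrC.
  - rewrite !homM1 // -homD -?pcp_hom1.
    + congr (k (mono _ _)); apply/funext => w.
      have [Xw|nXw] := pselect (X w); last first.
        rewrite (ideal_out Ih) 1?(ideal_out Iq) 1?(ideal_out (ideal_char 1%g)) ?mul0r ?addr0 //;
          by case.
      rewrite /q (char1E Xw) mulr1 /hC -!rmorphM -rmorphD /= -!expr2 sqr_sqrtr.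
        by rewrite addrC subrK.
      by have /andP[h0 h1] := h01 w; rewrite subr_ge0 expr_le1.
    + exact: idealMl (ideal_cont Ih) Ih.
    + exact: idealMl (ideal_cont Iq) Iq.
have H2 : nrm (k (mono f 1%g)) ^+ 2 <= c ^+ 2.
  rewrite -nrm_star2 homS1 // homM1 //; last first.
    rewrite -[X in ideal X]invg1; have := ideal_star If.
    by under eq_fun do rewrite translate1.
  have -> : (fun w => ((f w)^*)%R * f w) = (fun w => (c ^+ 2)%:C * hC w).
    apply/funext => w; rewrite hE mulrA mulrA -rmorphM /= mulfV ?mul1r //.
    by rewrite expf_neq0 // gt_eqF.
  rewrite homZ // nrmZ cnC ger0_norm ?sqr_ge0 //.
  by rewrite ler_piMr ?sqr_ge0.
by rewrite -(@ler_pXn2r _ 2) ?nnegrE ?nrm_ge0 // ltW.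
Qed.

(** The C*-identity moves f delta_t to degree 1, where [nrm_hom1] applies. *)
Lemma nrm_hom t f (c : R) : ideal t f -> 0 <= c -> (forall w, X w -> cn (f w) <= c) ->
  nrm (k (mono f t)) <= c.
Proof.
move=> If c0 fc; rewrite -(@ler_pXn2r _ 2) ?nnegrE ?nrm_ge0 // -nrm_star2 homS //.
have Is := ideal_star If.
rewrite homM // mulVg; apply: nrm_hom1.
- by have := ideal_prod Is If; rewrite mulVg.
- exact: sqr_ge0.
move=> w Xw; rewrite invgK conjM_cn cnC ger0_norm ?sqr_ge0 //.
rewrite ler_pXn2r ?nnegrE ?cn_ge0 //.
have [/fc//|nX] := pselect (X (tr t w)).
by rewrite (ideal_out If) ?cn0 // => -[].
Qed.

End Hom.

(** The universal property speaks of values on [pcp_elt] only. Setting the others to 0 bounds every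
    value of k, as the construction of [univ] requires. *)
Definition pcp_rep (D : cstarType R) (k : pcp R G -> D) : Prop :=
  pcp_hom X k /\ forall a, ~ elt a -> k a = 0.

Lemma pcp_rep_bounded a : exists M, forall (D : cstarType R) (k : pcp R G -> D),
  pcp_rep k -> nrm (k a) <= M.
Proof.
have [ea|na] := pselect (elt a); last by exists 0 => D k [_ /(_ _ na) ->]; rewrite nrm0.
have [[l [ul Hl]] Ia] := (eltP a).1 ea.
have [C HC] := choice (fun t => ideal_bounded (Ia t)).
exists (\sum_(t <- l) C t) => D k [kP _].
rewrite (hom_decomp kP ea ul Hl) (le_trans (nrm_sum _ _ _)) //.
by apply: ler_sum => t _; have [C0 HCt] := HC t; apply: (nrm_hom kP (Ia t)).
Qed.

Lemma crossed_product_exists :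
  exists (B : cstarType R) (j : pcp R G -> B),
    is_crossed_product X j /\
    forall (xi : B) (eps : R), 0 < eps -> exists2 a, elt a & nrm (xi - j a) < eps.
Proof.
have [M HM] := choice pcp_rep_bounded.
pose K (D : cstarType R) (k : pcp R G -> D) := pcp_rep k.
have Kb (D : cstarType R) (k : pcp R G -> D) a : K D k -> nrm (k a) <= M a by exact: HM.
pose B := univ Kb; pose j : pcp R G -> B := ugen Kb.
have eqj := @ugen_eq _ _ K M Kb.
have jP : pcp_hom X j.
  split.
  - move=> a b ea eb; apply: (eqj (TVar _ (pcp_add a b)) (TAdd (TVar _ a) (TVar _ b))).
    by move=> D k [kP _] /=; exact: pcp_homD.
  - move=> c a ea; apply: (eqj (TVar _ (pcp_scale c a)) (TSc c (TVar _ a))).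
    by move=> D k [kP _] /=; exact: pcp_homZ.
  - move=> a b ea eb; apply: (eqj (TVar _ (pcp_mul a b)) (TMul (TVar _ a) (TVar _ b))).
    by move=> D k [kP _] /=; exact: pcp_homM.
  - move=> a ea; apply: (eqj (TVar _ (pcp_star a)) (TSt (TVar _ a))).
    by move=> D k [kP _] /=; exact: pcp_homS.
  - apply: (eqj (TVar _ (@pcp_one R G X)) (T1 _ _)).
    by move=> D k [kP _] /=; exact: pcp_hom1.
have j0 a : ~ elt a -> j a = 0.
  move=> na; apply: (eqj (TVar _ a) (T0 _ _)).
  by move=> D k [_ k0] /=; exact: k0.
exists B, j; split; first (split=> // D k kP).
  pose k' a : D := if `[< elt a >] then k a else 0.
  have k'E a : elt a -> k' a = k a by rewrite /k'; case: asboolP.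
  have Kk' : K D k'.
    split; last by move=> a na; rewrite /k'; case: asboolP.
    split.
    - move=> a b ea eb; rewrite !k'E ?pcp_homD //; exact: elt_add.
    - move=> c a ea; rewrite !k'E ?pcp_homZ //; exact: elt_scale.
    - move=> a b ea eb; rewrite !k'E ?pcp_homM //; exact: elt_mul.
    - move=> a ea; rewrite !k'E ?pcp_homS //; exact: elt_star.
    - rewrite k'E ?pcp_hom1 //; exact: elt_one.
  exists (@ulift _ _ K M Kb D k' Kk'); split.
    split; first exact: ulift_star_hom.
    by move=> a ea; rewrite -k'E //; exact: ulift_gen.
  move=> g [gP gj]; apply: univ_hom_unique => //; first exact: ulift_star_hom.
  move=> a; rewrite ulift_gen; have [ea|na] := pselect (elt a).
    by rewrite k'E // -gj.
  have E : k' a = 0 by rewrite /k'; case: asboolP.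
  by rewrite E -/(j a) j0 // star_hom0.
(* The images of [pcp_elt] form a *-subalgebra, so every expression has its value among them. *)
have ap (t : term R (pcp R G)) : exists2 a, elt a & ev j t = j a.
  elim: t => [a|||t [a ea ta] s [b eb sb]|c t [a ea ta]|t [a ea ta] s [b eb sb]|t [a ea ta]] /=;
      rewrite ?ta ?sb.
  - have [ea|na] := pselect (elt a); first by exists a.
    by exists (mono (fun=> 0) 1%g); [exact/elt_mono/ideal0|rewrite (hom0 jP) j0].
  - by exists (mono (fun=> 0) 1%g); [exact/elt_mono/ideal0|rewrite (hom0 jP)].
  - by exists (@pcp_one R G X); [exact: elt_one|rewrite (pcp_hom1 jP)].
  - by exists (pcp_add a b); [exact: elt_add|rewrite (pcp_homD jP)].
  - by exists (pcp_scale c a); [exact: elt_scale|rewrite (pcp_homZ jP)].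
  - by exists (pcp_mul a b); [exact: elt_mul|rewrite (pcp_homM jP)].
  - by exists (pcp_star a); [exact: elt_star|rewrite (pcp_homS jP)].
move=> xi eps e0; have [t Ht] := @uemb_dense _ _ K M Kb xi _ e0; have [a ea aE] := ap t.
by exists a; last exact: (eq_ind _ (fun z => nrm (xi - z) < eps) Ht _ aE).
Qed.

End PartialCrossedProductTheory.

(** * The boundary spectrum *)

Section Boundary.
Variables (S : countType) (e : rel S).
Hypothesis e_sym : symmetric e.
Hypothesis e_irr : irreflexive e.
Local Notation G := (raag e).
Local Notation P := (@raag_pos S e).
Local Notation X0 := (@X0 S e).
Local Notation X := (@boundary S e).
Local Notation pg := (@pg S e).
Implicit Types (w : subsets G).

Lemma boundaryE w : X w <-> forall l, exists2 w', X0 w' & agree l w w'.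
Proof.
split=> [[_ /closure_agree]//|H]; split; last exact/closure_agree.
split.
- have [w' X0w' Hw] := H [:: 1%g]; rewrite (Hw 1%g) ?mem_head //.
  by case: X0w'.
- move=> x p wx Pp; have [w' X0w' Hw] := H [:: x; (x * p^-1)%g].
  rewrite Hw ?inE ?eqxx ?orbT //; have [_ her _] := X0_nica e_sym e_irr X0w'.
  by apply: her => //; rewrite -Hw ?mem_head.
- move=> x y wx wy; have [w1 X0w1 Hw1] := H [:: x; y].
  have [_ _ /(_ x y)] := X0_nica e_sym e_irr X0w1.
  rewrite -!Hw1 ?inE ?eqxx ?orbT // => /(_ wx wy)[z zj _].
  (* The join z found in w1 may lie outside the coordinates compared so far; w2 agrees with w at z
     too, and joins are unique. *)
  have [w2 X0w2 Hw2] := H [:: x; y; z].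
  have [_ _ /(_ x y)] := X0_nica e_sym e_irr X0w2.
  rewrite -!Hw2 ?inE ?eqxx ?orbT // => /(_ wx wy)[z' zj' wz'].
  have zz := is_join_unique e_sym e_irr zj zj'.
  by exists z => //; rewrite Hw2 ?inE ?eqxx ?orbT // zz.
Qed.

Lemma X0_boundary w : X0 w -> X w.
Proof. by move=> wX; apply/boundaryE => l; exists w. Qed.

Lemma boundary_closed : closed X.
Proof.
apply: closed_agree => w H; apply/boundaryE => l.
have [w' /boundaryE /(_ l)[w'' X0w'' H2] H1] := H l.
by exists w'' => //; exact: agree_trans H1 H2.
Qed.

Lemma boundary1 w : X w -> w 1%g. Proof. by case=> -[]. Qed.

Lemma boundary_down w x y : X w -> w y -> qle P x y -> w x.
Proof. by case=> -[_ her _] _; exact: hereditary_down her. Qed.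

Lemma boundary_translate t w : X w -> w t^-1%g -> X (translate t w).
Proof.
move=> /boundaryE H wt; apply/boundaryE => l.
have [w' X0w' Hw] := H (t^-1 :: [seq t^-1 * h | h <- l])%g.
exists (translate t w').
  by apply: translate_X0 => //; rewrite -Hw ?mem_head.
by move=> h hl; rewrite !translateE; apply: Hw; rewrite inE map_f ?orbT.
Qed.

Lemma boundary_component w (F : {fset S}) : X w -> opp_component e [set` F] ->
  exists2 s, s \in F & w (raag_gen e s).
Proof.
move=> /boundaryE H Fc; have [w' X0w' Hw] := H [seq raag_gen e s | s <- F].
have [s sF ws] := X0_component e_sym e_irr X0w' Fc.
by exists s => //; rewrite Hw // map_f.
Qed.

Lemma boundary_join w x y : X w -> w x -> w y ->
  exists2 z, is_join P x y z & w z.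
Proof. by case=> -[_ _ dw] _; exact: dw. Qed.

End Boundary.

(** * The boundary relations in the crossed product *)

Section BoundaryCharacters.
Variables (R : realType) (S : countType) (e : rel S).
Hypothesis e_sym : symmetric e.
Hypothesis e_irr : irreflexive e.
Local Notation G := (raag e).
Local Notation P := (@raag_pos S e).
Local Notation X := (@boundary S e).
Local Notation pg := (@pg S e).
Local Notation gen := (raag_gen e).
Local Notation mono := (@pcp_mono R G).
Local Notation chi := (@pcp_char R G X).
Local Notation ideal := (@pcp_ideal R G X).
Implicit Types (w : subsets G) (r t h : G) (u v : seq S).

Let X1 := @boundary1 S e.
Let Xt := boundary_translate e_sym e_irr.

Lemma chi_mul r t w : chi r w * chi t (translate r^-1%g w) = chi r w * chi (r * t)%g w.
Proof.
have [Xw|nXw] := pselect (X w); last first.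
  by rewrite (ideal_out (ideal_char _ _ r)) ?mul0r // => -[].
rewrite [chi r w]charE //; case wr : (w r); rewrite ?mul0r // !mul1r.
by rewrite charE; [rewrite charE // translateE invgK|exact: XtV Xt _ _ Xw wr].
Qed.

Lemma chi_star t w : chi t (translate t w) = chi t^-1%g w.
Proof.
rewrite /pcp_char; congr (nat_of_bool _)%:R; apply/asboolP/asboolP.
  case=> Xtw tw; have Xw : X w by have := XtV Xt Xtw tw; rewrite translateK.
  by split=> //; have := X1 Xtw; rewrite translateE mulg1.
by case=> Xw wt; split; [exact: Xt|rewrite translateE mulVg X1].
Qed.

Lemma chi_neg u w : X w -> chi (pg u)^-1%g w = 1.
Proof.
move=> Xw; rewrite charE // (boundary_down Xw (X1 Xw)) //.
by apply/qleP => //; exists u; rewrite mulVg.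
Qed.

(** A member of X contains 1, hence together with t the join of 1 and t. Translation by r allows
    this join to be computed among positive elements. *)
Lemma chi_join1 r t h w : is_join P (r * 1)%g (r * t)%g (r * h)%g ->
  chi t w = chi t w * chi h w.
Proof.
move=> /(is_join_mull r^-1%g); rewrite !mulgA mulVg !mul1g => H.
have [Xw|nXw] := pselect (X w); last first.
  by rewrite (ideal_out (ideal_char _ _ t)) ?mul0r // => -[].
rewrite !charE //; case wt : (w t); rewrite ?mul0r // mul1r.
have [z zj wz] := boundary_join Xw (X1 Xw) wt.
by rewrite (is_join_unique e_sym e_irr H zj) wz.
Qed.

Section Hom.
Variables (D : cstarType R) (k : pcp R G -> D).
Hypothesis kP : pcp_hom X k.
Local Notation V t := (k (mono (chi t) t)).

Lemma hom_chi_mul r t : V r * V t = k (mono (fun w => chi r w * chi (r * t)%g w) (r * t)%g).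
Proof.
rewrite (homM kP) //; try exact: ideal_char.
by congr (k (mono _ _)); apply/funext => w; exact: chi_mul.
Qed.

Lemma hom_chi_star t : star (V t) = V t^-1%g.
Proof.
rewrite (homS kP); last exact: ideal_char.
congr (k (mono _ _)); apply/funext => w; rewrite chi_star.
by rewrite /pcp_char conjC_nat.
Qed.

Lemma hom_chi1 : V 1%g = 1. Proof. exact: (pcp_hom1 kP). Qed.

(** In general the product [V r * V t] keeps a factor [chi r]. It is 1 on X if r is the inverse of a
    positive element; in [hom_pos] the corresponding factor is absorbed because t lies below its
    product with [pg u]. *)
Lemma hom_neg u t : V (pg u)^-1%g * V t = V ((pg u)^-1 * t)%g.
Proof.
rewrite hom_chi_mul; congr (k (mono _ _)); apply/funext => w.
have [Xw|nXw] := pselect (X w); first by rewrite chi_neg // mul1r.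
by rewrite !(ideal_out (ideal_char _ _ _)) ?mul0r // => -[].
Qed.

Lemma hom_pos u t : V t * V (pg u) = V (t * pg u)%g.
Proof.
rewrite hom_chi_mul; congr (k (mono _ _)); apply/funext => w.
have [Xw|nXw] := pselect (X w); last first.
  by rewrite !(ideal_out (ideal_char _ _ _)) ?mul0r // => -[].
rewrite !charE //; case wtu : (w (t * pg u)%g); last by rewrite mulr0.
by rewrite (boundary_down Xw wtu) ?mulr1 //; apply/qleP => //; exists u.
Qed.

Definition hom_gen s : D := V (gen s).

Lemma hom_gen_star (s t : S) : star (hom_gen s) * hom_gen t = V ((gen s)^-1 * gen t)%g.
Proof. by rewrite hom_chi_star -pg_gen hom_neg. Qed.

Lemma hom_gen_relations : boundary_relations e hom_gen.
Proof.
split.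
- by move=> s; rewrite hom_gen_star mulVg hom_chi1.
- move=> s t st.
  have stE : (gen s * gen t = gen t * gen s)%g.
    rewrite -!pg_gen -!pg_cat; apply/(pgP e_sym e_irr).
    by apply: (@ScongSwap _ _ [::]); rewrite /dep st.
  split; first by rewrite /hom_gen -!pg_gen !hom_pos !pg_gen stE.
  rewrite hom_gen_star hom_chi_star hom_chi_mul.
  have tsE : (gen t * (gen s)^-1 = (gen s)^-1 * gen t)%g.
    by apply: (mulgI (gen s)); rewrite mulgA stE mulgK mulgA mulgV mul1g.
  rewrite tsE; congr (k (mono _ _)); apply/funext => w.
  (* A w with s^-1 t contains the join of 1 and s^-1 t, which is t since s and t are distinct and
     commute; so the factor [chi (gen t)] changes nothing. *)
  rewrite [LHS](@chi_join1 (gen s) _ (gen t)) 1?mulrC //.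
  rewrite mulg1 mulgA mulgV mul1g.
  have : res e [:: s] [:: t] = Some ([:: t], [:: s]).
    by rewrite /= andbF orbF st; case: eqP => // ts; rewrite ts e_irr in st.
  by move=> /(res_is_join e_sym e_irr)[+ _]; rewrite !pg_gen (pg_cat _ [:: s] [:: t]) !pg_gen.
- move=> s t st nst; rewrite hom_gen_star -(hom0 kP ((gen s)^-1 * gen t)%g).
  congr (k (mono _ _)); apply/funext => w; apply: contrapT.
  move=> /(ideal_supp (ideal_char _ _ _))[Xw wst].
  (* A w with s^-1 t contains an upper bound z of 1 and s^-1 t; then s z would bound s and t, which
     have no common multiple. *)
  have [z [z1 z2 _] wz] := boundary_join Xw (X1 Xw) wst.
  have z1' : qle P (gen s) (gen s * z)%g by rewrite -{1}[gen s]mulg1; apply/qle_mull.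
  have z2' : qle P (gen t) (gen s * z)%g.
    by move: z2 => /(qle_mull (gen s)); rewrite mulgA mulgV mul1g.
  have [a [b]] := @res_ub S e e_sym e_irr [:: s] [:: t] _ z1' z2'.
  by rewrite /= /dep (negbTE st) (negbTE nst).
- move=> F Fc.
  have E s : 1 - hom_gen s * star (hom_gen s) =
      k (mono (fun w => chi 1%g w - chi 1%g w * chi (gen s) w) 1%g).
    rewrite /hom_gen hom_chi_star hom_chi_mul mulgV.
    have If : ideal 1%g (fun w => chi (gen s) w * chi 1%g w).
      by apply: idealMl; [exact: ideal_cont (ideal_char _ _ _)|exact: ideal_char].
    rewrite -{1}hom_chi1 -scaleN1r -(homZ kP) // -(homD kP) //; last 2 first.
    + exact: ideal_char.
    + exact: idealZ.
    by congr (k (mono _ _)); apply/funext => w; rewrite mulN1r [chi (gen s) w * _]mulrC.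
  have key (l : seq S) : \prod_(s <- l) (1 - hom_gen s * star (hom_gen s)) =
      k (mono (fun w => chi 1%g w * \prod_(s <- l) (1 - chi (gen s) w)) 1%g) /\
      ideal 1%g (fun w => chi 1%g w * \prod_(s <- l) (1 - chi (gen s) w)).
    have Is s : ideal 1%g (fun w => chi 1%g w - chi 1%g w * chi (gen s) w).
      have -> : (fun w => chi 1%g w - chi 1%g w * chi (gen s) w) =
          (fun w => (1 + (-1) * chi (gen s) w) * chi 1%g w).
        by apply/funext => w; ring.
      apply: idealMl; last exact: ideal_char.
      apply: cylcontD; first exact: cylcont_cst.
      apply: cylcontM; first exact: cylcont_cst.
      exact: ideal_cont (ideal_char _ _ _).
    elim: l => [|s l [IH1 IH2]].
      have -> : (fun w => chi 1%g w * \prod_(s <- [::]) (1 - chi (gen s) w)) = chi 1%g.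
        by apply/funext => w; rewrite big_nil mulr1.
      by rewrite big_nil hom_chi1; split=> //; exact: ideal_char.
    have -> : (fun w => chi 1%g w * \prod_(s <- s :: l) (1 - chi (gen s) w)) =
       (fun w => (chi 1%g w - chi 1%g w * chi (gen s) w) *
          (chi 1%g w * \prod_(s <- l) (1 - chi (gen s) w))).
      apply/funext => w; rewrite big_cons -{2}[chi 1%g w]mulr1 -mulrBr mulrACA.
      congr (_ * _); have [Xw|nXw] := pselect (X w); first by rewrite char1E // mul1r.
      by rewrite !(ideal_out (ideal_char _ _ 1%g)) ?mul0r // => -[].
    rewrite big_cons E IH1 (homM1 kP) //; split=> //.
    by apply: idealMl => //; exact: ideal_cont (Is s).
  rewrite (key F).1 -(hom0 kP 1%g); congr (k (mono _ _)); apply/funext => w.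
  have [Xw|nXw] := pselect (X w); last first.
    by rewrite !(ideal_out (ideal_char _ _ 1%g)) ?mul0r // => -[].
  have [s sF ws] := boundary_component e_sym e_irr Xw Fc.
  by rewrite (big_rem s) //= charE // charE // ws subrr mul0r mulr0.
Qed.

End Hom.

End BoundaryCharacters.

(** * The regular representation *)

Section RegularRepresentation.
Variables (R : realType) (S : countType) (e : rel S).
Hypothesis e_sym : symmetric e.
Hypothesis e_irr : irreflexive e.
Local Notation G := (raag e).
Local Notation X := (@boundary S e).
Local Notation X0 := (@X0 S e).
Local Notation pg := (@pg S e).
Local Notation ideal := (@pcp_ideal R G X).
Local Notation elt := (@pcp_elt R G X).
Implicit Types (w : subsets G) (r s t g : G) (u v : seq S) (a b : pcp R G).

(** The representation on functions of maximal w, tensored with the left regular representation of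
    G. The group coordinate grades the space, which is what [rnrm_graded] rests on. *)
Let I : choiceType := (subsets G * G)%type.
Let Q : set I := fun i => X0 i.1.
Let X1 := @boundary1 S e.
Let Xt := boundary_translate e_sym e_irr.
Let Xc := boundary_closed e_sym e_irr.

Definition gshift t (i : I) : I := (translate t i.1, (t * i.2)%g).

Lemma gshiftM s t i : gshift s (gshift t i) = gshift (s * t)%g i.
Proof. by rewrite /gshift /= translateM mulgA. Qed.

Lemma gshiftK t : cancel (gshift t) (gshift t^-1%g).
Proof. by case=> w g; rewrite gshiftM mulVg /gshift translate1 mul1g. Qed.

Lemma gshiftKV t : cancel (gshift t^-1%g) (gshift t).
Proof. by case=> w g; rewrite gshiftM mulgV /gshift translate1 mul1g. Qed.

Implicit Types x y : hsp R Q.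

Section Monomial.
Variables (t : G) (f : subsets G -> R[i]).
Hypothesis If : ideal t f.

Let bnd := cid (ideal_bounded Xc If).

Lemma mono_bound_ge0 : 0 <= projT1 bnd. Proof. by case: (projT2 bnd). Qed.
Lemma mono_boundP (i : I) : cn (f i.1) <= projT1 bnd.
Proof. by case: (projT2 bnd) => _; exact. Qed.

Lemma mono_support (i : I) : f i.1 <> 0 -> (Q i <-> Q (gshift t^-1%g i)).
Proof.
move=> /(ideal_supp If)[Xw wt]; split=> /= H.
  by apply: translate_X0 => //; rewrite invgK.
rewrite /Q -(translateKV t i.1); apply: translate_X0 => //.
by rewrite translateE mulVg X1.
Qed.

Definition mono_op : bop (@hip R I Q) :=
  bshift (gshiftK t) (gshiftKV t) mono_bound_ge0 mono_boundP mono_support.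

Lemma mono_opA x (i : I) : ba mono_op x i = ((f (translate t i.1))^*)%R * x (gshift t i).
Proof. by []. Qed.

End Monomial.

Definition act a x (i : I) : R[i] := \sum_(t \in [set: G]) a t i.1 * x (gshift t^-1%g i).

Lemma actE a x i l : uniq l -> (forall t, t \notin l -> a t = fun=> 0) ->
  act a x i = \sum_(t <- l) a t i.1 * x (gshift t^-1%g i).
Proof.
move=> ul Hl; rewrite /act (fsbigE l) //.
  by rewrite big_mkcond; apply: eq_bigr => s _; rewrite in_setT.
by move=> s _ sl; rewrite (Hl s sl) mul0r.
Qed.

Lemma elt_op a : elt a -> exists T : bop (@hip R I Q),
  forall x i, bf T x i = act a x i /\ ba T x i = act (pcp_star a) x i.
Proof.
move=> /eltP[[l [ul Hl]] Ia]; exists (bsum l (fun t => mono_op (Ia t))) => x i.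
split; first by rewrite bsumE (actE _ _ ul Hl).
rewrite (@actE _ _ _ [seq t^-1 | t <- l]%g); last 2 first.
- by rewrite map_inj_uniq //; exact: invg_inj.
- move=> t tl; apply/funext => w; rewrite /pcp_star /pcp_alpha Hl ?conjC0 //.
  by apply: contra tl => tl; apply/mapP; exists t^-1%g; rewrite ?invgK.
rewrite big_map; elim: l {ul Hl} => [|t l IH]; first by rewrite !big_nil.
rewrite big_cons -IH [LHS]hvD; congr (_ + _).
by rewrite mono_opA /pcp_star /pcp_alpha !invgK.
Qed.

Definition reg_op a (ea : elt a) := projT1 (cid (elt_op ea)).

Lemma reg_opE a (ea : elt a) x i : bf (reg_op ea) x i = act a x i.
Proof. by case: (projT2 (cid (elt_op ea)) x i). Qed.

Lemma reg_opA a (ea : elt a) x i : ba (reg_op ea) x i = act (pcp_star a) x i.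
Proof. by case: (projT2 (cid (elt_op ea)) x i). Qed.

Definition regular : cstarType R := operators (@hip_lin R I Q) (@hip_conj R I Q) (@hip_ge0 R I Q).
Local Notation emb := (@oemb _ _ _ (@hip_lin R I Q) (@hip_conj R I Q) (@hip_ge0 R I Q)).

Definition regrep a : regular := if pselect (elt a) is left ea then emb (reg_op ea) else 0.

Lemma regrepE a (T : bop (@hip R I Q)) : elt a -> (forall x i, bf T x i = act a x i) ->
  regrep a = emb T.
Proof.
move=> ea HT; rewrite /regrep; case: pselect => // ea'; apply: oemb_eq => x.
by apply: hsp_eq => i; rewrite reg_opE HT.
Qed.

Lemma regrep_op a (ea : elt a) : regrep a = emb (reg_op ea).
Proof. by apply: regrepE => // x i; rewrite reg_opE. Qed.

Lemma elt_cover2 a b : elt a -> elt b -> exists l, [/\ uniq l,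
  forall t, t \notin l -> a t = fun=> 0 & forall t, t \notin l -> b t = fun=> 0].
Proof.
move=> /eltP[[l [_ Hl]] _] /eltP[[m [_ Hm]] _]; exists (undup (l ++ m)).
by split; rewrite ?undup_uniq // => t; rewrite mem_undup mem_cat negb_or => /andP[/Hl ? /Hm].
Qed.

Lemma act_mul a b x y i : elt a -> elt b -> (forall j, y j = act b x j) ->
  act (pcp_mul a b) x i = act a y i.
Proof.
move=> ea eb yE.
have /eltP[[l [ul Hl]] _] := ea; have /eltP[[m [um Hm]] _] := eb.
pose T := undup [seq s * t | s <- l, t <- m]%g.
have HT s r : s \in l -> r \notin T -> (s^-1 * r)%g \notin m.
  move=> sl; apply: contra => rm; rewrite mem_undup; apply/allpairsP.
  by exists (s, s^-1 * r)%g; rewrite /= mulgA mulgV mul1g.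
rewrite (actE _ _ ul Hl) (@actE _ _ _ T) ?undup_uniq //; last first.
  move=> r rT; apply/funext => w; rewrite (pcp_mulE _ _ _ ul Hl) big_seq big1 // => s sl.
  by rewrite (Hm _ (HT _ _ sl rT)) mulr0.
under eq_bigr => r _ do rewrite (pcp_mulE _ _ _ ul Hl) mulr_suml.
rewrite exchange_big /= big_seq [RHS]big_seq; apply: eq_bigr => s sl.
under eq_bigr => r _ do rewrite -mulrA.
rewrite -mulr_sumr; congr (_ * _); rewrite yE /act.
rewrite (@reindex_fsbigT _ _ _ _ _ (fun r => s^-1 * r)%g) /=; last first.
  by exists (fun r => s * r)%g => r; rewrite mulgA ?mulgV ?mulVg mul1g.
rewrite (fsbigE T) ?undup_uniq //=; last first.
  by move=> r _ rT; rewrite (Hm _ (HT _ _ sl rT)) mul0r.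
rewrite [RHS]big_mkcond; apply: eq_bigr => r _; rewrite in_setT.
by rewrite gshiftM invgM invgK -mulgA mulgV mulg1.
Qed.

Lemma regrep_hom : pcp_hom X regrep.
Proof.
split.
- move=> a b ea eb; rewrite (regrep_op ea) (regrep_op eb) -oembD.
  apply: regrepE; first exact: elt_add.
  move=> x i; rewrite [LHS]hvD !reg_opE.
  have [l [ul Ha Hb]] := elt_cover2 ea eb.
  rewrite !(@actE _ _ _ l) //; last first.
    by move=> t tl; apply/funext => w; rewrite /pcp_add Ha // Hb // addr0.
  by rewrite -big_split; apply: eq_bigr => t _; rewrite /pcp_add mulrDl.
- move=> c a ea; rewrite (regrep_op ea) -oembZ.
  apply: regrepE; first exact: elt_scale.
  move=> x i; rewrite [LHS]hvZ !reg_opE.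
  have /eltP[[l [ul Ha]] _] := ea.
  rewrite !(@actE _ _ _ l) //; last first.
    by move=> t tl; apply/funext => w; rewrite /pcp_scale Ha // mulr0.
  by rewrite mulr_sumr; apply: eq_bigr => t _; rewrite /pcp_scale mulrA.
- move=> a b ea eb; rewrite (regrep_op ea) (regrep_op eb) -oembM.
  apply: regrepE; first exact: elt_mul.
  by move=> x i; rewrite /= reg_opE (@act_mul a b x (bf (reg_op eb) x) i ea eb) // => j; rewrite reg_opE.
- move=> a ea; rewrite (regrep_op ea) -oembS.
  apply: regrepE; first exact: elt_star.
  by move=> x i; rewrite /= reg_opA.
- rewrite (regrepE (T := bid _)) ?oemb1 //; first exact: elt_one.
  move=> x i; rewrite (@actE _ _ _ [:: 1%g]) //; last first.
    by move=> t; rewrite inE /pcp_one /pcp_mono => /negbTE ->.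
  rewrite big_seq1 /pcp_one /pcp_mono eqxx invg1.
  have -> : gshift 1%g i = i by case: i => w g; rewrite /gshift translate1 mul1g.
  have [xi|xi] := eqVneq (x i) 0; first by rewrite /= xi mulr0.
  have Xi : X i.1 by apply: (X0_boundary e_sym e_irr); exact: (@hv_in _ _ _ x i (elimN eqP xi)).
  by rewrite (char1E R X1 Xi) mul1r.
Qed.

End RegularRepresentation.

Lemma hq_partial (R : realType) (I : choiceType) (Q : set I) (x : hsp R Q) (B : {fset I}) :
  \sum_(i <- B) cn (x i) ^+ 2 <= hq (@hip R I Q) x.
Proof.
have [A HA] := hv_fin x.
rewrite (@hq_sum _ _ _ _ (A `|` B)%fset); last first.
  by move=> i; rewrite inE negb_or => /andP[/HA].
rewrite [leRHS](bigID (mem B)) /= -[leLHS]addr0; apply: lerD; last first.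
  by apply: sumr_ge0 => i _; rewrite exprn_ge0 ?cn_ge0.
rewrite -[leRHS]big_filter le_eqVlt; apply/orP; left; apply/eqP.
apply: perm_big; apply: uniq_perm; rewrite ?filter_uniq ?finmap.fset_uniq // => i.
by rewrite mem_filter !inE; case: (i \in B); rewrite ?orbT.
Qed.

Section RepresentedSums.
Variables (R : realType) (S : countType) (e : rel S).
Hypothesis e_sym : symmetric e.
Hypothesis e_irr : irreflexive e.
Local Notation G := (raag e).
Local Notation X0 := (@X0 S e).
Local Notation pg := (@pg S e).
Local Notation chi := (@pcp_char R G (@boundary S e)).
Local Notation regular := (regular R e).
Local Notation regrep := (@regrep R S e e_sym e_irr).
Variables (A : cstarType R) (V : S -> A) (pi : A -> regular).
Hypothesis piP : star_hom pi.
Hypothesis piV : forall s, pi (V s) = hom_gen regrep s.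
Local Notation fterm := (R[i] * (seq S * seq S))%type.
Local Notation fsum := (fsum R S).
Implicit Types (u v : seq S) (t : fterm) (x y z : fsum) (w : subsets G).

Let I : choiceType := (subsets G * G)%type.
Let Q : set I := fun i => X0 i.1.
Implicit Types xi : hsp R Q.
Local Notation emb := (@oemb _ _ _ (@hip_lin R I Q) (@hip_conj R I Q) (@hip_ge0 R I Q)).
Local Notation hn := (hn (@hip R I Q)).
Local Notation hq := (hq (@hip R I Q)).

Let kP := @regrep_hom R S e e_sym e_irr.

Definition deg t : G := (pg t.2.1 * (pg t.2.2)^-1)%g.

Definition sum_act x xi (i : I) : R[i] :=
  \sum_(t <- x | i.1 (pg t.2.1)) t.1 * xi (gshift (deg t)^-1%g i).

Lemma pi_vw u : pi (vw V u) = regrep (@pcp_mono R G (chi (pg u)) (pg u)).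
Proof.
elim: u => [|s u IH]; first by rewrite vw_nil (star_hom1 piP) pg_nil hom_chi1.
by rewrite vw_cons (star_homM piP) IH piV /hom_gen (hom_pos e_sym e_irr kP) -pg_cons.
Qed.

Lemma pi_pair u v : exists T, pi (vw V u * star (vw V v)) = emb T /\
  forall xi i, X0 i.1 -> bf T xi i =
    if i.1 (pg u) then xi (gshift (pg u * (pg v)^-1)^-1%g i) else 0.
Proof.
rewrite (star_homM piP) (star_homS piP) !pi_vw (hom_chi_star e_sym e_irr kP).
rewrite (hom_chi_mul e_sym e_irr kP).
set g := (pg u / pg v)%g; set f := fun w => _.
have If : pcp_ideal (@boundary S e) g f.
  by apply: idealMl; [exact: ideal_cont (ideal_char _ _ _)|exact: ideal_char].
have em := elt_mono If; exists (reg_op e_sym e_irr em); rewrite (regrep_op _ _ em); split=> // xi i Xi.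
rewrite reg_opE (@actE R S e _ _ _ [:: g]) //; last first.
  by move=> t; rewrite inE /pcp_mono => /negbTE ->.
have Xb : boundary e i.1 by exact: X0_boundary.
rewrite big_seq1 /pcp_mono eqxx /f !charE //; case: ifP => [iu|_]; last by rewrite !mul0r.
(* [i.1] contains u, hence also u v^-1, which lies below u. *)
rewrite (boundary_down Xb iu) ?mul1r //; apply/qleP => //; exists v.
by rewrite /g -mulgA mulVg mulg1.
Qed.

Lemma pi_fval x : exists T, pi (fval V x) = emb T /\
  forall xi i, X0 i.1 -> bf T xi i = sum_act x xi i.
Proof.
elim: x => [|[c [u v]] x [T [IH1 IH2]]].
  exists (bzero (@hip_lin R I Q) (@hip_conj R I Q) (@hip_ge0 R I Q)).
  by rewrite fval_nil (star_hom0 piP) oemb0; split=> // xi i _; rewrite /sum_act big_nil.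
have [T' [E1 E2]] := pi_pair u v.
exists (badd (@hip_lin R I Q) (@hip_conj R I Q) (@hip_ge0 R I Q) (bscale (@hip_lin R I Q) (@hip_conj R I Q) (@hip_ge0 R I Q) c T') T).
split.
  rewrite oembD oembZ -E1 -IH1 -(star_homZ piP) -(star_homD piP).
  by rewrite /fval big_cons.
move=> xi i Xi; rewrite [LHS]hvD [_ i]hvZ E2 // IH2 // /sum_act big_cons /=.
by case: ifP => // _; rewrite mulr0 add0r.
Qed.

Definition fop x : bop (@hip R I Q) := projT1 (cid (pi_fval x)).

Lemma pi_fop x : pi (fval V x) = emb (fop x).
Proof. by case: (projT2 (cid (pi_fval x))). Qed.

Lemma fopE x xi i : X0 i.1 -> bf (fop x) xi i = sum_act x xi i.
Proof. by case: (projT2 (cid (pi_fval x))) => _; exact. Qed.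

Definition rnrm x : R := nrm (pi (fval V x)).

Lemma rnrm_ge0 x : 0 <= rnrm x. Proof. exact: nrm_ge0. Qed.

Lemma hn_fop x xi : hn (bf (fop x) xi) <= rnrm x * hn xi.
Proof. by rewrite /rnrm pi_fop; exact: nrm_oemb_ge. Qed.

Lemma hq_fop x xi : hq (bf (fop x) xi) <= rnrm x ^+ 2 * hq xi.
Proof.
rewrite -!(hn_sqr (@hip_ge0 R I Q)) -exprMn.
by rewrite lerXn2r ?nnegrE ?mulr_ge0 ?hn_ge0 ?rnrm_ge0 // hn_fop.
Qed.

Lemma rnrm_le x (c : R) : 0 <= c -> (forall xi, hq (bf (fop x) xi) <= c ^+ 2 * hq xi) ->
  rnrm x <= c.
Proof.
move=> c0 H; rewrite /rnrm pi_fop; apply: nrm_oemb_le => // xi.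
rewrite -(@ler_pXn2r _ 2) ?nnegrE ?mulr_ge0 ?hn_ge0 // exprMn.
by rewrite !(hn_sqr (@hip_ge0 R I Q)); exact: H.
Qed.

Lemma oemb_inj (T T' : bop (@hip R I Q)) : emb T = emb T' -> forall xi i, bf T xi i = bf T' xi i.
Proof.
move=> E xi i.
pose N' := bscale (@hip_lin R I Q) (@hip_conj R I Q) (@hip_ge0 R I Q) (-1) T'.
pose D := badd (@hip_lin R I Q) (@hip_conj R I Q) (@hip_ge0 R I Q) T N'.
have D0 : nrm (emb D) = 0 by rewrite oembD oembZ E scaleN1r subrr nrm0.
have := @nrm_oemb_ge _ _ _ (@hip_lin R I Q) (@hip_conj R I Q) (@hip_ge0 R I Q) D xi.
rewrite D0 mul0r => H0.
have Hq : hq (bf D xi) <= 0.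
  rewrite -(hn_sqr (@hip_ge0 R I Q)); have := hn_ge0 (@hip R I Q) (bf D xi) => H1.
  by have -> : hn (bf D xi) = 0 by [apply/eqP; rewrite eq_le H0]; rewrite expr0n.
have := le_trans (hq_coord (bf D xi) i) Hq; rewrite [bf D xi i]hvD hvZ mulN1r => H2.
apply/eqP; rewrite -subr_eq0; apply/eqP/cn_eq0/eqP.
by rewrite -sqrf_eq0 eq_le H2 sqr_ge0.
Qed.

Section Grading.
Variables (K : eqType) (kap : G -> K) (dv : K -> K -> K).
Hypothesis kapE : forall g h, kap (g^-1 * h)%g = dv (kap g) (kap h).
Hypothesis dv_inj : forall a b c, dv a c = dv b c -> a = b.

(** Only a division on K is assumed, so that K can be the group itself as well as the integers that
    a letter degree takes as values. *)
Definition graded k x : fsum := [seq t <- x | kap (deg t) == k].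

Definition hpart (k : K) xi : hsp R Q := hrestr (fun i : I => kap i.2 == k) xi.

Lemma fop_graded k x xi i : X0 i.1 ->
  bf (fop (graded k x)) xi i = bf (fop x) (hpart (dv k (kap i.2)) xi) i.
Proof.
move=> Xi; rewrite !fopE // /sum_act big_filter_cond [LHS]big_mkcond [RHS]big_mkcond /=.
apply: eq_bigr => t _; rewrite kapE.
have -> : (dv (kap (deg t)) (kap i.2) == dv k (kap i.2)) = (kap (deg t) == k).
  by apply/eqP/eqP => [/dv_inj|->].
by case: (kap (deg t) == k); case: (i.1 _) => //=; rewrite mulr0.
Qed.

(* The regular representation is graded by kap: the part of x of degree k maps the
   part of xi of each degree to a part of the image of the latter under x. *)
Lemma rnrm_graded k x : rnrm (graded k x) <= rnrm x.
Proof.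
apply: rnrm_le => [|xi]; first exact: rnrm_ge0.
have [B HB] := hv_fin (bf (fop (graded k x)) xi); have [C HC] := hv_fin xi.
pose J := undup [seq kap i.2 | i <- C].
rewrite (hq_sum HB).
(* At a given i only the part of xi of degree [dv k (kap i.2)] contributes; if this degree is not in
   J, that part is 0. *)
have H1 i : cn (bf (fop (graded k x)) xi i) ^+ 2 <=
    \sum_(j <- J) cn (bf (fop x) (hpart j xi) i) ^+ 2.
  have J0 : 0 <= \sum_(j <- J) cn (bf (fop x) (hpart j xi) i) ^+ 2.
    by apply: sumr_ge0 => j _; rewrite exprn_ge0 ?cn_ge0.
  have [Xi|nXi] := pselect (X0 i.1); last first.
    have -> : bf (fop (graded k x)) xi i = 0.
      by apply: contrapT => /(@hv_in _ _ _ _ i).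
    by rewrite cn0 expr0n.
  rewrite fop_graded //; set j := dv k _.
  have [jJ|jJ] := boolP (j \in J).
    rewrite (big_rem j) //= lerDl; apply: sumr_ge0 => j' _.
    by rewrite exprn_ge0 ?cn_ge0.
  have -> : hpart j xi = 0.
    apply: hsp_eq => i' /=; case: eqP => // E; apply: HC; apply: contra jJ => i'C.
    by rewrite mem_undup -E; apply/mapP; exists i'.
  by rewrite bf0 hv0 cn0 expr0n.
apply: (le_trans (ler_sum _ (fun i _ => H1 i))); rewrite exchange_big /=.
have H2 j : \sum_(i <- B) cn (bf (fop x) (hpart j xi) i) ^+ 2 <=
    rnrm x ^+ 2 * \sum_(i <- C) (if kap i.2 == j then cn (xi i) ^+ 2 else 0).
  apply: le_trans (hq_partial _ _) _; apply: le_trans (hq_fop _ _) _.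
  rewrite ler_wpM2l ?sqr_ge0 // (@hq_sum _ _ _ _ C); last by move=> i /HC /= ->; case: ifP.
  by apply: ler_sum => i _ /=; case: ifP; rewrite // cn0 expr0n.
apply: (le_trans (ler_sum _ (fun j _ => H2 j))); rewrite -mulr_sumr (hq_sum HC).
rewrite ler_wpM2l ?sqr_ge0 // exchange_big /= big_seq [leRHS]big_seq; apply: ler_sum => i iC.
rewrite -big_mkcond /= (big_rem (kap i.2)) /=; last by rewrite mem_undup; apply/mapP; exists i.
rewrite eqxx big_seq_cond big1 ?addr0 // => j /andP[+ /eqP E].
by rewrite -E mem_rem_uniq ?undup_uniq // inE eqxx.
Qed.

End Grading.

End RepresentedSums.

(** * Amenability *)

(* Opaque to simplification, which would otherwise leave [lia] with several
   forms of the same [count_mem s u]. *)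
Definition lcount (S : eqType) (s : S) (u : seq S) : nat := count_mem s u.

Lemma lcount_cat (S : eqType) (s : S) u v : lcount s (u ++ v) = (lcount s u + lcount s v)%N.
Proof. exact: count_cat. Qed.

Section LetterDegree.
Variables (S : countType) (e : rel S).
Local Notation G := (raag e).
Local Notation pg := (@pg S e).
Implicit Types (s : S) (u v : seq S) (g h : G).

Definition word_degree s (u : seq (S * bool)) : int :=
  (count_mem (s, true) u)%:Z - (count_mem (s, false) u)%:Z.

Lemma word_degree_cat s (u v : seq (S * bool)) :
  word_degree s (u ++ v) = word_degree s u + word_degree s v.
Proof. by rewrite /word_degree ?lcount_cat ?count_cat; lia. Qed.

Lemma word_degree_cong s (u v : seq (S * bool)) : raag_cong e u v -> word_degree s u = word_degree s v.
Proof.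
elim=> {u v} [//|//|u v w _ -> _ ->//|u t b v|u t t' v _].
  rewrite !word_degree_cat; case: b; rewrite /word_degree /= !xpair_eqE ?andbT ?andbF; lia.
rewrite !word_degree_cat; congr (_ + (_ + _)).
by rewrite /word_degree /= !xpair_eqE ?andbT ?andbF; lia.
Qed.

(** The exponent sum of s, a homomorphism from the group to the integers. *)
Definition letter_degree s (g : G) : int := word_degree s (raag_repr g).

Lemma letter_degreeM s g h : letter_degree s (g * h)%g = letter_degree s g + letter_degree s h.
Proof.
by rewrite /letter_degree -word_degree_cat; apply: word_degree_cong; exact: raag_repr_class.
Qed.

Lemma letter_degree1 s : letter_degree s 1%g = 0.
Proof. by have := letter_degreeM s 1%g 1%g; rewrite mulg1; lia. Qed.

Lemma letter_degreeV s g : letter_degree s g^-1%g = - letter_degree s g.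
Proof. by have := letter_degreeM s g^-1%g g; rewrite mulVg letter_degree1; lia. Qed.

Lemma letter_degree_pg s u : letter_degree s (pg u) = (lcount s u)%:Z.
Proof.
elim: u => [|t u IH]; first by rewrite pg_nil letter_degree1.
rewrite pg_cons letter_degreeM IH.
have -> : letter_degree s (raag_gen e t) = (t == s)%:Z.
  rewrite /letter_degree (word_degree_cong s (raag_repr_class e _)).
  by rewrite /word_degree /= !xpair_eqE ?andbT ?andbF; lia.
by rewrite /lcount /= PoszD.
Qed.

End LetterDegree.

Section FiniteSums.
Variables (R : realType) (S : countType) (e : rel S).
Hypothesis e_sym : symmetric e.
Hypothesis e_irr : irreflexive e.
Local Notation G := (raag e).
Local Notation pg := (@pg S e).
Local Notation fterm := (R[i] * (seq S * seq S))%type.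
Local Notation fsum := (fsum R S).
Local Notation deg := (@deg R S e).
Local Notation fmul := (@fmul R S e).
Implicit Types (s : S) (u v : seq S) (t : fterm) (x y z : fsum).

Lemma fmulP x y t : t \in fmul x y -> exists t1 t2 a b,
  [/\ t1 \in x, t2 \in y, res e t1.2.2 t2.2.1 = Some (a, b) &
      t = (t1.1 * t2.1, (t1.2.1 ++ a, t2.2.2 ++ b))].
Proof.
move=> /flattenP[l /mapP[t1 t1x ->]] /flattenP[l' /mapP[t2 t2y ->]].
rewrite /fmul1; case E : (res _ _ _) => [[a b]|] //; rewrite inE => /eqP ->.
by exists t1, t2, a, b.
Qed.

Lemma fstarP x t : t \in fstar x -> exists2 t1, t1 \in x & t = ((t1.1^*)%R, (t1.2.2, t1.2.1)).
Proof. by case/mapP=> t1 t1x ->; exists t1. Qed.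

Lemma deg_fmul x y t : t \in fmul x y -> exists t1 t2,
  [/\ t1 \in x, t2 \in y & deg t = (deg t1 * deg t2)%g].
Proof.
case/fmulP=> t1 [t2 [a [b [t1x t2y ab ->]]]]; exists t1, t2; split=> //.
have [_] := res_is_join e_sym e_irr ab; rewrite /deg /= !pg_cat => E.
have {E} E : (pg a * (pg b)^-1 = (pg t1.2.2)^-1 * pg t2.2.1)%g.
  apply: (mulgI (pg t1.2.2)); apply: (mulIg (pg b)).
  by rewrite !mulgA mulgV mul1g -E -!mulgA mulVg mulg1.
by rewrite invgM !mulgA -(mulgA _ (pg a)) E !mulgA.
Qed.

Lemma deg_fstar x t : t \in fstar x -> exists2 t1, t1 \in x & deg t = (deg t1)^-1%g.
Proof. by case/fstarP=> t1 t1x ->; exists t1 => //; rewrite /deg invgM invgK. Qed.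

Lemma deg1E t : deg t = 1%g <-> pg t.2.1 = pg t.2.2.
Proof.
rewrite /deg; split=> [H|->]; last by rewrite mulgV.
by apply: (mulIg (pg t.2.2)^-1%g); rewrite mulgV.
Qed.

Lemma size_fmul x y : (size (fmul x y) <= size x * size y)%N.
Proof.
rewrite /fmul; elim: x => //= t x IH; rewrite size_cat mulSn leq_add //.
elim: y {IH} => //= t' y IH; rewrite size_cat -add1n leq_add //.
by rewrite /fmul1; case: (res _ _ _) => [[]|].
Qed.

Definition bounded_counts s (m : nat) x :=
  forall t, t \in x -> (lcount s t.2.1 <= m)%N /\ (lcount s t.2.2 <= m)%N.

Lemma res_counts s u v a b : res e u v = Some (a, b) ->
  (lcount s u + lcount s a)%N = maxn (lcount s u) (lcount s v) /\
  (lcount s v + lcount s b)%N = maxn (lcount s u) (lcount s v).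
Proof.
move=> H; have := res_count e_sym e_irr s H; have /scong_perm/permP/(_ (pred1 s)) := res_scong e_sym H.
by rewrite /lcount !count_cat => -> ->.
Qed.

(** Passing to the least common multiple adds at most m letters s to a word. Doubling in each
    squaring keeps the count linear in the exponent 2^r. *)
Lemma bounded_counts_fmul s m x y : bounded_counts s m x -> bounded_counts s m y ->
  bounded_counts s (2 * m) (fmul x y).
Proof.
move=> Bx By t /fmulP[t1 [t2 [a [b [/Bx[? ?] /By[? ?] /(res_counts s)[? ?] ->]]]]] /=.
rewrite ?lcount_cat ?count_cat. lia.
Qed.

Lemma bounded_counts_fstar s m x : bounded_counts s m x -> bounded_counts s m (fstar x).
Proof. by move=> Bx t /fstarP[t1 /Bx[? ?] ->]. Qed.

Lemma bounded_counts_ex s x : exists m, bounded_counts s m x.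
Proof.
elim: x => [|t x [m IH]]; first by exists 0%N.
exists (m + lcount s t.2.1 + lcount s t.2.2)%N => t'.
by rewrite inE => /orP[/eqP ->|/IH []]; lia.
Qed.

Definition balanced x := forall t, t \in x -> forall s, lcount s t.2.1 = lcount s t.2.2.

Lemma balanced_fmul x y : balanced x -> balanced y -> balanced (fmul x y).
Proof.
move=> bx by' t /fmulP[t1 [t2 [a [b [/bx H1 /by' H2 E ->]]]]] s /=.
have [] := res_counts s E; rewrite ?lcount_cat ?count_cat (H1 s) -(H2 s); lia.
Qed.

Lemma balanced_fstar x : balanced x -> balanced (fstar x).
Proof. by move=> bx t /fstarP[t1 /bx H ->] s /=. Qed.

(** If u and v contain s equally often, then u a contains it as often as v a, and this number is a
    maximum of old counts. *)
Lemma balanced_counts s m x y : balanced x -> balanced y ->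
  bounded_counts s m x -> bounded_counts s m y -> bounded_counts s m (fmul x y).
Proof.
move=> bx by' Bx By t tm; have := balanced_fmul bx by' tm s => <-.
case/fmulP: tm => t1 [t2 [a [b [t1x t2y E ->]]]] /=.
have [] := res_counts s E; have := bx _ t1x s.
by have := Bx _ t1x; have := By _ t2y; rewrite lcount_cat; lia.
Qed.

Lemma words_finite (l : seq S) n : exists W : seq (seq S),
  forall u, {subset u <= l} -> (size u <= n)%N -> u \in W.
Proof.
elim: n => [|n [W HW]]; first by exists [:: [::]] => -[].
exists ([::] :: [seq s :: u | s <- l, u <- W]) => -[|s u] sub su //.
rewrite inE; apply/allpairsP; exists (s, u); split=> //=; first by apply: sub; rewrite mem_head.
by apply: HW => // t tu; apply: sub; rewrite inE tu orbT.
Qed.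

Lemma finitely_many_degrees (w0 : seq S) : exists D : seq G, uniq D /\
  forall x, (forall s, bounded_counts s (lcount s w0) x) -> forall t, t \in x -> deg t \in D.
Proof.
have [W HW] := words_finite w0 (size w0).
exists (undup [seq pg u * (pg v)^-1 | u <- W, v <- W]%g); split; first exact: undup_uniq.
move=> x Bx t tx; rewrite mem_undup; apply/allpairsP; exists (t.2.1, t.2.2) => /=.
(* A word whose counts are bounded by those of w0 is a rearrangement of a subsequence of w0, so it
   is no longer than w0 and has letters of w0 only. *)
have H u : (forall s, count_mem s u <= count_mem s w0)%N -> u \in W.
  move=> /count_subseqP[u' sub pu]; apply: HW.
    by move=> s su; apply: (mem_subseq sub); rewrite -(perm_mem pu).
  by rewrite (perm_size pu) size_subseq.
by split=> //; apply: H => s; case: (Bx s t tx).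
Qed.

(** A formal sum for (x^* x)^(2^r), kept formal so that the degrees of its terms can be counted. *)
Definition square_iter r x := iter r (fun z => fmul z z) (fmul (fstar x) x).

End FiniteSums.

Section Amenability.
Variables (R : realType) (S : countType) (e : rel S).
Hypothesis e_sym : symmetric e.
Hypothesis e_irr : irreflexive e.
Local Notation G := (raag e).
Local Notation X0 := (@X0 S e).
Local Notation pg := (@pg S e).
Local Notation regular := (regular R e).
Local Notation regrep := (@regrep R S e e_sym e_irr).
Variables (A : cstarType R) (V : S -> A) (pi : A -> regular).
Hypothesis HV : boundary_relations e V.
Hypothesis piP : star_hom pi.
Hypothesis piV : forall s, pi (V s) = hom_gen regrep s.
Local Notation fterm := (R[i] * (seq S * seq S))%type.
Local Notation fsum := (fsum R S).
Local Notation deg := (@deg R S e).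
Local Notation fmul := (@fmul R S e).
Local Notation fval := (fval V).
Local Notation rnrm := (rnrm V pi).
Implicit Types (s : S) (u v : seq S) (t : fterm) (x y z : fsum) (w : subsets G).

Lemma fval_square x : fval (fmul (fstar x) x) = star (fval x) * fval x.
Proof. by rewrite (fval_mul e_sym HV) fval_star. Qed.

Lemma nrm_square x : nrm (fval (fmul (fstar x) x)) = nrm (fval x) ^+ 2.
Proof. by rewrite fval_square nrm_star2. Qed.

Lemma rnrm_square x : rnrm (fmul (fstar x) x) = rnrm x ^+ 2.
Proof. by rewrite /rnrm fval_square (star_homM piP) (star_homS piP) nrm_star2. Qed.

Lemma fval_square_iter r x :
  fval (square_iter e r x) = (star (fval x) * fval x) ^+ (2 ^ r).
Proof.
elim: r => [|r IH]; first by rewrite expr1 /square_iter /= fval_square.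
by rewrite /square_iter iterS -/(square_iter e r x) (fval_mul e_sym HV) IH -exprD addnn -mul2n -expnS.
Qed.

Lemma amenable_of_growth x (K : R) :
  (forall r, nrm (fval (square_iter e r x)) <= K * 2 ^+ r * rnrm (square_iter e r x)) ->
  nrm (fval x) <= rnrm x.
Proof.
move=> H; rewrite -(@ler_pXn2r _ 2) ?nnegrE ?nrm_ge0 // -nrm_star2 -rnrm_square.
rewrite /rnrm fval_square (star_homM piP) (star_homS piP).
apply: (@power_trick _ _ _ K); rewrite ?nrm_ge0 // => r.
rewrite -!nrm_exp2 ?starMr ?starK //.
have := H r; rewrite /rnrm fval_square_iter.
set h := star (fval x) * fval x.
have -> : pi (h ^+ (2 ^ r)) = (star (pi (fval x)) * pi (fval x)) ^+ (2 ^ r).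
  elim: (2 ^ r)%N => [|n IH]; first by rewrite !expr0 (star_hom1 piP).
  by rewrite !exprS (star_homM piP) IH /h (star_homM piP) (star_homS piP).
by [].
Qed.

(** The diagonal coefficient of x at the basis vector (w, 1) is [symbol w x]; so N bounds all
    symbols, and [diagonal_norm] applies. *)
Lemma rnrm_diagonal x : diagonal_sum e x -> nrm (fval x) <= rnrm x.
Proof.
move=> dx; apply: (diagonal_norm e_sym e_irr HV dx); first exact: nrm_ge0.
move=> w Xw.
pose i0 := (w, 1%g : G).
have Qi : X0 i0.1 by [].
pose d := @hdelta R _ (fun i : subsets G * G => X0 i.1) i0 Qi.
have H := hq_fop piP piV x d; rewrite hq_delta mulr1 in H.
have := le_trans (hq_coord _ i0) H; rewrite fopE // /sum_act.
have -> : \sum_(t <- x | i0.1 (pg t.2.1)) t.1 * d (gshift (deg t)^-1%g i0) = symbol w x.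
  rewrite /symbol big_seq_cond [RHS]big_seq_cond; apply: eq_bigr => t /andP[tx _].
  have -> : deg t = 1%g by apply/deg1E; exact: dx.
  by rewrite invg1 /gshift translate1 mul1g /= eqxx mulr1.
by rewrite ler_pXn2r ?nnegrE ?cn_ge0 ?nrm_ge0.
Qed.

Lemma rnrm_homogeneous g x : (forall t, t \in x -> deg t = g) -> nrm (fval x) <= rnrm x.
Proof.
move=> Hx; rewrite -(@ler_pXn2r _ 2) ?nnegrE ?nrm_ge0 // -nrm_square -rnrm_square.
apply: rnrm_diagonal; move=> t /(deg_fmul e_sym e_irr)[t1 [t2 [/(@deg_fstar R S e)[t1' t1x E1] t2x E]]].
by apply/deg1E; rewrite E E1 (Hx _ t1x) (Hx _ t2x) mulVg.
Qed.

Lemma fval_graded (K : eqType) (kap : G -> K) (D : seq K) x : uniq D ->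
  (forall t, t \in x -> kap (deg t) \in D) -> fval x = \sum_(k <- D) fval (graded kap k x).
Proof.
move=> uD HD.
under eq_bigr => k _ do rewrite {1}/fval big_filter.
rewrite {1}/fval (exchange_big_dep xpredT) //= big_seq [RHS]big_seq; apply: eq_bigr => t tx.
rewrite -big_filter (@perm_big _ _ _ _ _ [:: kap (deg t)]) ?big_seq1 //.
apply: uniq_perm; rewrite ?filter_uniq // => k; rewrite mem_filter !inE eq_sym.
by case: eqP => //= ->; rewrite HD.
Qed.

(** Triangle inequality over the degrees in D; each part costs at most N(x), by [rnrm_graded]. *)
Lemma nrm_fval_graded (K : eqType) (kap : G -> K) (dv : K -> K -> K) (D : seq K) x :
  (forall g h, kap (g^-1 * h)%g = dv (kap g) (kap h)) ->
  (forall a b c, dv a c = dv b c -> a = b) -> uniq D ->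
  (forall t, t \in x -> kap (deg t) \in D) ->
  (forall k, nrm (fval (graded kap k x)) <= rnrm (graded kap k x)) ->
  nrm (fval x) <= (size D)%:R * rnrm x.
Proof.
move=> kE dI uD HD Hk; rewrite (fval_graded uD HD) (le_trans (nrm_sum _ _ _)) //.
rewrite -sum1_size natr_sum mulr_suml; apply: ler_sum => k _; rewrite mul1r.
exact: (le_trans (Hk k) (rnrm_graded piP piV kE dI k x)).
Qed.

Lemma amenable_balanced x : balanced x -> nrm (fval x) <= rnrm x.
Proof.
(* The concatenation of all words of x bounds the count of every letter in x and, by balance, in all
   powers. *)
move=> bx; pose w0 := flatten [seq t.2.1 ++ t.2.2 | t <- x].
have Bx s : bounded_counts s (lcount s w0) x.
  move=> t; rewrite /w0; elim: (x) => //= t' y IH; rewrite inE ?lcount_cat ?count_cat.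
  by case/orP => [/eqP ->|/IH[]]; rewrite ?lcount_cat; lia.
have [D [uD HD]] := finitely_many_degrees R e w0.
have sq r : balanced (square_iter e r x) /\
    forall s, bounded_counts s (lcount s w0) (square_iter e r x).
  elim: r => [|r [IH1 IH2]].
    have bs := balanced_fstar bx; split; first exact: balanced_fmul.
    by move=> s; apply: balanced_counts => //; exact: bounded_counts_fstar.
  by split=> [|s]; [exact: balanced_fmul|exact: balanced_counts].
apply: (@amenable_of_growth x (size D)%:R) => r.
have [_ Br] := sq r.
rewrite (le_trans (@nrm_fval_graded G id (fun a c => a^-1 * c)%g D _ _ _ uD _ _)) //.
- by move=> a b c /mulIg /invg_inj.
- exact: HD.
- by move=> k; apply: (@rnrm_homogeneous k) => t; rewrite mem_filter => /andP[/eqP].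
- by rewrite ler_wpM2r ?nrm_ge0 // ler_peMr ?ler0n // -natrX ler1n expn_gt0.
Qed.

(** l lists the letters released so far; all others have exponent sum 0 in every degree. *)
Definition unbalanced_in (l : seq S) x :=
  forall t, t \in x -> forall s, s \notin l -> letter_degree s (deg t) = 0.

Lemma unbalanced_fmul l x y : unbalanced_in l x -> unbalanced_in l y ->
  unbalanced_in l (fmul x y).
Proof.
move=> ux uy t /(deg_fmul e_sym e_irr)[t1 [t2 [/ux H1 /uy H2 ->]]] s sl.
by rewrite letter_degreeM H1 // H2 // addr0.
Qed.

Lemma unbalanced_fstar l x : unbalanced_in l x -> unbalanced_in l (fstar x).
Proof.
by move=> ux t /(@deg_fstar R S e)[t1 /ux H ->] s sl; rewrite letter_degreeV H // oppr0.
Qed.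

Lemma amenable_unbalanced l x : unbalanced_in l x -> nrm (fval x) <= rnrm x.
Proof.
elim: l x => [|s0 l IH] x ux.
  apply: amenable_balanced => t tx s; have := ux t tx s isT.
  rewrite /deg letter_degreeM letter_degreeV !letter_degree_pg; lia.
(* If y has constant degree in s0, then y^* y has degree 0 in s0, and the induction hypothesis
   applies to it. *)
have gr k y : unbalanced_in (s0 :: l) y ->
    nrm (fval (graded (@letter_degree S e s0) k y)) <= rnrm (graded (@letter_degree S e s0) k y).
  move=> uy; rewrite -(@ler_pXn2r _ 2) ?nnegrE ?nrm_ge0 // -nrm_square -rnrm_square.
  set yk := graded _ k y; apply: IH => t /(deg_fmul e_sym e_irr)[t1 [t2 [/(@deg_fstar R S e)[t1' t1y E1] t2y ->]]] s sl.
  rewrite E1 letter_degreeM letter_degreeV.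
  move: t1y t2y; rewrite !mem_filter => /andP[/eqP k1 t1y] /andP[/eqP k2 t2y].
  have [->|ss0] := eqVneq s s0; first by rewrite k1 k2 addNr.
  have nsl : s \notin s0 :: l by rewrite inE negb_or ss0.
  by rewrite (uy _ t1y _ nsl) (uy _ t2y _ nsl) oppr0 addr0.
(* With counts at most m the degree in s0 lies between -m and m, which leaves 2 m + 1 parts. *)
have step m y : unbalanced_in (s0 :: l) y -> bounded_counts s0 m y ->
    nrm (fval y) <= (2 * m + 1)%:R * rnrm y.
  move=> uy By; pose D := [seq k%:Z - m%:Z | k <- iota 0 (2 * m + 1)].
  have -> : (2 * m + 1)%N = size D by rewrite size_map size_iota.
  apply: (@nrm_fval_graded int (@letter_degree S e s0) (fun a c => c - a)).
  - by move=> g h; rewrite letter_degreeM letter_degreeV addrC.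
  - by move=> a b c; lia.
  - by rewrite map_inj_uniq ?iota_uniq // => a b; lia.
  - move=> t /By[H1 H2]; apply/mapP; exists (m + lcount s0 t.2.1 - lcount s0 t.2.2)%N.
      by rewrite mem_iota; lia.
    rewrite /deg letter_degreeM letter_degreeV !letter_degree_pg; lia.
  - by move=> k; exact: gr.
have [m Bm] := bounded_counts_ex s0 x.
have sq r : unbalanced_in (s0 :: l) (square_iter e r x) /\
    bounded_counts s0 (2 ^ r.+1 * m) (square_iter e r x).
  elim: r => [|r [IH1 IH2]].
    have us := unbalanced_fstar ux; split; first exact: unbalanced_fmul.
    by rewrite expn1; apply: bounded_counts_fmul => //; exact: bounded_counts_fstar.
  split; first exact: unbalanced_fmul.
  by rewrite expnS -mulnA; exact: bounded_counts_fmul.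
(* [step] at the count 2^(r + 1) m gives 4 m 2^r + 1 <= (4 m + 1) 2^r parts. *)
apply: (@amenable_of_growth x (4 * m + 1)%:R) => r; have [ur Br] := sq r.
rewrite (le_trans (step _ _ ur Br)) // ler_wpM2r ?nrm_ge0 // -natrX -natrM ler_nat.
rewrite expnS; have : (0 < 2 ^ r)%N by rewrite expn_gt0.
nia.
Qed.

Lemma amenable x : nrm (fval x) <= rnrm x.
Proof.
apply: (@amenable_unbalanced (flatten [seq t.2.1 ++ t.2.2 | t <- x])) => t tx s sl.
rewrite /deg letter_degreeM letter_degreeV !letter_degree_pg.
have : s \notin t.2.1 ++ t.2.2.
  apply: contra sl => st; apply/flattenP; exists (t.2.1 ++ t.2.2) => //.
  by apply/mapP; exists t.
by rewrite mem_cat negb_or => /andP[/count_memPn E1 /count_memPn E2]; rewrite /lcount E1 E2.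
Qed.

End Amenability.

(** * Pure infiniteness *)

(** Linearity turns a bound on the basis vectors into one by the l^1 norm of x; read backwards, an
    operator that is large on some vector is large on a basis vector. *)
Lemma hn_restr (R : realType) (I : choiceType) (Q : set I) (T : bop (@hip R I Q))
    (B : R) (l : seq I) (x : hsp R Q) : uniq l -> 0 <= B ->
  (forall i (Qi : Q i), hn (@hip R I Q) (bf T (hdelta R Qi)) <= B) ->
  hn (@hip R I Q) (bf T (hrestr (mem l) x)) <= B * \sum_(i <- l) cn (x i).
Proof.
move=> ul B0 HB; elim: l ul => [_|i l IH /= /andP[il ul]].
  have -> : hrestr (mem [::]) x = 0 by apply: hsp_eq.
  by rewrite big_nil mulr0 bf0 (hn0 (@hip_lin R I Q) (@hip_conj R I Q)) //; exact: hip_ge0.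
rewrite big_cons mulrDr.
have [xi0|/eqP xi] := eqVneq (x i) 0.
  have -> : hrestr (mem (i :: l)) x = hrestr (mem l) x.
    apply: hsp_eq => j /=; rewrite !inE; case: eqP => [->|//] /=.
    by rewrite xi0; case: ifP.
  by rewrite xi0 cn0 mulr0 add0r; exact: IH.
have Qi := hv_in xi.
have -> : hrestr (mem (i :: l)) x = x i *: hdelta R Qi + hrestr (mem l) x.
  apply: hsp_eq => j; rewrite hvD hvZ /= !inE; case: eqP => [->|_] /=.
    by rewrite (negbTE il) addr0 mulr1.
  by rewrite mulr0 add0r.
rewrite bfD bfZ (le_trans (hnD (@hip_lin R I Q) (@hip_conj R I Q) (@hip_ge0 R I Q) _ _)) // lerD //.
  rewrite (hnZ (@hip_lin R I Q) (@hip_conj R I Q) (@hip_ge0 R I Q)) mulrC ler_wpM2r ?cn_ge0 //.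
  exact: IH.
Qed.

Section PurelyInfinite.
Variables (R : realType) (S : countType) (e : rel S).
Hypothesis e_sym : symmetric e.
Hypothesis e_irr : irreflexive e.
Hypothesis no_isolated : forall s : S, exists t : S, opp_adj e s t.
Local Notation G := (raag e).
Local Notation X0 := (@X0 S e).
Local Notation pg := (@pg S e).
Local Notation regular := (regular R e).
Local Notation regrep := (@regrep R S e e_sym e_irr).
Variables (A : cstarType R) (V : S -> A) (pi : A -> regular).
Hypothesis HV : boundary_relations e V.
Hypothesis piP : star_hom pi.
Hypothesis piV : forall s, pi (V s) = hom_gen regrep s.
Local Notation fterm := (R[i] * (seq S * seq S))%type.
Local Notation fsum := (fsum R S).
Local Notation deg := (@deg R S e).
Local Notation fmul := (@fmul R S e).
Local Notation fval := (fval V).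
Local Notation vw := (vw V).
Local Notation rnrm := (rnrm V pi).
Local Notation op := (fop piP piV).
Local Notation Q := (fun i : subsets G * G => X0 i.1).
Local Notation hn := (hn (@hip R _ Q)).
Local Notation hq := (hq (@hip R _ Q)).
Implicit Types (s : S) (u v p : seq S) (t : fterm) (x y z : fsum) (w : subsets G).

Definition compress p x : fsum := fmul (fmul [:: (1, ([::], p))] x) [:: (1, (p, [::]))].

Lemma fval_compress p x : fval (compress p x) = star (vw p) * fval x * vw p.
Proof.
rewrite !(fval_mul e_sym HV); congr (_ * _ * _).
  by rewrite /fval big_seq1 /= vw_nil mul1r scale1r.
by rewrite /fval big_seq1 /= vw_nil star1 mulr1 scale1r.
Qed.

Lemma size_compress p x : (size (compress p x) <= size x)%N.
Proof.
rewrite (leq_trans (size_fmul _ _ _)) //= muln1.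
by rewrite (leq_trans (size_fmul _ _ _)) //= mul1n.
Qed.

Lemma compress_offdiag p x : (forall t, t \in x -> deg t <> 1%g) ->
  forall t, t \in compress p x -> deg t <> 1%g.
Proof.
move=> H t /(deg_fmul e_sym e_irr)[t1 [t2 [/(deg_fmul e_sym e_irr)[t3 [t4 [+ t4x ->]]] + ->]]].
rewrite !inE => /eqP -> /eqP -> E; apply: (H t4 t4x); move: E.
rewrite /deg /= pg_nil invg1 mulg1 mul1g => E.
apply: (mulIg (pg p)); apply: (mulgI (pg p)^-1%g).
by rewrite mul1g mulVg mulgA.
Qed.

(** The terms are killed one at a time. Conjugation by V_q does not increase the number of the
    remaining terms and conjugates their degrees, so these stay different from 1. *)
Lemma kill_offdiag x : (forall t, t \in x -> deg t <> 1%g) ->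
  exists p, star (vw p) * fval x * vw p = 0.
Proof.
have [n] := ubnP (size x); elim: n x => // n IH [|t x] /=.
  by move=> _ _; exists [::]; rewrite fval_nil mulr0 mul0r.
rewrite ltnS => sx H.
have [q Hq] : exists q : seq S, star (vw q) * (vw t.2.1 * star (vw t.2.2)) * vw q = 0.
  have [|q Hq] := separating_word e_sym e_irr (a := t.2.1) (b := t.2.2) no_isolated.
    by move=> E; apply: (H t (mem_head _ _)); apply/deg1E.
  exists q; rewrite -!mulrA (nica e_sym HV t.2.2).
  case E : (res e t.2.2 q) => [[c d]|]; last by rewrite !mulr0.
  by rewrite (mulrA (vw t.2.1)) -vw_cat mulrA (nica e_sym HV) (Hq _ _ E) mul0r.
have [||p Hp] := IH (compress q x).
- exact: leq_ltn_trans (size_compress _ _) sx.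
- by apply: compress_offdiag => t' t'x; apply: H; rewrite inE t'x orbT.
exists (q ++ p); rewrite vw_cat starMr.
have -> : fval (t :: x) = t.1 *: (vw t.2.1 * star (vw t.2.2)) + fval x.
  by rewrite /fval big_cons.
rewrite mulrA -(mulrA (star (vw p)) (star (vw q))) -(mulrA (star (vw p)) (star (vw q) * _)).
by rewrite (mulrDr (star (vw q))) (mulrDl _ _ (vw q)) scaleAr scaleAl Hq scaler0 add0r -fval_compress.
Qed.

Definition diag_part x : fsum := [seq t <- x | deg t == 1%g].

(** A p that decides all words u turns the diagonal terms into scalars, and these survive the later
    conjugation that kills the other terms. *)
Lemma compress_to_symbol w x : X0 w ->
  exists p, star (vw p) * fval x * vw p = symbol w (diag_part x) *: (1 : A).
Proof.
move=> Xw; have [p [wp Hp]] := deciding_prefix e_sym e_irr [seq t.2.1 | t <- x] Xw.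
have dg t : t \in x -> deg t = 1%g ->
    star (vw p) * (vw t.2.1 * star (vw t.2.2)) * vw p = (w (pg t.2.1))%:R *: (1 : A).
  move=> tx /deg1E E; rewrite -(vw_pg e_sym e_irr HV E).
  have := Hp t.2.1 (map_f _ tx); case: ifP => _.
    move=> /qleP[c]; rewrite -pg_cat => /(vw_pg e_sym e_irr HV) ->.
    rewrite vw_cat starMr scale1r -!mulrA (mulrA (star (vw t.2.1)) (vw t.2.1) (vw c)).
    rewrite (vw_iso HV) mul1r (mulrA (star (vw t.2.1)) (vw t.2.1) (vw c)) (vw_iso HV) mul1r.
    exact: (vw_iso HV).
  move=> N; rewrite -mulrA -mulrA mulrA (nica e_sym HV p).
  case E2 : (res e p t.2.1) => [[a b]|]; last by rewrite mul0r scale0r.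
  have [[pj uj _] _] := res_is_join e_sym e_irr E2; by case: (N _ uj pj).
pose off := [seq t <- x | deg t != 1%g].
have [|q Hq] := @kill_offdiag (compress p off).
  by apply: compress_offdiag => t; rewrite mem_filter => /andP[/eqP].
exists (p ++ q); rewrite vw_cat starMr.
have -> : fval x = fval (diag_part x) + fval off.
  by rewrite /fval [LHS](bigID (fun t => deg t == 1%g)) /= !big_filter.
rewrite mulrA -(mulrA (star (vw q)) (star (vw p))) -(mulrA (star (vw q)) (star (vw p) * _)).
rewrite (mulrDr (star (vw p))) (mulrDl _ _ (vw p)) -(fval_compress p off) mulrDr mulrDl Hq addr0.
have -> : star (vw p) * fval (diag_part x) * vw p = symbol w (diag_part x) *: (1 : A).
  rewrite /fval mulr_sumr mulr_suml /symbol scaler_suml [RHS]big_mkcond /=.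
  rewrite big_seq [RHS]big_seq; apply: eq_bigr => t; rewrite mem_filter => /andP[/eqP d1 tx].
  rewrite scaleAr scaleAl dg //; case: ifP => _; first by rewrite scale1r.
  by rewrite scale0r scaler0.
by rewrite scaleAr mulr1 scaleAl (vw_iso HV).
Qed.

Lemma symbol_diag_part i (Qi : Q i) x :
  symbol i.1 (diag_part x) = bf (op x) (hdelta R Qi) i.
Proof.
rewrite fopE // /symbol /sum_act big_filter_cond [LHS]big_mkcond [RHS]big_mkcond /=.
apply: eq_bigr => t _.
have -> : (gshift (deg t)^-1%g i == i) = (deg t == 1%g).
  apply/eqP/eqP => [|->]; last by rewrite invg1 /gshift translate1 mul1g -surjective_pairing.
  case: (i) => w h [_ /eqP]; rewrite -{2}[h]mul1g => /eqP/mulIg/(congr1 (fun g : G => g^-1%g)).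
  by rewrite invgK invg1.
by case: (deg t == 1%g); case: (i.1 _) => //=; rewrite ?mulr1 ?mulr0.
Qed.

(** Both sides are the diagonal matrix entry of x^* x at the basis vector i. *)
Lemma symbol_square i (Qi : Q i) x :
  symbol i.1 (diag_part (fmul (fstar x) x)) = (hq (bf (op x) (hdelta R Qi)))%:C.
Proof.
rewrite symbol_diag_part; set d := hdelta R Qi.
pose T2 := bmul (bstar (@hip_lin R _ Q) (@hip_conj R _ Q) (@hip_ge0 R _ Q) (op x)) (op x).
rewrite (@oemb_inj _ _ _ _ T2); last first.
  by rewrite oembM oembS -!pi_fop (fval_mul e_sym HV) fval_star (star_homM piP) (star_homS piP).
rewrite /T2 /= -(hqE (@hip_ge0 R _ Q)) -(b_adj' (@hip_conj R _ Q)).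
rewrite (hip_conj d) (@hipE _ _ _ _ _ [fset i]%fset); last first.
  by move=> j; rewrite inE /= => /negbTE ->.
by rewrite big_seq_fset1 /= eqxx mul1r conjCK.
Qed.

Lemma fop_sub_le x y xi :
  hn (bf (op x) xi) <= hn (bf (op y) xi) + nrm (fval x - fval y) * hn xi.
Proof.
pose l := @hip_lin R _ Q; pose c := @hip_conj R _ Q; pose g := @hip_ge0 R _ Q.
pose D := badd l c g (op x) (bscale l c g (-1) (op y)).
have E : oemb l c g D = pi (fval x - fval y).
  by rewrite oembD oembZ -!pi_fop scaleN1r (star_homB piP).
have -> : bf (op x) xi = bf (op y) xi + bf D xi.
  by rewrite /= scaleN1r addrC subrK.
rewrite (le_trans (hnD l c g _ _)) // lerD2l.
rewrite (le_trans (nrm_oemb_ge l c g D xi)) // E ler_wpM2r ?hn_ge0 //.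
exact: star_hom_le.
Qed.

(** c has to be found before x, since the final accuracy depends on it. One vector xi serves for all
    x close to b, and [hn_restr] passes from xi to a basis vector. Such a xi exists because N
    dominates the norm, by [amenable]. *)
Lemma large_vector (b : A) : b <> 0 ->
  (forall (xi : A) (eps : R), 0 < eps -> exists x, nrm (xi - fval x) < eps) ->
  exists delta c : R, [/\ 0 < delta, 0 < c & forall x, nrm (b - fval x) < delta ->
    exists i (Qi : Q i), c < hn (bf (op x) (hdelta R Qi))].
Proof.
move=> b0 dense; pose n := nrm b.
have n0 : 0 < n.
  rewrite lt_neqAle nrm_ge0 andbT eq_sym; apply/eqP => /nrm_eq0; exact: b0.
have [x0 Hx0] := dense b (n / 8) ltac:(by rewrite divr_gt0).
have [xi Hxi] : exists xi, n / 2 * hn xi < hn (bf (op x0) xi).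
  apply: contrapT => N.
  have : rnrm x0 <= n / 2.
    rewrite /rnrm (pi_fop piP piV); apply: nrm_oemb_le; first by rewrite divr_ge0 // ltW.
    by move=> xi; rewrite leNgt; apply/negP => H; apply: N; exists xi.
  have := amenable HV piP piV x0; have := nrm_distl b (fval x0).
  rewrite -/n; lra.
have h0 : 0 < hn xi.
  rewrite lt_neqAle hn_ge0 andbT eq_sym; apply/eqP => h0.
  by have := hn_fop piP piV x0 xi; move: Hxi; rewrite h0 !mulr0; lra.
have [C HC] := hv_fin xi.
pose M := \sum_(i <- C) cn (xi i).
have M0 : 0 <= M by apply: sumr_ge0 => i _; exact: cn_ge0.
have M1 : 0 < M + 1 by lra.
(* If all basis vectors stayed below c, the image of xi under x would be at most n/8 |xi|, and under
   x0 at most (n/8 + n/4) |xi|, which is less than n/2 |xi|. The added 1 keeps the denominator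
   positive. *)
pose c := n / 8 * hn xi / (M + 1).
have c0 : 0 < c by rewrite !divr_gt0 // mulr_gt0 // divr_gt0.
exists (n / 8), c; split=> //; first by rewrite divr_gt0.
move=> x Hx; apply: contrapT => N.
have HB i (Qi : Q i) : hn (bf (op x) (hdelta R Qi)) <= c.
  by rewrite leNgt; apply/negP => H; apply: N; exists i, Qi.
have := @hn_restr _ _ _ (op x) c C xi (finmap.fset_uniq C) (ltW c0) HB.
have -> : hrestr (mem (finmap.enum_fset C)) xi = xi.
  by apply: hsp_eq => i /=; case: ifPn => // /HC.
rewrite -/M => H1; have H2 := fop_sub_le x0 x xi.
have H3 : nrm (fval x0 - fval x) <= n / 4.
  rewrite (le_trans (nrm_dist b _ _)) // nrmB; lra.
have H4 : nrm (fval x0 - fval x) * hn xi <= n / 4 * hn xi by rewrite ler_wpM2r ?(ltW h0).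
have H5 : c * M <= n / 8 * hn xi.
  rewrite /c -mulrA ler_piMr ?mulr_ge0 ?(ltW h0) ?divr_ge0 ?(ltW n0) //.
  by rewrite mulrC ler_pdivrMr // mul1r lerDl.
have : 0 < n * hn xi by rewrite mulr_gt0.
nra.
Qed.

Lemma purely_infinite_of_dense :
  (forall (xi : A) (eps : R), 0 < eps -> exists x, nrm (xi - fval x) < eps) ->
  forall b : A, b <> 0 -> exists r l : A, r * b * l = 1.
Proof.
move=> dense b b0; have [delta [c [d0 c0 Hc]]] := large_vector b0 dense.
pose n := nrm b.
have n0 : 0 <= n by exact: nrm_ge0.
(* If x is within eps <= delta of b, the norm of b^* b - x^* x is at most eps (2 n + delta) < eps k
   <= c^2, which is below the scalar lam. *)
pose k := 2 * n + delta + 1.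
have k0 : 0 < k by rewrite /k; lra.
pose eps := Num.min delta (c ^+ 2 / k).
have c20 : 0 < c ^+ 2 by rewrite exprn_gt0.
have eps0 : 0 < eps by rewrite /eps lt_min d0 divr_gt0.
have eps_d : eps <= delta by rewrite /eps ge_min lexx.
have eps_c : eps * k <= c ^+ 2.
  by rewrite -ler_pdivlMr // /eps ge_min lexx orbT.
have [x Hx] := dense b eps eps0.
have [i [Qi Hi]] := Hc x (lt_le_trans Hx eps_d).
have [p Hp] := compress_to_symbol (fmul (fstar x) x) Qi.
rewrite symbol_square in Hp; set lam := hq _ in Hp.
have lamc : c ^+ 2 < lam.
  rewrite /lam -(hn_sqr (@hip_ge0 R _ Q)).
  by rewrite ltrXn2r ?nnegrE ?hn_ge0 ?(ltW c0).
have lam0 : 0 < lam by exact: lt_trans lamc.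
(* y is b^* b compressed by V_p and divided by lam; with x in place of b the result would be exactly
   1. *)
pose y := (lam^-1)%:C *: (star (vw p) * (star b * b) * vw p).
have E1 : 1 - y = - (lam^-1)%:C *: (star (vw p) * (star b * b - star (fval x) * fval x) * vw p).
  rewrite mulrBr mulrBl -(fval_square e_sym HV) Hp scalerBr !scaleNr -/y opprK addrC.
  congr (_ + _); rewrite scalerA -rmorphM /= mulVf ?gt_eqF // scale1r //.
have H1 : nrm (star b * b - star (fval x) * fval x) < c ^+ 2.
  have -> : star b * b - star (fval x) * fval x =
      star b * (b - fval x) + star (b - fval x) * fval x.
    by rewrite starB mulrBr mulrBl addrA subrK.
  have Hf : nrm (fval x) <= n + eps.
    by rewrite (le_trans (nrm_distl _ b)) // nrmB lerD2l ltW.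
  have HA := nrmM (star b) (b - fval x); have HB := nrmM (star (b - fval x)) (fval x).
  rewrite !nrm_star -/n in HA HB.
  have HD := nrmD (star b * (b - fval x)) (star (b - fval x) * fval x).
  set q := nrm (b - fval x) in Hx HA HB.
  have q0 : 0 <= q by exact: nrm_ge0.
  have : q * n + q * (n + eps) <= eps * (2 * n + delta).
    have : q <= eps by exact: ltW.
    nra.
  have : q * nrm (fval x) <= q * (n + eps) by rewrite ler_wpM2l.
  have : eps * (2 * n + delta) < eps * k by rewrite ltr_pM2l // /k; lra.
  lra.
have Hy : nrm (1 - y) < 1.
  rewrite E1 nrmZ cnN cnC ger0_norm ?invr_ge0 ?(ltW lam0) // mulrC ltr_pdivrMr // mul1r.
  apply: le_lt_trans (nrm_conj_le _ (nrm_vw HV p)) _.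
  exact: lt_trans H1 lamc.
have [r Hr] := right_inverse_near1 Hy.
exists ((lam^-1)%:C *: (star (vw p) * star b)), (vw p * r).
by rewrite -Hr /y !scaleAl !mulrA.
Qed.

End PurelyInfinite.

(** * The isomorphism *)

Section DenseRange.
Variables (R : realType) (A B : cstarType R) (f : A -> B).
Hypothesis fP : star_hom f.
Hypothesis f_iso : forall x, nrm (f x) = nrm x.

Lemma isometric_range_closed (b : B) :
  (forall eps : R, 0 < eps -> exists a, nrm (b - f a) < eps) -> exists a, f a = b.
Proof.
move=> H; have inv0 n : 0 < (n.+1%:R^-1 : R) by rewrite invr_gt0 ltr0n.
have [u Hu] := choice (fun n => H _ (inv0 n)).
have small eps : 0 < eps -> exists N, forall n, (N <= n)%N -> nrm (b - f (u n)) < eps.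
  move=> e0; have [N HN] := ltr_add_invr e0; exists N => n Nn.
  apply: lt_trans (Hu n) _; apply: le_lt_trans HN; rewrite add0r.
  by rewrite lef_pV2 ?posrE ?ltr0n // ler_nat ltnS.
have [l ul] : exists l, nlim u l.
  apply: nrm_complete => eps e0; have e2 : 0 < eps / 2 by rewrite divr_gt0.
  have [N HN] := small _ e2; exists N => m n Nm Nn.
  rewrite -f_iso (star_homB fP) (le_lt_trans (nrm_dist b _ _)) // nrmB.
  by have := HN _ Nm; have := HN _ Nn; lra.
exists l; apply: (nlim_unique (star_hom_nlim fP ul)) => eps e0.
by have [N HN] := small _ e0; exists N => n /HN; rewrite nrmB.
Qed.

End DenseRange.

Section Universal.
Variables (R : realType) (S : countType) (e : rel S).
Local Notation fsum := (fsum R S).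

Definition boundary_term (l : seq S) : term R S :=
  foldr (fun s t => TMul (TAdd (T1 R S) (TSc (-1) (TMul (TVar R s) (TSt (TVar R s))))) t) (T1 R S) l.

Lemma ev_boundary_term (D : cstarType R) (W : S -> D) (l : seq S) :
  ev W (boundary_term l) = \prod_(s <- l) (1 - W s * star (W s)).
Proof. by elim: l => [|s l IH] /=; rewrite ?big_nil ?big_cons // -IH scaleN1r. Qed.

Lemma boundary_relations_bounded (D : cstarType R) (W : S -> D) s :
  boundary_relations e W -> nrm (W s) <= 1.
Proof.
case=> H _ _ _; have := nrm_star2 (W s); rewrite H => E; have := nrm1_le D; rewrite E.
by rewrite expr_le1 // nrm_ge0.
Qed.

Hypothesis e_sym : symmetric e.

Lemma universal_cstar_exists : exists (A : cstarType R) (V : S -> A),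
  is_universal_cstar e V /\
  forall (xi : A) (eps : R), 0 < eps -> exists x : fsum, nrm (xi - fval V x) < eps.
Proof.
pose K (D : cstarType R) (W : S -> D) := boundary_relations e W.
have Kb (D : cstarType R) (W : S -> D) s : K D W -> nrm (W s) <= (fun=> 1) s.
  exact: boundary_relations_bounded.
pose V : S -> univ Kb := ugen Kb.
have eqj := @ugen_eq _ _ K _ Kb.
have HV : boundary_relations e V.
  split.
  - move=> s; apply: (eqj (TMul (TSt (TVar R s)) (TVar R s)) (T1 _ _)).
    by move=> D W [H _ _ _] /=.
  - move=> s t st; split.
      apply: (eqj (TMul (TVar R s) (TVar R t)) (TMul (TVar R t) (TVar R s))).
      by move=> D W [_ H _ _] /=; case: (H s t st).
    apply: (eqj (TMul (TSt (TVar R s)) (TVar R t)) (TMul (TVar R t) (TSt (TVar R s)))).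
    by move=> D W [_ H _ _] /=; case: (H s t st).
  - move=> s t st nst; apply: (eqj (TMul (TSt (TVar R s)) (TVar R t)) (T0 _ _)).
    by move=> D W [_ _ H _] /=; exact: H.
  - move=> F Fc; rewrite -ev_boundary_term.
    apply: (eqj (boundary_term F) (T0 _ _)) => D W [_ _ _ H].
    by rewrite ev_boundary_term H.
exists (univ Kb), V; split.
  split=> // D W HW; exists (@ulift _ _ K _ Kb D W HW); split.
    by split; [exact: ulift_star_hom|move=> s; exact: ulift_gen].
  move=> g [gP gV]; apply: univ_hom_unique => //; first exact: ulift_star_hom.
  by move=> s; rewrite ulift_gen -gV.
have ap (t : term R S) : exists x, ev V t = fval V x.
  elim: t => [s|||t [x tx] r [y ry]|c t [x tx]|t [x tx] r [y ry]|t [x tx]] /=;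
      rewrite ?tx ?ry.
  - by exists [:: (1, ([:: s], [::]))]; rewrite /fval big_seq1 /= vw_nil vw1 star1 mulr1 scale1r.
  - by exists [::]; rewrite fval_nil.
  - by exists [:: (1, ([::], [::]))]; rewrite /fval big_seq1 /= vw_nil star1 mulr1 scale1r.
  - by exists (x ++ y); rewrite fval_cat.
  - exists [seq (c * t.1, t.2) | t <- x]; rewrite /fval big_map scaler_sumr.
    by apply: eq_bigr => r _ /=; rewrite scalerA.
  - by exists (fmul e x y); rewrite (fval_mul e_sym HV).
  - by exists (fstar x); rewrite fval_star.
move=> xi eps e0; have [t Ht] := @uemb_dense _ _ K _ Kb xi _ e0; have [x xE] := ap t.
by exists x; exact: (eq_ind _ (fun z => nrm (xi - z) < eps) Ht _ xE).
Qed.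

Lemma star_hom_comp (A B C : cstarType R) (f : A -> B) (g : B -> C) :
  star_hom f -> star_hom g -> star_hom (g \o f).
Proof.
move=> fP gP; split.
- by move=> c x y /=; rewrite (star_homD fP) (star_homZ fP) (star_homD gP) (star_homZ gP).
- by split=> [|x y] /=; rewrite ?(star_hom1 fP) ?(star_hom1 gP) // (star_homM fP) (star_homM gP).
- by move=> x /=; rewrite (star_homS fP) (star_homS gP).
Qed.

Lemma star_hom_id (A : cstarType R) : star_hom (@id A).
Proof. by []. Qed.

Lemma star_hom_fval (A B : cstarType R) (f : A -> B) (V : S -> A) x :
  star_hom f -> f (fval V x) = fval (f \o V) x.
Proof.
move=> fP; rewrite /fval (star_hom_sum fP); apply: eq_bigr => t _.
have fvw u : f (vw V u) = vw (f \o V) u.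
  by elim: u => [|s u IH]; rewrite ?vw_nil ?(star_hom1 fP) // !vw_cons (star_homM fP) IH.
by rewrite (star_homZ fP) (star_homM fP) (star_homS fP) !fvw.
Qed.

(** Density is not part of the universal property. The map f to the constructed model and the map g
    back compose to the identity, by uniqueness, and the contraction g carries approximations in the
    model back to A. *)
Lemma universal_cstar_dense (A : cstarType R) (V : S -> A) : is_universal_cstar e V ->
  forall (xi : A) (eps : R), 0 < eps -> exists x : fsum, nrm (xi - fval V x) < eps.
Proof.
move=> [HV univV] xi eps e0.
have [A0 [V0 [[HV0 univ0] dense]]] := universal_cstar_exists.
have [f [[fP fV] _]] := univV A0 V0 HV0.
have [g [[gP gV] _]] := univ0 A V HV.
have [h [_ uniq_h]] := univV A V HV.
have gf : g \o f = @id A.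
  transitivity h; [apply/esym|]; apply: uniq_h.
    by split=> [|s] /=; [exact: star_hom_comp|rewrite fV gV].
  by split=> //; exact: star_hom_id.
have [x Hx] := dense (f xi) eps e0; exists x.
have -> : xi - fval V x = g (f xi - fval V0 x).
  rewrite (star_homB gP) -[g (f xi)]/((g \o f) xi) gf (star_hom_fval _ _ gP).
  by congr (_ - fval _ x); apply/funext => s; rewrite /= gV.
exact: le_lt_trans (star_hom_le gP _) Hx.
Qed.

End Universal.

Lemma crossed_product_dense (R : realType) (G : groupType) (X : set (subsets G))
    (X1 : forall w, X w -> w 1%g)
    (Xt : forall t w, X w -> w t^-1%g -> X (translate t w)) (Xc : closed X)
    (B : cstarType R) (j : pcp R G -> B) : is_crossed_product X j ->
  forall (xi : B) (eps : R), 0 < eps -> exists2 a, pcp_elt X a & nrm (xi - j a) < eps.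
Proof.
move=> [jP univ] xi eps e0.
have [B0 [j0 [[j0P univ0] dense]]] := crossed_product_exists R X1 Xt Xc.
have [f [[fP fj] _]] := univ B0 j0 j0P.
have [g [[gP gj] _]] := univ0 B j jP.
have [h [_ uniq_h]] := univ B j jP.
have gf : g \o f = @id B.
  transitivity h; [apply/esym|]; apply: uniq_h.
    by split=> [|a ea] /=; [exact: star_hom_comp|rewrite fj // gj].
  by split=> //; exact: star_hom_id.
have [a ea Ha] := dense (f xi) eps e0; exists a => //.
have -> : xi - j a = g (f xi - j0 a).
  by rewrite (star_homB gP) -[g (f xi)]/((g \o f) xi) gf gj.
exact: le_lt_trans (star_hom_le gP _) Ha.
Qed.

Section Isomorphism.
Variables (R : realType) (S : countType) (e : rel S).
Hypothesis e_sym : symmetric e.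
Hypothesis e_irr : irreflexive e.
Local Notation G := (raag e).
Local Notation X := (@boundary S e).
Local Notation pg := (@pg S e).
Local Notation chi := (@pcp_char R G X).
Local Notation mono := (@pcp_mono R G).
Local Notation ideal := (@pcp_ideal R G X).
Local Notation regular := (regular R e).
Local Notation regrep := (@regrep R S e e_sym e_irr).
Implicit Types (w : subsets G) (t : G) (u v : seq S).

Let X1 := @boundary1 S e.
Let Xt := boundary_translate e_sym e_irr.
Let Xc := boundary_closed e_sym e_irr.
Let kP := @regrep_hom R S e e_sym e_irr.

Lemma regular_nontrivial : (1 : regular) <> 0.
Proof.
have [w Xw _] := X0_exists e_sym e_irr (@nil S).
pose i : subsets G * G := (w, 1%g).
have Qi : X0 i.1 by [].
pose d := @hdelta R _ (fun i : subsets G * G => X0 i.1) i Qi.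
move=> H; have := @nrm_oemb_ge _ _ _ (@hip_lin R _ _) (@hip_conj R _ _) (@hip_ge0 R _ _) (bid _) d.
rewrite oemb1 -/regular H nrm0 mul0r /= /hn hq_delta sqrtr1.
by rewrite ler10.
Qed.

(** t is written as a reduced fraction u v^-1. A w with t contains some c with t = c d^-1, and c
    lies above u, so w contains u. Hence 1_t delta_t is V_u V_v^* or 0. *)
Lemma char_quotient t : (forall w, chi t w = 0) \/
  exists u v, t = (pg u * (pg v)^-1)%g /\ forall w, chi (pg u) w * chi t w = chi t w.
Proof.
have up w : X w -> w t -> exists c d, t = (pg c * (pg d)^-1)%g /\ w (pg c).
  move=> Xw wt; have [z [z1 zt _] wz] := boundary_join Xw (X1 Xw) wt.
  move: z1 => /qleP[c]; rewrite mul1g => zc; move: zt => /qleP[d zd].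
  by exists c, d; rewrite -zc; split=> //; rewrite zd -mulgA mulgV mulg1.
have [[w0 [Xw0 wt0]]|N] := pselect (exists w, X w /\ w t); last first.
  by left=> w; apply: contrapT => /(ideal_supp (ideal_char _ _ _))[Xw wt]; apply: N; exists w.
have [c0 [d0 [E0 _]]] := up _ Xw0 wt0.
have [u [v [E nf]]] := fraction_normal_form e_sym e_irr c0 d0.
right; exists u, v; split; first by rewrite E0 E.
move=> w; have [Xw|nXw] := pselect (X w); last first.
  by rewrite !(ideal_out (ideal_char _ _ _)) ?mul0r // => -[].
rewrite !charE //; case wt : (w t); last by rewrite mulr0.
have [c [d [Ec wc]]] := up _ Xw wt.
have [|x [Hx _]] := nf c d; first by rewrite -Ec E0 E.
by rewrite (boundary_down Xw wc) ?mul1r //; apply/qleP => //; exists x.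
Qed.

Variables (A : cstarType R) (V : S -> A) (B : cstarType R) (j : pcp R G -> B).
Hypothesis univA : is_universal_cstar e V.
Hypothesis univB : is_boundary_quotient j.

Let jP : pcp_hom X j. Proof. by case: univB. Qed.

Lemma canonical_map : exists f : A -> B, star_hom f /\ forall s, f (V s) = hom_gen j s.
Proof.
have [_ H] := univA; have [f [fP _]] := H B _ (hom_gen_relations e_sym e_irr jP).
by exists f.
Qed.

Lemma canonical_representation (f : A -> B) : star_hom f -> (forall s, f (V s) = hom_gen j s) ->
  exists rho : B -> regular, [/\ star_hom rho, star_hom (rho \o f) &
    forall s, (rho \o f) (V s) = hom_gen regrep s].
Proof.
move=> fP fV; have [_ H] := univB; have [rho [[rhoP rhoj] _]] := H regular regrep kP.
exists rho; split=> //; first exact: star_hom_comp.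
by move=> s /=; rewrite fV /hom_gen rhoj //; exact/elt_mono/ideal_char.
Qed.

(** For a finite sum y, |y| <= |rho (f y)| <= |f y| <= |y|, the first by [amenable]; density does
    the rest. *)
Lemma canonical_isometric (f : A -> B) : star_hom f -> (forall s, f (V s) = hom_gen j s) ->
  forall x, nrm (f x) = nrm x.
Proof.
move=> fP fV x; apply/eqP; rewrite eq_le star_hom_le //=.
have [rho [rhoP piP piV]] := canonical_representation fP fV.
apply/ler_addgt0Pl => eps e0; have e2 : 0 < eps / 2 by rewrite divr_gt0.
have [y Hy] := universal_cstar_dense e_sym univA x e2.
have [HV _] := univA; have am := amenable HV piP piV y.
have le2 : nrm (fval V y) <= nrm (f (fval V y)).
  by rewrite (le_trans am) // /rnrm /= star_hom_le.
have H1 := nrm_distl x (fval V y).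
have H2 := nrm_distl (f (fval V y)) (f x).
have H3 : nrm (f (fval V y) - f x) <= nrm (x - fval V y).
  by rewrite -(star_homB fP) nrmB star_hom_le.
lra.
Qed.

Section Range.
Variable f : A -> B.
Hypothesis fP : star_hom f.
Hypothesis fV : forall s, f (V s) = hom_gen j s.

Let rng (b : B) := exists a, f a = b.

Lemma rngD b c : rng b -> rng c -> rng (b + c).
Proof. by move=> [x <-] [y <-]; exists (x + y); rewrite (star_homD fP). Qed.
Lemma rngM b c : rng b -> rng c -> rng (b * c).
Proof. by move=> [x <-] [y <-]; exists (x * y); rewrite (star_homM fP). Qed.
Lemma rngZ (c : R[i]) b : rng b -> rng (c *: b).
Proof. by move=> [x <-]; exists (c *: x); rewrite (star_homZ fP). Qed.
Lemma rngS b : rng b -> rng (star b).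
Proof. by move=> [x <-]; exists (star x); rewrite (star_homS fP). Qed.

Lemma rng_pos u : rng (j (mono (chi (pg u)) (pg u))).
Proof.
elim: u => [|s u [x IH]]; first by exists 1; rewrite (star_hom1 fP) pg_nil (hom_chi1 jP).
exists (V s * x); rewrite (star_homM fP) fV IH /hom_gen (hom_pos e_sym e_irr jP).
by rewrite -pg_cons.
Qed.

Lemma rng_chi t : rng (j (mono (chi t) t)).
Proof.
have [t0|[u [v [E H]]]] := char_quotient t.
  exists 0; rewrite (star_hom0 fP) -(hom0 jP t); congr (j (mono _ _)).
  by apply/funext => w; rewrite t0.
have <- : j (mono (chi (pg u)) (pg u)) * star (j (mono (chi (pg v)) (pg v))) = j (mono (chi t) t).
  rewrite (hom_chi_star e_sym e_irr jP) (hom_chi_mul e_sym e_irr jP) -E.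
  by congr (j (mono _ _)); apply/funext => w; rewrite H.
by apply: rngM; [exact: rng_pos|apply: rngS; exact: rng_pos].
Qed.

Definition rng_fun (q : subsets G -> R[i]) := ideal 1%g q /\ rng (j (mono q 1%g)).

Lemma rng_fun_chi t : rng_fun (chi t).
Proof.
have E : j (mono (chi t) t) * star (j (mono (chi t) t)) = j (mono (fun w => chi t w * chi 1%g w) 1%g).
  by rewrite (hom_chi_star e_sym e_irr jP) (hom_chi_mul e_sym e_irr jP) mulgV.
have F : (fun w => chi t w * chi 1%g w) = chi t.
  apply/funext => w; have [Xw|nXw] := pselect (X w); first by rewrite char1E ?mulr1.
  by rewrite !(ideal_out (ideal_char _ _ _)) ?mul0r // => -[].
split.
  rewrite -F; apply: idealMl; last exact: ideal_char.
  exact: ideal_cont (ideal_char _ _ _).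
by rewrite -F -E; apply: rngM; [exact: rng_chi|apply: rngS; exact: rng_chi].
Qed.

Lemma rng_funD p q : rng_fun p -> rng_fun q -> rng_fun (fun w => p w + q w).
Proof.
move=> [Ip rp] [Iq rq]; split; first exact: idealD.
by rewrite (homD jP) //; exact: rngD.
Qed.

Lemma rng_funZ c p : rng_fun p -> rng_fun (fun w => c * p w).
Proof.
move=> [Ip rp]; split; first exact: idealZ.
by rewrite (homZ jP) //; exact: rngZ.
Qed.

Lemma rng_funM p q : rng_fun p -> rng_fun q -> rng_fun (fun w => p w * q w).
Proof.
move=> [Ip rp] [Iq rq]; split; first by apply: idealMl => //; exact: ideal_cont Ip.
by rewrite -(homM1 jP) //; exact: rngM.
Qed.

(** The coordinate h splits Y in two; approximations on the halves are glued with [chi h] and its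
    complement. *)
Lemma step_approx (g : subsets G -> R[i]) (eps : R) (l : seq G) (Y : set (subsets G)) :
  0 < eps -> Y `<=` X ->
  (forall w w', Y w -> Y w' -> agree l w w' -> cn (g w - g w') < eps) ->
  exists2 q, rng_fun q & forall w, Y w -> cn (g w - q w) < eps.
Proof.
move=> e0; elim: l Y => [|h l IH] Y YX Hl.
  have [[w0 Yw0]|N] := pselect (exists w0, Y w0).
    exists (fun w => g w0 * chi 1%g w); first exact/rng_funZ/rng_fun_chi.
    move=> w Yw; rewrite char1E ?mulr1 //; first exact: Hl.
    exact: YX.
  by exists (chi 1%g) => [|w Yw]; [exact: rng_fun_chi|case: N; exists w].
have [||q1 rq1 H1] := IH (fun w => Y w /\ w h).
- by move=> w [/YX].
- move=> w w' [Yw wh] [Yw' wh'] H; apply: Hl => // k; rewrite inE => /orP[/eqP ->|/H//].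
  by rewrite wh wh'.
have [||q2 rq2 H2] := IH (fun w => Y w /\ ~~ w h).
- by move=> w [/YX].
- move=> w w' [Yw wh] [Yw' wh'] H; apply: Hl => // k; rewrite inE => /orP[/eqP ->|/H//].
  by rewrite (negbTE wh) (negbTE wh').
exists (fun w => chi h w * q1 w + (chi 1%g w + (-1) * chi h w) * q2 w).
  apply: rng_funD; first by apply: rng_funM => //; exact: rng_fun_chi.
  apply: rng_funM => //; apply: rng_funD; first exact: rng_fun_chi.
  exact/rng_funZ/rng_fun_chi.
move=> w Yw; have Xw := YX _ Yw; rewrite char1E // charE //.
have [wh|wh] := boolP (w h).
  by rewrite mul1r mulr1 subrr mul0r addr0; exact: H1.
by rewrite mul0r mulr0 add0r addr0 mul1r; exact: H2.
Qed.

Lemma rng_fun_ideal1 g : ideal 1%g g -> rng (j (mono g 1%g)).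
Proof.
move=> Ig; apply: (isometric_range_closed fP (canonical_isometric fP fV)) => eps e0.
have e2 : 0 < eps / 2 by rewrite divr_gt0.
have [l Hl] := cylcont_uniform Xc (ideal_cont Ig) e2.
have [//|q [Iq [a Ha]] Hq] := @step_approx g (eps / 2) l X e2 _ Hl.
exists a; rewrite Ha.
have Iq' := idealZ (-1) Iq.
have -> : j (mono g 1%g) - j (mono q 1%g) = j (mono (fun w => g w + (-1) * q w) 1%g).
  by rewrite (homD jP) // (homZ jP) // scaleN1r.
suff H : nrm (j (mono (fun w => g w + (-1) * q w) 1%g)) <= eps / 2 by lra.
apply: (nrm_hom1 X1 Xt jP (idealD Ig Iq') (ltW e2)).
by move=> w Xw; rewrite mulN1r ltW // Hq.
Qed.

Lemma rng_ideal t g : ideal t g -> rng (j (mono g t)).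
Proof.
move=> Ig; have I1 : ideal 1%g g.
  apply/idealP; split; first exact: ideal_cont Ig.
  by move=> w /(ideal_supp Ig)[Xw _]; split=> //; exact: X1.
(* g delta_t = (g delta_1) (1_t delta_t). *)
have -> : mono g t = mono (fun w => g w * chi t (translate 1^-1%g w)) (1 * t)%g.
  rewrite mul1g; congr mono; apply/funext => w; rewrite invg1 translate1.
  have [->|/eqP gw] := eqVneq (g w) 0; first by rewrite mul0r.
  by have [Xw wt] := ideal_supp Ig gw; rewrite charE // wt mulr1.
rewrite -(homM jP) //; last exact: ideal_char.
by apply: rngM; [exact: rng_fun_ideal1|exact: rng_chi].
Qed.

Lemma canonical_surjective b : exists a, f a = b.
Proof.
apply: (isometric_range_closed fP (canonical_isometric fP fV)) => eps e0.
have [a ea Ha] := crossed_product_dense X1 Xt Xc univB b e0.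
have /eltP[[l [ul Hl]] Ia] := ea.
have [x Hx] : rng (j a).
  rewrite (hom_decomp jP ea ul Hl); elim: l {ul Hl} => [|t l IH].
    by rewrite big_nil; exists 0; exact: (star_hom0 fP).
  by rewrite big_cons; apply: rngD IH; exact: rng_ideal.
by exists x; rewrite Hx.
Qed.

End Range.

End Isomorphism.

Theorem theorem6p7 (R : realType) (S : countType) (e : rel S)
    (e_sym : symmetric e) (e_irr : irreflexive e)
    (no_isolated : forall s : S, exists t : S, opp_adj e s t) :
  (exists (A : cstarType R) (V : S -> A), is_universal_cstar e V) /\
  (exists (B : cstarType R) (j : pcp R (raag e) -> B), is_boundary_quotient j) /\
  (forall (A : cstarType R) (V : S -> A) (B : cstarType R)
      (j : pcp R (raag e) -> B),
    is_universal_cstar e V -> is_boundary_quotient j ->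
    (exists f : A -> B,
      [/\ star_hom f, bijective f &
          forall s : S,
            f (V s) =
            j (pcp_mono (pcp_char R (boundary e) (raag_gen e s)) (raag_gen e s))]) /\
    purely_infinite_simple A).
Proof.
split.
  by have [A [V [univ _]]] := @universal_cstar_exists R S e e_sym; exists A, V.
split.
  have [B [j [univ _]]] := crossed_product_exists R (@boundary1 S e)
    (boundary_translate e_sym e_irr) (boundary_closed e_sym e_irr).
  by exists B, j.
move=> A V B j univA univB.
have [f [fP fV]] := canonical_map e_sym e_irr univA univB.
have iso := canonical_isometric e_sym e_irr univA univB fP fV.
split.
  exists f; split=> //.
  have sur := canonical_surjective e_sym e_irr univA univB fP fV.
  have [g gf] := choice sur.
  exists g => [x|//]; apply/eqP; rewrite -subr_eq0; apply/eqP/nrm_eq0.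
  by rewrite -iso (star_homB fP) gf subrr nrm0.
have [rho [rhoP piP piV]] := canonical_representation e_sym e_irr univB fP fV.
split.
  (* The unit of A goes to the identity operator, which is not 0 because maximal directed sets
     exist. *)
  exists 1 => A0; apply: (@regular_nontrivial R S e e_sym e_irr).
  by rewrite -(star_hom1 piP) A0 (star_hom0 piP).
have [HV _] := univA.
exact: (purely_infinite_of_dense no_isolated HV piP piV (universal_cstar_dense e_sym univA)).
Qed.
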